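(* Let $p$ be a prime number, let $s$ be an even positive integer, and let $k=\mathbb{F}_{p^s}$. Then the ring $W(k)[\![X]\!]/(X^2-pX)$ is in the class $\mathfrak{Q}$ (associated with $k$), i.e. it is (isomorphic in $\hat{\mathcal{C}}$ to) a quotient of the universal deformation ring of some representation over $k$ of some finite group.
   Context: For a finite field $k$ of characteristic $p$, $W(k)$ denotes the ring of Witt vectors over $k$. $\hat{\mathcal{C}}$ denotes the category of all complete noetherian local commutative rings with residue field $k$; morphisms are the local ring homomorphisms inducing the identity on $k$. Every ring in $\hat{\mathcal{C}}$ has a natural $W(k)$-algebra structure. Let $G$ be a finite group and $\bar\rho: G\to \mathrm{GL}_n(k)$ a representation. A lift of $\bar\rho$ to $R\in\hat{\mathcal{C}}$ is a group homomorphism $\rho: G\to \mathrm{GL}_n(R)$ whose composition with the map $\mathrm{GL}_n(R)\to\mathrm{GL}_n(k)$ induced by reduction modulo the maximal ideal equals $\bar\rho$. Two lifts $\rho,\rho'$ are strictly equivalent if $\rho'=K\rho K^{-1}$ for some $K\in\ker(\mathrm{GL}_n(R)\to\mathrm{GL}_n(k))$. The set of strict equivalence classes is $\mathrm{Def}_{\bar\rho}(R)$; this defines a functor $\mathrm{Def}_{\bar\rho}:\hat{\mathcal{C}}\to\mathrm{Sets}$. If it is representable by a ring $R_{\bar\rho}\in\hat{\mathcal{C}}$, then $R_{\bar\rho}$ is called the universal deformation ring of $\bar\rho$. $\mathfrak{U}$ denotes the class of rings in $\hat{\mathcal{C}}$ that occur as universal deformation rings for a representation over $k$ of a finite group. $\mathfrak{Q}$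 denotes the class of rings in $\hat{\mathcal{C}}$ that occur as a quotient of a ring in $\mathfrak{U}$. *)

(* Defs.v *)
From HB Require Import structures.
From mathcomp Require Import all_boot all_order all_fingroup all_algebra all_character.
From mathcomp Require Import finmap.
From mathcomp Require Import boolp.
From mathcomp.multinomials Require Import monalg.

Set Implicit Arguments.
Unset Strict Implicit.
Unset Printing Implicit Defensive.

Import GRing.Theory.
Local Open Scope ring_scope.

(* Polynomials with integer coefficients in variables indexed by I. *)
Notation zpoly I := {malg int[{cmonom I}]}.

Lemma malgUM (I : choiceType) (m1 m2 : {cmonom I}) :
  << mmul m1 m2 >> = << m1 >> * << m2 >> :> zpoly I.
Proof. by rewrite malgM_def fgmulUU mulr1. Qed.


Definition zpolyX (I : choiceType) (i : I) : zpoly I := << ucm i >>.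

Section Evaluation.
Variables (I : choiceType) (R : comNzRingType) (h : I -> R).

Definition cmonom_ev (m : {cmonom I}) : R := \prod_(i <- finsupp m) h i ^+ m i.

Lemma cmonom_evE (d : {fset I}) (m : {cmonom I}) : (finsupp m `<=` d)%fset ->
  cmonom_ev m = \prod_(i <- d) h i ^+ m i.
Proof.
move=> le; rewrite /cmonom_ev (big_fset_incl _ le) // => i _.
by rewrite -cmE_eq0 => /eqP ->; rewrite expr0.
Qed.

Lemma cmonom_ev_mmorphism : mmorphism cmonom_ev.
Proof.
split=> [x y|]; last by rewrite /cmonom_ev mdom1 big_seq_fset0.
rewrite (@cmonom_evE (finsupp x `|` finsupp y)%fset) ?mdomD //.
rewrite (@cmonom_evE (finsupp x `|` finsupp y)%fset x) ?fsubsetUl //.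
rewrite (@cmonom_evE (finsupp x `|` finsupp y)%fset y) ?fsubsetUr //.
by rewrite -big_split; apply: eq_bigr => i _; rewrite cmM exprD.
Qed.

HB.instance Definition _ :=
  isMultiplicative.Build {cmonom I} R cmonom_ev cmonom_ev_mmorphism.

Definition zpoly_ev : zpoly I -> R := mmap (intr : int -> R) cmonom_ev.

HB.instance Definition _ := GRing.RMorphism.on zpoly_ev.

Lemma zpoly_evX i : zpoly_ev (zpolyX i) = h i.
Proof.
rewrite /zpoly_ev /zpolyX mmapU.
rewrite [X in X * _](_ : _ = 1) ?mul1r; last exact: mulr1z.
by rewrite /= /cmonom_ev mdomU big_seq_fset1 cmUU expr1.
Qed.

End Evaluation.

Lemma zpoly_ind (I : choiceType) (F : zpoly I -> Prop) :
    F 1 -> (forall x y, F x -> F y -> F (x - y)) ->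
    (forall x y, F x -> F y -> F (x * y)) -> (forall i, F (zpolyX i)) ->
  forall x, F x.
Proof.
move=> F1 FB FM FX.
have F0 : F 0 by rewrite -(subrr 1); apply: FB.
have FN x : F x -> F (- x) by rewrite -sub0r; apply: FB.
have FD x y : F x -> F y -> F (x + y).
  by move=> Fx Fy; rewrite -[y]opprK; apply: FB => //; apply: FN.
have FMn x n : F x -> F (x *+ n).
  by move=> Fx; elim: n => [|n IHn]; rewrite ?mulr0n // mulrS; apply: FD.
have FU (m : {cmonom I}) : F << m >>.
  move: {2}(mdeg m) (leqnn (mdeg m)) => n.
  elim: n m => [|n IHn] m lemn.
    move: lemn; rewrite leqn0 => /eqP /mdeg_eq0I ->; exact: F1.
  have [->|m1] := eqVneq m (mone : {cmonom I}); first exact: F1.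
  have [i mi] : exists i, m i != 0%N.
    apply: contrapT => m0; move/eqP: m1; apply; apply/eqP/cmP => i.
    by rewrite cm1; apply/eqP; apply: contrapT => /negP mi; apply: m0; exists i.
  have mE : m = mmul (ucm i) (divcm m (ucm i)).
    apply/eqP/cmP => j; rewrite cmM divcmE cmU; case: eqP => [<-|] /=.
      by rewrite subnKC // lt0n.
    by rewrite subn0.
  move: lemn; rewrite {1}mE mdegM mdegU add1n ltnS => lemn.
  have -> : << m >> = zpolyX i * << divcm m (ucm i) >> :> zpoly I.
    by rewrite {1}mE malgUM.
  by apply: FM; [apply: FX | apply: IHn].
have FC (c : int) (m : {cmonom I}) : F << c *g m >>.
  have FCn n : F << n%:Z *g m >>.
    elim: n => [|n IHn]; first by rewrite monalgU0; exact: F0.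
    by rewrite -addn1 PoszD monalgUD; apply: FD; [exact: IHn | exact: FU].
  by case: c => n; rewrite ?NegzE ?monalgUN; [exact: FCn | apply/FN/FCn].
have FS (r : seq {cmonom I}) x : F (\sum_(m <- r) << x@_m *g m >>).
  elim: r => [|m r IHr]; first by rewrite big_nil; exact: F0.
  by rewrite big_cons; apply: FD; [exact: FC | exact: IHr].
by move=> x; rewrite (monalgE x); apply: FS.
Qed.

Lemma zpoly_evK (I : choiceType) (R S : comNzRingType) (h : I -> R)
    (f : {rmorphism R -> S}) x :
  f (zpoly_ev h x) = zpoly_ev (f \o h) x.
Proof.
apply: (@zpoly_ind _ (fun x => f (zpoly_ev h x) = zpoly_ev (f \o h) x)) => {x}.
- by rewrite !rmorph1.
- by move=> x y; rewrite !rmorphB /= => -> ->.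
- by move=> x y; rewrite !rmorphM /= => -> ->.
- by move=> i; rewrite !zpoly_evX.
Qed.

Definition pdvd (A : zmodType) (m : nat) (x : A) := exists z, x = z *+ m.

Section Pdvd.
Variable A : comNzRingType.
Implicit Types (m n : nat) (x y : A).

Lemma pdvd0 m : pdvd m (0 : A). Proof. by exists 0; rewrite mul0rn. Qed.

Lemma pdvdD m x y : pdvd m x -> pdvd m y -> pdvd m (x + y).
Proof. by move=> [u ->] [v ->]; exists (u + v); rewrite mulrnDl. Qed.

Lemma pdvdN m x : pdvd m x -> pdvd m (- x).
Proof. by move=> [u ->]; exists (- u); rewrite mulNrn. Qed.

Lemma pdvdB m x y : pdvd m x -> pdvd m y -> pdvd m (x - y).
Proof. by move=> dx dy; apply: pdvdD => //; apply: pdvdN. Qed.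

Lemma pdvdM m n x y : pdvd m x -> pdvd n y -> pdvd (m * n) (x * y).
Proof.
by move=> [u ->] [v ->]; exists (u * v); rewrite mulrnAl mulrnAr -mulrnA mulnC.
Qed.

Lemma pdvd1 x : pdvd 1 x. Proof. by exists x. Qed.

Lemma pdvdMr m x y : pdvd m x -> pdvd m (x * y).
Proof. by move=> dx; rewrite -[m]muln1; apply: pdvdM => //; apply: pdvd1. Qed.

Lemma pdvdMn m n x : pdvd m x -> pdvd (m * n) (x *+ n).
Proof. by move=> [u ->]; exists u; rewrite -mulrnA. Qed.

Lemma pdvd_sum m (J : Type) (r : seq J) (Q : pred J) (F : J -> A) :
  (forall j, Q j -> pdvd m (F j)) -> pdvd m (\sum_(j <- r | Q j) F j).
Proof. by move=> dF; apply: big_ind => //; [apply: pdvd0|apply: pdvdD]. Qed.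

Lemma pdvd_trans m x y z : pdvd m (x - y) -> pdvd m (y - z) -> pdvd m (x - z).
Proof. by move=> d1 d2; rewrite -(subrKA y); apply: pdvdD. Qed.

Lemma pdvd_sym m x y : pdvd m (x - y) -> pdvd m (y - x).
Proof. by move=> d; rewrite -opprB; apply: pdvdN. Qed.

Variables (p : nat) (p_pr : prime p).

Lemma pdvd_exp n x y : pdvd p (x - y) -> pdvd (p ^ n.+1) (x ^+ (p ^ n) - y ^+ (p ^ n)).
Proof.
move=> dxy; elim: n => [|n IHn]; first by rewrite expn1 expn0 !expr1.
rewrite (expnSr p n) !exprM subrXX expnSr; apply: pdvdM => //.
set a := x ^+ _; set b := y ^+ _.
have dab : pdvd p (a - b).
  by have [u ->] := IHn; exists (u *+ p ^ n); rewrite -mulrnA expnSr.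
have -> : \sum_(i < p) a ^+ (p.-1 - i) * b ^+ i =
    \sum_(i < p) (a ^+ (p.-1 - i) - b ^+ (p.-1 - i)) * b ^+ i + b ^+ p.-1 *+ p.
  rewrite -[X in _ *+ X]card_ord -sumr_const -big_split; apply: eq_bigr => i _ /=.
  rewrite mulrBl -exprD subnK ?subrK //.
  by rewrite -ltnS prednK ?prime_gt0.
apply: pdvdD; last by exists (b ^+ p.-1).
apply: pdvd_sum => i _; apply: pdvdMr; rewrite subrXX; exact: pdvdMr.
Qed.

Lemma pdvd_addp x y : pdvd p ((x + y) ^+ p - (x ^+ p + y ^+ p)).
Proof.
rewrite exprDn -(big_mkord xpredT (fun i => x ^+ (p - i) * y ^+ i *+ 'C(p, i))).
rewrite big_nat_recl // subn0 expr0 mulr1 bin0.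
case: p p_pr => // q q_pr.
rewrite big_nat_recr //= subnn binn expr0 mul1r.
rewrite !mulr1n addrCA addrK big_nat; apply: pdvd_sum => i /andP[_ iq].
have /dvdnP[c ->] : (q.+1 %| 'C(q.+1, i.+1))%N by apply: prime_dvd_bin.
by rewrite mulrnA; eexists.
Qed.

Lemma pdvd_subp x y : pdvd p ((x - y) ^+ p - (x ^+ p - y ^+ p)).
Proof.
have dN : pdvd p (- (y ^+ p) - (- y) ^+ p).
  have := pdvd_addp y (- y).
  by rewrite subrr expr0n eqn0Ngt prime_gt0 //= sub0r opprD; apply.
apply: pdvd_trans (pdvd_addp _ _) _; apply: pdvd_sym.
by rewrite opprD addrACA subrr add0r.
Qed.

Variable f : {rmorphism A -> A}.

Lemma frob_liftB x y : pdvd p (f x - x ^+ p) -> pdvd p (f y - y ^+ p) ->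
  pdvd p (f (x - y) - (x - y) ^+ p).
Proof.
move=> dx dy; rewrite rmorphB; apply: pdvd_trans (pdvd_sym (pdvd_subp _ _)).
by rewrite opprD addrACA -opprD; apply: pdvdB.
Qed.

Lemma frob_liftM x y : pdvd p (f x - x ^+ p) -> pdvd p (f y - y ^+ p) ->
  pdvd p (f (x * y) - (x * y) ^+ p).
Proof.
move=> dx dy; rewrite rmorphM exprMn.
rewrite (_ : _ - _ = (f x - x ^+ p) * f y + (f y - y ^+ p) * x ^+ p).
  by apply: pdvdD; apply: pdvdMr.
by rewrite !mulrBl [f y * _]mulrC [y ^+ p * _]mulrC addrA subrK.
Qed.

Lemma frob_lift_div (S w : nat -> A) :
    (forall x, pdvd p (f x - x ^+ p)) ->
    (forall n, pdvd (p ^ n.+1) (w n.+1 - f (w n))) ->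
    (forall n, let d := w n - \sum_(i < n) S i ^+ (p ^ (n - i)) *+ p ^ i in
      pdvd (p ^ n) d -> S n *+ p ^ n = d) ->
  forall n, \sum_(i < n.+1) S i ^+ (p ^ (n - i)) *+ p ^ i = w n.
Proof.
move=> df dw dS.
have wE n : pdvd (p ^ n) (w n - \sum_(i < n) S i ^+ (p ^ (n - i)) *+ p ^ i) ->
    \sum_(i < n.+1) S i ^+ (p ^ (n - i)) *+ p ^ i = w n.
  by move=> /dS Sn; rewrite big_ord_recr /= subnn expn0 expr1 Sn addrC subrK.
move=> n; apply: (wE); elim: n => [|n /wE wn]; first exact: pdvd1.
apply: pdvd_trans (dw n) _; rewrite -wn rmorph_sum -sumrB.
apply: pdvd_sum => i _; have lein : (i <= n)%N by rewrite -ltnS.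
rewrite rmorphMn rmorphXn /= -mulrnBl.
rewrite (_ : p ^ n.+1 = p ^ (n - i).+1 * p ^ i)%N; last first.
  by rewrite -expnD addSn subnK.
by apply: pdvdMn; rewrite subSn // [X in _ - _ ^+ X]expnS exprM; apply: pdvd_exp.
Qed.

End Pdvd.

Section Frobenius.
Variables (I : choiceType) (p : nat) (p_pr : prime p).

Definition zpoly_frob : zpoly I -> zpoly I := zpoly_ev (fun i => zpolyX i ^+ p).

HB.instance Definition _ := GRing.RMorphism.on zpoly_frob.

Lemma zpoly_frobX i : zpoly_frob (zpolyX i) = zpolyX i ^+ p.
Proof. exact: zpoly_evX. Qed.

Lemma zpoly_frobP x : pdvd p (zpoly_frob x - x ^+ p).
Proof.
apply: (@zpoly_ind I (fun x => pdvd p (zpoly_frob x - x ^+ p))) => {x}.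
- rewrite rmorph1 expr1n subrr; exact: pdvd0.
- by move=> x y; apply: frob_liftB.
- by move=> x y; apply: frob_liftM.
- by move=> i; rewrite zpoly_frobX subrr; apply: pdvd0.
Qed.

End Frobenius.

(* The p-typical Witt polynomials w_n = \sum_(i <= n) p^i a_i^(p^(n-i)). *)
Definition ghost (A : comNzRingType) (p n : nat) (a : nat -> A) : A :=
  \sum_(i < n.+1) a i ^+ (p ^ (n - i)) *+ p ^ i.

(* Coefficientwise division; only meaningful when d divides g. *)
Definition zpoly_div (I : choiceType) (d : nat) (g : zpoly I) : zpoly I :=
  [malg m in msupp g => (g@_m %/ d%:Z)%Z].

(* Recursive solution S of ghost p n S = w n for all n, where dv d x stands for
   the quotient of x by d; ghostK below shows that over zpoly all the divisions
   involved are exact (Dwork's lemma) in the cases used here. *)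
Section UnghostRec.
Variables (A : comNzRingType) (dv : nat -> A -> A) (p : nat) (w : nat -> A).

Fixpoint unghost_seq (n : nat) : seq A :=
  if n is m.+1 then
    let s := unghost_seq m in
    rcons s (dv (p ^ m) (w m - \sum_(i < m) s`_i ^+ (p ^ (m - i)) *+ p ^ i))
  else [::].

Definition unghost_rec (n : nat) : A := (unghost_seq n.+1)`_n.

Lemma size_unghost_seq n : size (unghost_seq n) = n.
Proof. by elim: n => //= n IHn; rewrite size_rcons IHn. Qed.

Lemma nth_unghost_seq n i : (i < n)%N -> (unghost_seq n)`_i = unghost_rec i.
Proof.
elim: n => // n IHn; rewrite ltnS leq_eqVlt => /orP[/eqP-> //|ltin] /=.
by rewrite nth_rcons size_unghost_seq ltin IHn.
Qed.

Lemma unghost_recE n :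
  unghost_rec n =
  dv (p ^ n) (w n - \sum_(i < n) unghost_rec i ^+ (p ^ (n - i)) *+ p ^ i).
Proof.
rewrite {1}/unghost_rec /= nth_rcons size_unghost_seq ltnn eqxx.
by congr (dv _ (_ - _)); apply: eq_bigr => i _; rewrite nth_unghost_seq.
Qed.

End UnghostRec.

Definition unghost (I : choiceType) (p : nat) (w : nat -> zpoly I) : nat -> zpoly I :=
  unghost_rec (@zpoly_div I) p w.

Section Unghost.
Variables (I : choiceType) (p : nat) (p_pr : prime p).
Implicit Types (w : nat -> zpoly I) (x : zpoly I).

Lemma zpoly_mulrn_inj d x y : (0 < d)%N -> x *+ d = y *+ d -> x = y.
Proof.
move=> d_gt0 xy; apply/malgP => m; have {xy} := congr1 (mcoeff m) xy.
by rewrite !raddfMn /=; move/(Num.Theory.pmulrnI d_gt0).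
Qed.

Lemma zpoly_divK d x : (0 < d)%N -> pdvd d x -> zpoly_div d x *+ d = x.
Proof.
move=> d_gt0 [z xz]; apply/malgP => m.
have xm : x@_m = z@_m * d%:Z by rewrite xz raddfMn /= -mulr_natr natz.
rewrite raddfMn /= mcoeffE -mulr_natr natz.
case: (boolP (m \in msupp x)) => [_|/mcoeff_outdom ->]; last by rewrite mul0r.
by rewrite xm mulzK // -lt0n.
Qed.

Lemma ghostK w :
    (forall n, pdvd (p ^ n.+1) (w n.+1 - zpoly_frob p (w n))) ->
  forall n, ghost p n (unghost p w) = w n.
Proof.
move=> dw; apply: (@frob_lift_div _ _ p_pr (zpoly_frob p)) => // [x|n d dd].
  exact: zpoly_frobP.
by rewrite /unghost unghost_recE zpoly_divK // expn_gt0 prime_gt0.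
Qed.

End Unghost.

Lemma ghost_rmorph (A B : comNzRingType) (f : {rmorphism A -> B}) p n a :
  f (ghost p n a) = ghost p n (f \o a).
Proof.
by rewrite /ghost rmorph_sum; apply: eq_bigr => i _; rewrite rmorphMn rmorphXn.
Qed.

Lemma ghost_ext (A : comNzRingType) p n (a b : nat -> A) :
  a =1 b -> ghost p n a = ghost p n b.
Proof. by move=> ab; apply: eq_bigr => i _; rewrite ab. Qed.

Lemma ghostS (A : comNzRingType) p n (a : nat -> A) :
  ghost p n.+1 a = ghost p n (fun i => a i ^+ p) + a n.+1 *+ p ^ n.+1.
Proof.
rewrite /ghost big_ord_recr /= subnn expn0 expr1; congr (_ + _).
by apply: eq_bigr => i _; rewrite -exprM -expnS subSn // -ltnS.
Qed.

Lemma ghost_inj (A : comNzRingType) p (a b : nat -> A) : (0 < p)%N ->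
    (forall d (x y : A), (0 < d)%N -> x *+ d = y *+ d -> x = y) ->
  (forall n, ghost p n a = ghost p n b) -> a =1 b.
Proof.
move=> p_gt0 tfA ab n; elim/ltn_ind: n => n IHn.
have := ab n; rewrite /ghost !big_ord_recr /= subnn expn0 !expr1.
rewrite (eq_bigr (fun i : 'I_n => b i ^+ (p ^ (n - i)) *+ p ^ i)); last first.
  by move=> i _; rewrite IHn.
by move/addrI/tfA; apply; rewrite expn_gt0 p_gt0.
Qed.

Section GhostFrobenius.
Variables (A : comNzRingType) (p : nat) (f : {rmorphism A -> A}) (a b : nat -> A).
Hypotheses (fa : forall i, f (a i) = a i ^+ p) (fb : forall i, f (b i) = b i ^+ p).

Lemma ghost_frob (c : nat -> A) (fc : forall i, f (c i) = c i ^+ p) n :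
  ghost p n.+1 c = f (ghost p n c) + c n.+1 *+ p ^ n.+1.
Proof.
by rewrite ghostS ghost_rmorph; congr (_ + _); apply: ghost_ext => i /=.
Qed.

Lemma ghost_addP n : pdvd (p ^ n.+1)
  (ghost p n.+1 a + ghost p n.+1 b - f (ghost p n a + ghost p n b)).
Proof.
rewrite !(ghost_frob fa) !(ghost_frob fb) rmorphD addrACA [X in pdvd _ X]addrC addKr.
by apply: pdvdD; eexists.
Qed.

Lemma ghost_oppP n : pdvd (p ^ n.+1) (- ghost p n.+1 a - f (- ghost p n a)).
Proof.
rewrite (ghost_frob fa) rmorphN opprK opprD addrAC addNr add0r.
by apply: pdvdN; eexists.
Qed.

Lemma ghost_mulP n : pdvd (p ^ n.+1)
  (ghost p n.+1 a * ghost p n.+1 b - f (ghost p n a * ghost p n b)).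
Proof.
rewrite (ghost_frob fa) (ghost_frob fb) rmorphM.
have mulBE (F G x y : A) : (F + x) * (G + y) - F * G = x * (G + y) + y * F.
  by rewrite mulrDl [F * (_ + _)]mulrDr addrC -addrA addKr addrC (mulrC F).
by rewrite mulBE; apply: pdvdD; apply: pdvdMr; eexists.
Qed.

End GhostFrobenius.

Notation wpoly := {malg int[{cmonom (bool * nat)%type}]}.

Definition wvar (b : bool) (n : nat) : wpoly := zpolyX (b, n).

(* The universal integral polynomials S_n, I_n, P_n giving the coordinates of a
   sum, an opposite and a product of Witt vectors; they are characterized by
   witt_addpP, witt_opppP and witt_mulpP. The variables wvar false and
   wvar true stand for the coordinates of the first and second operand. *)
HB.lock Definition witt_addp (p : nat) : nat -> wpoly :=
  unghost p (fun n => ghost p n (wvar false) + ghost p n (wvar true)).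

HB.lock Definition witt_oppp (p : nat) : nat -> wpoly :=
  unghost p (fun n => - ghost p n (wvar false)).

HB.lock Definition witt_mulp (p : nat) : nat -> wpoly :=
  unghost p (fun n => ghost p n (wvar false) * ghost p n (wvar true)).

Section WittPoly.
Variables (p : nat) (p_pr : prime p).

Let frobX b n : zpoly_frob p (wvar b n) = wvar b n ^+ p.
Proof. exact: zpoly_frobX. Qed.

Lemma witt_addpP n :
  ghost p n (witt_addp p) = ghost p n (wvar false) + ghost p n (wvar true).
Proof.
rewrite unlock; apply: (ghostK p_pr) => m; exact: (ghost_addP (frobX false) (frobX true)).
Qed.

Lemma witt_opppP n : ghost p n (witt_oppp p) = - ghost p n (wvar false).
Proof.
rewrite unlock; apply: (ghostK p_pr) => m; exact: (ghost_oppP (frobX false)).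
Qed.

Lemma witt_mulpP n :
  ghost p n (witt_mulp p) = ghost p n (wvar false) * ghost p n (wvar true).
Proof.
rewrite unlock; apply: (ghostK p_pr) => m; exact: (ghost_mulP (frobX false) (frobX true)).
Qed.

End WittPoly.

Section WittOps.
Variables (p : nat) (p_pr : prime p).

Section Ops.
Variable R : comNzRingType.
Implicit Types a b c : nat -> R.

Definition wev a b : wpoly -> R :=
  zpoly_ev (fun v : bool * nat => if v.1 then b v.2 else a v.2).

HB.instance Definition _ a b := GRing.RMorphism.on (wev a b).

Definition wadd a b n := wev a b (witt_addp p n).
Definition wopp a n := wev a a (witt_oppp p n).
Definition wmul a b n := wev a b (witt_mulp p n).
Definition wzero (n : nat) : R := 0.
Definition wone (n : nat) : R := (n == 0%N)%:R.

Lemma wevF a b n : wev a b (wvar false n) = a n.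
Proof. exact: zpoly_evX. Qed.
Lemma wevT a b n : wev a b (wvar true n) = b n.
Proof. exact: zpoly_evX. Qed.

Let ghostF a b n : wev a b (ghost p n (wvar false)) = ghost p n a.
Proof. by rewrite ghost_rmorph; apply: ghost_ext => i /=; rewrite wevF. Qed.
Let ghostT a b n : wev a b (ghost p n (wvar true)) = ghost p n b.
Proof. by rewrite ghost_rmorph; apply: ghost_ext => i /=; rewrite wevT. Qed.

Lemma ghost_wadd n a b : ghost p n (wadd a b) = ghost p n a + ghost p n b.
Proof.
rewrite -(ghostF a b) -(ghostT a b) -(rmorphD (wev a b)) -(witt_addpP p_pr).
by rewrite ghost_rmorph.
Qed.

Lemma ghost_wopp n a : ghost p n (wopp a) = - ghost p n a.
Proof.
by rewrite -(ghostF a a) -(rmorphN (wev a a)) -(witt_opppP p_pr) ghost_rmorph.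
Qed.

Lemma ghost_wmul n a b : ghost p n (wmul a b) = ghost p n a * ghost p n b.
Proof.
rewrite -(ghostF a b) -(ghostT a b) -(rmorphM (wev a b)) -(witt_mulpP p_pr).
by rewrite ghost_rmorph.
Qed.

Lemma ghost_wzero n : ghost p n wzero = 0.
Proof.
rewrite /ghost big1 // => i _.
by rewrite expr0n expn_eq0 eqn0Ngt prime_gt0 // mul0rn.
Qed.

Lemma ghost_wone n : ghost p n wone = 1.
Proof.
rewrite /ghost big_ord_recl expr1n big1 ?addr0 // => i _.
by rewrite expr0n expn_eq0 eqn0Ngt prime_gt0 // mul0rn.
Qed.

End Ops.

Section Morph.
Variables (A B : comNzRingType) (f : {rmorphism A -> B}).

Lemma wev_morph (a b : nat -> A) x : f (wev a b x) = wev (f \o a) (f \o b) x.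
Proof.
rewrite /wev zpoly_evK; congr (zpoly_ev _ x).
by apply: funext => -[[] n].
Qed.

Lemma wadd_morph a b : f \o wadd a b = wadd (f \o a) (f \o b).
Proof. by apply: funext => n; apply: wev_morph. Qed.

Lemma wopp_morph a : f \o wopp a = wopp (f \o a).
Proof. by apply: funext => n; apply: wev_morph. Qed.

Lemma wmul_morph a b : f \o wmul a b = wmul (f \o a) (f \o b).
Proof. by apply: funext => n; apply: wev_morph. Qed.

Lemma wzero_morph : f \o @wzero A = @wzero B.
Proof. by apply: funext => n /=; rewrite rmorph0. Qed.

Lemma wone_morph : f \o @wone A = @wone B.
Proof. by apply: funext => n /=; rewrite rmorph_nat. Qed.

End Morph.

(* The ring axioms hold over torsion-free rings since the ghost map is injective
   there, hence over every R, as R is a quotient of zpoly R. *)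
Section TorsionFree.
Variables (A : comNzRingType).
Hypothesis tfA : forall d (x y : A), (0 < d)%N -> x *+ d = y *+ d -> x = y.
Implicit Types a b c : nat -> A.

Let gE := (ghost_wadd, ghost_wmul, ghost_wopp, ghost_wzero, ghost_wone).

Let ghostI a b : (forall n, ghost p n a = ghost p n b) -> a = b.
Proof. by move=> ab; apply/funext/(ghost_inj (prime_gt0 p_pr) tfA). Qed.

Lemma waddA_tf : associative (@wadd A).
Proof. by move=> a b c; apply: ghostI => n; rewrite !gE addrA. Qed.
Lemma waddC_tf : commutative (@wadd A).
Proof. by move=> a b; apply: ghostI => n; rewrite !gE addrC. Qed.
Lemma wadd0_tf : left_id (@wzero A) (@wadd A).
Proof. by move=> a; apply: ghostI => n; rewrite !gE add0r. Qed.
Lemma waddN_tf : left_inverse (@wzero A) (@wopp A) (@wadd A).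
Proof. by move=> a; apply: ghostI => n; rewrite !gE addNr. Qed.
Lemma wmulA_tf : associative (@wmul A).
Proof. by move=> a b c; apply: ghostI => n; rewrite !gE mulrA. Qed.
Lemma wmulC_tf : commutative (@wmul A).
Proof. by move=> a b; apply: ghostI => n; rewrite !gE mulrC. Qed.
Lemma wmul1_tf : left_id (@wone A) (@wmul A).
Proof. by move=> a; apply: ghostI => n; rewrite !gE mul1r. Qed.
Lemma wmulD_tf : left_distributive (@wmul A) (@wadd A).
Proof.
move=> a b c; apply: ghostI => n.
by rewrite ghost_wmul !ghost_wadd !ghost_wmul mulrDl.
Qed.

End TorsionFree.

Section RingLaws.
Variable R : comNzRingType.

Let tf := @zpoly_mulrn_inj R.
Let pi : {rmorphism zpoly R -> R} := zpoly_ev (@id R).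

Let piP (a : nat -> R) : exists a', a = pi \o a'.
Proof.
by exists (fun n => zpolyX (a n)); apply: funext => n /=; rewrite zpoly_evX.
Qed.

Let mE := (wzero_morph pi, wone_morph pi).

Lemma waddA : associative (@wadd R).
Proof.
move=> a b c; have [[a' ->] [b' ->] [c' ->]] := And3 (piP a) (piP b) (piP c).
by rewrite -!wadd_morph (waddA_tf tf).
Qed.
Lemma waddC : commutative (@wadd R).
Proof.
move=> a b; have [[a' ->] [b' ->]] := conj (piP a) (piP b).
by rewrite -!wadd_morph (waddC_tf tf).
Qed.
Lemma wadd0 : left_id (@wzero R) (@wadd R).
Proof.
by move=> a; have [a' ->] := piP a; rewrite -(wzero_morph pi) -wadd_morph (wadd0_tf tf).
Qed.
Lemma waddN : left_inverse (@wzero R) (@wopp R) (@wadd R).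
Proof.
move=> a; have [a' ->] := piP a.
by rewrite -(wzero_morph pi) -wopp_morph -wadd_morph (waddN_tf tf).
Qed.
Lemma wmulA : associative (@wmul R).
Proof.
move=> a b c; have [[a' ->] [b' ->] [c' ->]] := And3 (piP a) (piP b) (piP c).
by rewrite -!wmul_morph (wmulA_tf tf).
Qed.
Lemma wmulC : commutative (@wmul R).
Proof.
move=> a b; have [[a' ->] [b' ->]] := conj (piP a) (piP b).
by rewrite -!wmul_morph (wmulC_tf tf).
Qed.
Lemma wmul1 : left_id (@wone R) (@wmul R).
Proof.
by move=> a; have [a' ->] := piP a; rewrite -(wone_morph pi) -wmul_morph (wmul1_tf tf).
Qed.
Lemma wmulD : left_distributive (@wmul R) (@wadd R).
Proof.
move=> a b c; have [[a' ->] [b' ->] [c' ->]] := And3 (piP a) (piP b) (piP c).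
by rewrite -wadd_morph -!wmul_morph -wadd_morph (wmulD_tf tf).
Qed.

End RingLaws.
End WittOps.

(* The ring of p-typical Witt vectors over R. The primality proof is a parameter
   of the type because the ring axioms depend on it. *)
Record witt (p : nat) (p_pr : prime p) (R : comNzRingType) :=
  Witt { wcoef : nat -> R }.
Arguments Witt {p} p_pr {R}.

Section WittRing.
Variables (p : nat) (p_pr : prime p) (R : comNzRingType).
Local Notation W := (witt p_pr R).

HB.instance Definition _ := [isNew for @wcoef p p_pr R].
HB.instance Definition _ := [Choice of W by <:].

Let wcoef_inj : injective (@wcoef p p_pr R). Proof. exact: val_inj. Qed.

Definition witt_zero : W := Witt p_pr (@wzero R).
Definition witt_one : W := Witt p_pr (@wone R).
Definition witt_opp (x : W) : W := Witt p_pr (wopp p (wcoef x)).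
Definition witt_add (x y : W) : W := Witt p_pr (wadd p (wcoef x) (wcoef y)).
Definition witt_mul (x y : W) : W := Witt p_pr (wmul p (wcoef x) (wcoef y)).

Let addA : associative witt_add.
Proof. by move=> x y z; apply: wcoef_inj; apply: waddA. Qed.
Let addC : commutative witt_add.
Proof. by move=> x y; apply: wcoef_inj; apply: waddC. Qed.
Let add0 : left_id witt_zero witt_add.
Proof. by move=> x; apply: wcoef_inj; apply: wadd0. Qed.
Let addN : left_inverse witt_zero witt_opp witt_add.
Proof. by move=> x; apply: wcoef_inj; apply: waddN. Qed.
Let mulA : associative witt_mul.
Proof. by move=> x y z; apply: wcoef_inj; apply: wmulA. Qed.
Let mulC : commutative witt_mul.
Proof. by move=> x y; apply: wcoef_inj; apply: wmulC. Qed.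
Let mul1 : left_id witt_one witt_mul.
Proof. by move=> x; apply: wcoef_inj; apply: wmul1. Qed.
Let mulD : left_distributive witt_mul witt_add.
Proof. by move=> x y z; apply: wcoef_inj; apply: wmulD. Qed.
Let one_neq0 : witt_one != witt_zero.
Proof.
by apply/eqP => /(congr1 (fun x => wcoef x 0%N)) /eqP; rewrite /= oner_eq0.
Qed.

HB.instance Definition _ := GRing.isZmodule.Build W addA addC add0 addN.
HB.instance Definition _ :=
  GRing.Zmodule_isComNzRing.Build W mulA mulC mul1 mulD one_neq0.

Lemma ghost_wittD n (x y : W) :
  ghost p n (wcoef (x + y)) = ghost p n (wcoef x) + ghost p n (wcoef y).
Proof. exact: ghost_wadd. Qed.

Lemma ghost_wittM n (x y : W) :
  ghost p n (wcoef (x * y)) = ghost p n (wcoef x) * ghost p n (wcoef y).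
Proof. exact: ghost_wmul. Qed.

Lemma ghost_witt1 n : ghost p n (wcoef (1 : W)) = 1.
Proof. exact: ghost_wone. Qed.

Lemma ghost_wittB n (x y : W) :
  ghost p n (wcoef (x - y)) = ghost p n (wcoef x) - ghost p n (wcoef y).
Proof. by rewrite ghost_wittD; congr (_ + _); apply: ghost_wopp. Qed.

Lemma ghost0 (A : comNzRingType) (a : nat -> A) : ghost p 0 a = a 0%N.
Proof. by rewrite /ghost big_ord1 expr1. Qed.

Definition witt_res (x : W) : R := wcoef x 0%N.

Lemma witt_res_zmod : zmod_morphism witt_res.
Proof. by move=> x y; rewrite /witt_res -!ghost0 ghost_wittB. Qed.

Lemma witt_res_monoid : monoid_morphism witt_res.
Proof.
by split=> [|x y]; rewrite /witt_res -!ghost0 (ghost_witt1, ghost_wittM).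
Qed.

HB.instance Definition _ := GRing.isZmodMorphism.Build W R witt_res witt_res_zmod.
HB.instance Definition _ := GRing.isMonoidMorphism.Build W R witt_res witt_res_monoid.

End WittRing.

(* Formal power series, given by their coefficients. *)
Record fps (A : Type) := Fps { fcoef : nat -> A }.

Section FpsRing.
Variable A : comNzRingType.

HB.instance Definition _ := [isNew for @fcoef A].
HB.instance Definition _ := [Choice of fps A by <:].
Implicit Types f g h : fps A.

Lemma fpsP f g : (forall n, fcoef f n = fcoef g n) -> f = g.
Proof. by move=> fg; apply: val_inj; apply: funext. Qed.

Definition fps_zero : fps A := Fps (fun=> 0).
Definition fps_one : fps A := Fps (fun n => (n == 0%N)%:R).
Definition fps_opp f : fps A := Fps (fun n => - fcoef f n).
Definition fps_add f g : fps A := Fps (fun n => fcoef f n + fcoef g n).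
Definition fps_mul f g : fps A :=
  Fps (fun n => \sum_(i < n.+1) fcoef f i * fcoef g (n - i)).

Definition fpsX : fps A := Fps (fun n => (n == 1%N)%:R).

Let trunc N f : {poly A} := \poly_(i < N) fcoef f i.

Let truncE N f n : (n < N)%N -> (trunc N f)`_n = fcoef f n.
Proof. by move=> ltnN; rewrite coef_poly ltnN. Qed.

Let mulE N f g n : (n < N)%N -> (trunc N f * trunc N g)`_n = fcoef (fps_mul f g) n.
Proof.
move=> ltnN; rewrite coefM; apply: eq_bigr => i _.
rewrite !truncE // ?(leq_ltn_trans (leq_subr _ _)) //.
by apply: leq_ltn_trans ltnN; rewrite -ltnS.
Qed.

Let addA : associative fps_add.
Proof. by move=> f g h; apply: fpsP => n /=; rewrite addrA. Qed.
Let addC : commutative fps_add.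
Proof. by move=> f g; apply: fpsP => n /=; rewrite addrC. Qed.
Let add0 : left_id fps_zero fps_add.
Proof. by move=> f; apply: fpsP => n /=; rewrite add0r. Qed.
Let addN : left_inverse fps_zero fps_opp fps_add.
Proof. by move=> f; apply: fpsP => n /=; rewrite addNr. Qed.
Let mulA : associative fps_mul.
Proof.
move=> f g h; apply: fpsP => n; pose T := trunc n.+1.
transitivity ((T f * (T g * T h))`_n).
  rewrite coefM; apply: eq_bigr => i _; rewrite truncE // (@mulE n.+1) //.
  by rewrite ltnS leq_subr.
rewrite mulrA coefM; apply: eq_bigr => i _; rewrite (@mulE n.+1) // truncE //.
by rewrite ltnS leq_subr.
Qed.
Let mulC : commutative fps_mul.
Proof. by move=> f g; apply: fpsP => n; rewrite -!(@mulE n.+1) // mulrC. Qed.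
Let mul1 : left_id fps_one fps_mul.
Proof.
move=> f; apply: fpsP => n /=; rewrite big_ord_recl /= mul1r subn0 big1 ?addr0 //.
by move=> i _; rewrite mul0r.
Qed.
Let mulD : left_distributive fps_mul fps_add.
Proof.
move=> f g h; apply: fpsP => n /=; rewrite -big_split; apply: eq_bigr => i _ /=.
by rewrite mulrDl.
Qed.
Let one_neq0 : fps_one != fps_zero.
Proof.
by apply/eqP => /(congr1 (fun f => fcoef f 0%N)) /eqP; rewrite /= oner_eq0.
Qed.

HB.instance Definition _ := GRing.isZmodule.Build (fps A) addA addC add0 addN.
HB.instance Definition _ :=
  GRing.Zmodule_isComNzRing.Build (fps A) mulA mulC mul1 mulD one_neq0.

Definition fps_coef0 f : A := fcoef f 0%N.

Lemma fps_coef0_zmod : zmod_morphism fps_coef0. Proof. by []. Qed.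

Lemma fps_coef0_monoid : monoid_morphism fps_coef0.
Proof. by split=> // f g; rewrite /fps_coef0 /= big_ord1. Qed.

HB.instance Definition _ :=
  GRing.isZmodMorphism.Build (fps A) A fps_coef0 fps_coef0_zmod.
HB.instance Definition _ :=
  GRing.isMonoidMorphism.Build (fps A) A fps_coef0 fps_coef0_monoid.

Lemma fps_coef0X : fps_coef0 fpsX = 0. Proof. by []. Qed.

End FpsRing.

Arguments fpsX {A}.

(* Classically, every commutative ring carries the comUnitRingType structure. *)
Section ClassicalUnits.
Variable A : comNzRingType.
Implicit Types x y : A.

Definition cunit x : bool := `[< exists y, y * x = 1 >].

Definition cinv x : A :=
  if pselect (exists y, y * x = 1) is left xV then projT1 (cid xV) else x.

Lemma cmulVx : {in cunit, left_inverse 1 cinv *%R}.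
Proof.
move=> x /asboolP xV; rewrite /cinv; case: pselect => // xV'.
by case: cid.
Qed.

Lemma cunitPl x y : y * x = 1 -> cunit x.
Proof. by move=> yx1; apply/asboolP; exists y. Qed.

Lemma cinv_out : {in [predC cunit], cinv =1 id}.
Proof.
by move=> x; rewrite inE /= /cinv => /asboolPn xNV; case: pselect.
Qed.

End ClassicalUnits.

Section PrincipalQuotient.
Variables (p : nat) (p_pr : prime p) (k : comNzRingType).

(* W(k)[[X]] *)
Definition witt_fps := fps (witt p_pr k).
HB.instance Definition _ := GRing.ComNzRing.on witt_fps.

Definition XpX_gen : witt_fps := fpsX ^+ 2 - p%:R * fpsX.

Definition XpX_ideal : {pred witt_fps} := fun f => `[< exists g, f = g * XpX_gen >].

Definition witt_fps_res (f : witt_fps) : k := witt_res (fps_coef0 f).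
HB.instance Definition _ := GRing.RMorphism.copy witt_fps_res
  (@witt_res p p_pr k \o @fps_coef0 (witt p_pr k)).

Lemma witt_fps_res_gen : witt_fps_res XpX_gen = 0.
Proof.
rewrite /XpX_gen rmorphB rmorphXn rmorphM /=.
by rewrite /witt_fps_res fps_coef0X rmorph0 mulr0 expr0n subr0.
Qed.

Lemma witt_fps_res_ideal f : f \in XpX_ideal -> witt_fps_res f = 0.
Proof. by move=> /asboolP[g ->]; rewrite rmorphM /= witt_fps_res_gen mulr0. Qed.

Lemma XpX_idealr_closed : idealr_closed XpX_ideal.
Proof.
split=> [||a u v].
- by apply/asboolP; exists 0; rewrite mul0r.
- by apply/negP => /witt_fps_res_ideal /eqP; rewrite rmorph1 oner_eq0.
move=> /asboolP[f ->] /asboolP[g ->]; apply/asboolP; exists (a * f + g).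
by rewrite mulrDl mulrA.
Qed.

HB.instance Definition _ := isIdealr.Build witt_fps XpX_ideal XpX_idealr_closed.

(* W(k)[[X]] / (X^2 - pX) *)
Definition XpX_quo := {ideal_quot XpX_ideal}.
HB.instance Definition _ := GRing.ComNzRing.on XpX_quo.
HB.instance Definition _ := GRing.ComNzRing_hasMulInverse.Build XpX_quo
  (@cmulVx XpX_quo) (@cunitPl XpX_quo) (@cinv_out XpX_quo).

Local Open Scope quotient_scope.

Definition XpX_residue (x : XpX_quo) : k := witt_fps_res (generic_quotient.repr x).

Lemma XpX_residue_pi (f : witt_fps) : XpX_residue (\pi_XpX_quo f) = witt_fps_res f.
Proof.
apply/eqP; rewrite -subr_eq0 -rmorphB; apply/eqP/witt_fps_res_ideal.
by rewrite Quotient.idealrBE reprK.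
Qed.

Lemma XpX_residue_zmod : zmod_morphism XpX_residue.
Proof.
move=> x y; rewrite -[x]reprK -[y]reprK -rmorphB !XpX_residue_pi.
exact: rmorphB.
Qed.

Lemma XpX_residue_monoid : monoid_morphism XpX_residue.
Proof.
split=> [|x y]; first by rewrite -(rmorph1 \pi_XpX_quo) XpX_residue_pi rmorph1.
by rewrite -[x]reprK -[y]reprK -rmorphM !XpX_residue_pi rmorphM.
Qed.

HB.instance Definition _ :=
  GRing.isZmodMorphism.Build XpX_quo k XpX_residue XpX_residue_zmod.
HB.instance Definition _ :=
  GRing.isMonoidMorphism.Build XpX_quo k XpX_residue XpX_residue_monoid.

End PrincipalQuotient.

(* A ring with a map to k, which for local rings identifies k with the residue
   field; the maximal ideal is then the kernel of this map. Requiring unit rings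
   is no restriction, see cunit above. *)
Record augRing (k : fieldType) := AugRing {
  aug_ring :> comUnitRingType;
  residue : {rmorphism aug_ring -> k}
}.

Section CompleteLocal.
Variables (k : fieldType) (A : augRing k).

Definition max_ideal (x : A) : Prop := residue A x = 0.

Definition is_ideal (I : A -> Prop) : Prop :=
  [/\ I 0, forall x y, I x -> I y -> I (x + y) & forall a x, I x -> I (a * x)].

Fixpoint max_ideal_pow (n : nat) : A -> Prop :=
  if n is m.+1 then
    fun x => exists r (a b : 'I_r -> A),
      [/\ forall i, max_ideal (a i), forall i, max_ideal_pow m (b i)
        & x = \sum_(i < r) a i * b i]
  else fun=> True.

Definition is_local : Prop :=
  (forall c, exists x, residue A x = c) /\
  (forall x, ~ max_ideal x -> x \is a GRing.unit).

Definition is_noetherian : Prop :=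
  forall I, is_ideal I -> exists r (g : 'I_r -> A),
    forall x, I x <-> exists c : 'I_r -> A, x = \sum_(i < r) c i * g i.

(* Bijectivity of the canonical map from A to the inverse limit of the quotients
   A/m^n. *)
Definition is_complete : Prop :=
  (forall x, (forall n, max_ideal_pow n x) -> x = 0) /\
  (forall u : nat -> A, (forall n, max_ideal_pow n (u n.+1 - u n)) ->
    exists l, forall n, max_ideal_pow n (l - u n)).

Definition in_Chat : Prop := [/\ is_local, is_noetherian & is_complete].

End CompleteLocal.

(* The objects of the category of complete noetherian local rings with residue
   field k. *)
Record Chat (k : fieldType) := MkChat {
  Chat_aug :> augRing k;
  ChatP : in_Chat Chat_aug
}.

(* Compatibility with the residue maps says at once that the morphism is local and
   that it induces the identity on k. *)
Record aug_hom (k : fieldType) (A B : augRing k) := AugHom {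
  aug_fun :> {rmorphism A -> B};
  aug_funP : forall x, residue B (aug_fun x) = residue A x
}.

Section Comp.
Variables (k : fieldType) (A B C : augRing k).
Variables (g : aug_hom B C) (f : aug_hom A B).

Lemma aug_compP x : residue C ((g \o f) x) = residue A x.
Proof. by rewrite /= !aug_funP. Qed.

Definition aug_comp : aug_hom A C :=
  @AugHom k A C (GRing.RMorphism.clone A C (g \o f) _) aug_compP.

End Comp.

Section InvMx.

Lemma invmx_uniq (R : comUnitRingType) n (K L : 'M[R]_n) :
  K *m L = 1%:M -> K \in unitmx /\ invmx K = L.
Proof.
move=> KL1; have [uK _] := mulmx1_unit KL1; split=> //.
by rewrite -[invmx K]mulmx1 -KL1 mulKmx.
Qed.

Lemma map_mx_unit (R S : comUnitRingType) (f : {rmorphism R -> S}) n (K : 'M[R]_n) :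
  K \in unitmx -> map_mx f K \in unitmx /\ invmx (map_mx f K) = map_mx f (invmx K).
Proof.
by move=> uK; apply: invmx_uniq; rewrite -map_mxM mulmxV // map_mx1.
Qed.

End InvMx.

Section Deformations.
Variables (k : fieldType) (gT : finGroupType) (G : {group gT}) (n : nat).
Variable rhobar : mx_representation k G n.

Record lift (A : augRing k) := Lift {
  lift_rep :> mx_representation A G n;
  liftP : {in G, forall g, map_mx (residue A) (lift_rep g) = rhobar g}
}.

HB.instance Definition _ (A : augRing k) := gen_eqMixin (lift A).
HB.instance Definition _ (A : augRing k) := gen_choiceMixin (lift A).

Section StrictEquivalence.
Variable A : augRing k.

Definition strict_equiv (rho rho' : lift A) : Prop :=
  exists K : 'M[A]_n,
    [/\ K \in unitmx, map_mx (residue A) K = 1%:M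
      & {in G, forall g, rho' g = K *m rho g *m invmx K}].

Lemma strict_equiv_refl rho : strict_equiv rho rho.
Proof.
exists 1%:M; rewrite unitmx1 map_mx1; split=> // g _.
by rewrite mul1mx invmx1 mulmx1.
Qed.

Lemma strict_equiv_sym rho rho' : strict_equiv rho rho' -> strict_equiv rho' rho.
Proof.
move=> [K [uK K1 rE]]; exists (invmx K).
split=> [||g Gg]; first by rewrite unitmx_inv.
  by have [_ <-] := map_mx_unit (residue A) uK; rewrite K1 invmx1.
by rewrite invmxK rE // !mulmxA mulVmx // mul1mx mulmxKV.
Qed.

Lemma strict_equiv_trans rho2 rho1 rho3 :
  strict_equiv rho1 rho2 -> strict_equiv rho2 rho3 -> strict_equiv rho1 rho3.
Proof.
move=> [K [uK K1 rE]] [L [uL L1 sE]]; exists (L *m K).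
split=> [||g Gg]; first by rewrite unitmx_mul uL.
  by rewrite map_mxM L1 K1 mulmx1.
have [_ ->] : L *m K \in unitmx /\ invmx (L *m K) = invmx K *m invmx L.
  by apply: invmx_uniq; rewrite mulmxA mulmxK // mulmxV.
by rewrite sE // rE // !mulmxA.
Qed.

Definition strict_equivb (rho rho' : lift A) : bool := `[< strict_equiv rho rho' >].

Lemma strict_equivb_refl : reflexive strict_equivb.
Proof. by move=> rho; apply/asboolP/strict_equiv_refl. Qed.

Lemma strict_equivb_sym : symmetric strict_equivb.
Proof. by move=> rho rho'; apply/asboolP/asboolP; apply: strict_equiv_sym. Qed.

Lemma strict_equivb_trans : transitive strict_equivb.
Proof.
move=> rho2 rho1 rho3 /asboolP r12 /asboolP r23.
by apply/asboolP/(strict_equiv_trans r12).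
Qed.

Canonical strict_equiv_rel :=
  EquivRel strict_equivb strict_equivb_refl strict_equivb_sym strict_equivb_trans.

(* Strict equivalence classes of lifts to A. *)
Definition Def := {eq_quot strict_equiv_rel}%qT.

End StrictEquivalence.

Local Open Scope quotient_scope.

Section Functor.
Variables (A B : augRing k) (f : aug_hom A B).

Lemma lift_mapP (rho : lift A) :
  {in G, forall g, map_mx (residue B) (map_repr f rho g) = rhobar g}.
Proof.
move=> g Gg; rewrite -(liftP rho Gg); apply/matrixP => i j.
by rewrite !mxE aug_funP.
Qed.

Definition lift_map (rho : lift A) : lift B := Lift (@lift_mapP rho).

Definition Def_map (x : Def A) : Def B :=
  \pi_(Def B) (lift_map (generic_quotient.repr x)).

Lemma Def_map_pi (rho : lift A) : Def_map (\pi_(Def A) rho) = \pi_(Def B) (lift_map rho).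
Proof.
apply/eqmodP; apply/asboolP.
have /eqmodP/asboolP[K [uK K1 rE]] := reprK (\pi_(Def A) rho).
exists (map_mx f K); have [ufK fKV] := map_mx_unit f uK; split=> [||g Gg] //.
  by rewrite -K1; apply/matrixP => i j; rewrite !mxE aug_funP.
by rewrite fKV /= /map_repr_mx rE // !map_mxM.
Qed.

End Functor.

(* R represents the deformation functor: there is a bijection, natural in A,
   between the morphisms from R to A and the strict equivalence classes of
   lifts to A. *)
Definition represents (R : Chat k) : Prop :=
  exists eta : forall A : Chat k, aug_hom R A -> Def A,
    (forall A, bijective (eta A)) /\
    (forall (A B : Chat k) (f : aug_hom A B) (h : aug_hom R A),
       eta B (aug_comp f h) = Def_map f (eta A h)).

End Deformations.

(* The class of universal deformation rings of representations of finite groups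
   over k; the degree of a representation is taken to be positive. *)
Definition frakU (k : finFieldType) (R : Chat k) : Prop :=
  exists (gT : finGroupType) (G : {group gT}) (n : nat)
         (rhobar : mx_representation k G n),
    (0 < n)%N /\ represents rhobar R.

(* The class of objects that are quotients of a ring of the previous class. *)
Definition frakQ (k : finFieldType) (T : augRing k) : Prop :=
  in_Chat T /\
  exists R : Chat k, frakU R /\
    exists f : aug_hom R T, forall y, exists x, f x = y.

Definition XpX_ring (p : nat) (p_pr : prime p) (k : fieldType) : augRing k :=
  AugRing (XpX_residue (p_pr := p_pr) (k := k)).

(* Main.v *)
Require Import Defs.
From HB Require Import structures.
From mathcomp Require Import all_boot all_order all_fingroup all_algebra all_field all_character.
From mathcomp Require Import boolp.
From mathcomp.multinomials Require Import monalg.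
From mathcomp Require Import ring zify.

(* Write T for W(k)[[X]]/(X^2 - pX), which is W(k) + W(k) X, i.e. the fibre product of W(k)
   with itself over k. If a finite group G has a representation rho over T such that the
   W(k)-span of rho(G) is the full matrix ring over T, then the reduction rhobar spans the
   full matrix ring over k; hence rhobar has a universal deformation ring R, and R -> T is
   onto because the traces of the elements of W(k)[G] fill T.

   Representability: lift to W(k)[G] an idempotent e acting as a matrix unit on rhobar. In
   every lift rho, rho(e) has rank one, so lam(g) = tr (rho(e) rho(g)) satisfies
   lam(u) lam(v) = lam(u e v) and determines rho up to strict equivalence. The ring R is
   generated by the lam(g), which span it over W(k).

   The group: for p = 2, the group of order 2 acting through 1 - X. For odd p, put
   n = 2 p^2. The n - 1 roots e_i - e_n of the root system A_(n-1) generate its Clifford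
   algebra over T once a square root z of p^2 is available: over W(k) the root lattice is
   unimodular of even rank n - 2 plus a line whose generator has square p^2 up to a unit, so
   that its Clifford algebra is a matrix ring over W(k)[z] = T, where z = p - 2X. The group
   generated by the roots is finite: it is a double cover of the symmetric group. The square
   roots of -1 and of 2 p^2 - 1 needed to split the algebra exist in W(k) because s is even. *)

Set Implicit Arguments.
Unset Strict Implicit.
Unset Printing Implicit Defensive.

Import GRing.Theory.
Local Open Scope ring_scope.

(** * Witt vectors of a finite field *)

(** A congruence modulo p between a_i and b_i improves to one modulo p^(n-i+1) between their
    p^(n-i)-th powers; the factor p^i supplies the rest. *)
Lemma ghost_congr (A : comNzRingType) p n (a b : nat -> A) : prime p ->
    (forall i, (i <= n)%N -> pdvd p (a i - b i)) ->
  pdvd (p ^ n.+1) (ghost p n a - ghost p n b).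
Proof.
move=> p_pr ab; rewrite /ghost -sumrB; apply: pdvd_sum => i _.
have lein : (i <= n)%N by rewrite -ltnS.
rewrite -mulrnBl (_ : p ^ n.+1 = p ^ (n - i).+1 * p ^ i)%N; last first.
  by rewrite -expnD addSn subnK.
by apply: pdvdMn; apply: pdvd_exp => //; apply: ab.
Qed.

Definition torsion_free (A : zmodType) :=
  forall d (x y : A), (0 < d)%N -> x *+ d = y *+ d -> x = y.

(** Identities between Witt vectors over [R] are checked on lifts to such a cover, where the ghost
    components determine the coordinates. *)
Lemma torsion_free_cover (R : comNzRingType) :
  exists (A : comNzRingType) (f : {rmorphism A -> R}) (h : R -> A),
    torsion_free A /\ cancel h f.
Proof.
exists (zpoly R), (zpoly_ev (@id R)), (@zpolyX R).
by split; [apply: zpoly_mulrn_inj | move=> a; apply: zpoly_evX].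
Qed.

Section WittLow.
Variables (p : nat) (p_pr : prime p).

Section TorsionFree.
Variables (A : comNzRingType) (tfA : torsion_free A).
Implicit Types a b : nat -> A.

Lemma ghost_inj_low n a b :
    (forall i, (i < n)%N -> ghost p i a = ghost p i b) ->
  forall i, (i < n)%N -> a i = b i.
Proof.
move=> ab i; elim/ltn_ind: i => i IHi ltin.
have := ab i ltin; rewrite /ghost !big_ord_recr /= subnn expn0 !expr1.
rewrite (eq_bigr (fun j : 'I_i => b j ^+ (p ^ (i - j)) *+ p ^ j)); last first.
  by move=> j _; rewrite IHi // (ltn_trans (ltn_ord j)).
by move/addrI/tfA; apply; rewrite expn_gt0 prime_gt0.
Qed.

(* Dwork's lemma. *)
Lemma ghost_congr_inv a b :
    (forall n, pdvd (p ^ n.+1) (ghost p n a - ghost p n b)) ->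
  forall n, pdvd p (a n - b n).
Proof.
move=> ab n; elim/ltn_ind: n => n IHn.
(* [b'] has the coordinates of [b] below n and those of [a] from n on, so its n-th ghost component
   differs from that of [b] by p^n (a_n - b_n) alone. *)
pose b' i := if (i < n)%N then b i else a i.
have d1 : pdvd (p ^ n.+1) (ghost p n a - ghost p n b').
  apply: ghost_congr => // i _; rewrite /b'; case: ifP => [/IHn //|_].
  by rewrite subrr; apply: pdvd0.
have [z zE] := pdvdB (ab n) d1.
have pn0 : (0 < p ^ n)%N by rewrite expn_gt0 prime_gt0.
exists z; apply: (tfA pn0).
rewrite -mulrnA -expnS -zE opprB [RHS]addrC subrKA /ghost !big_ord_recr /= subnn expn0 !expr1.
rewrite (eq_bigr (fun j : 'I_n => b j ^+ (p ^ (n - j)) *+ p ^ j)) => [|j _].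
  by rewrite {1}/b' ltnn [X in _ = X - _]addrC addrKA mulrnBl.
by rewrite /b' ltn_ord.
Qed.

End TorsionFree.

Section Low.
Variable R : comNzRingType.
Implicit Types x y z : witt p_pr R.

(** Over a torsion-free cover the first n ghost components and the first n coordinates determine
    each other, and ghost components subtract termwise. *)
Lemma witt_sub_low n x y x' y' :
    (forall i, (i < n)%N -> wcoef x i = wcoef x' i) ->
    (forall i, (i < n)%N -> wcoef y i = wcoef y' i) ->
  forall i, (i < n)%N -> wcoef (x - y) i = wcoef (x' - y') i.
Proof.
have [A [f [h [tfA hK]]]] := torsion_free_cover R.
move=> xx' yy' i ltin.
pose L (z : witt p_pr R) : witt p_pr A := Witt p_pr (h \o wcoef z).
have LK z : f \o wcoef (L z) = wcoef z by apply: funext => j /=; rewrite hK.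
have LB z t : wcoef (z - t) = f \o wcoef (L z - L t).
  transitivity (wadd p (wcoef z) (wopp p (wcoef t))) => //.
  by rewrite -{1}(LK z) -{1}(LK t) -wopp_morph -wadd_morph.
rewrite !LB; congr (f _).
move: i ltin; apply: (ghost_inj_low tfA) => i ltin; rewrite !ghost_wittB.
have ghL (z z' : witt p_pr R) : (forall i, (i < n)%N -> wcoef z i = wcoef z' i) ->
    ghost p i (wcoef (L z)) = ghost p i (wcoef (L z')).
  move=> zz'; apply: eq_bigr => j _ /=; rewrite zz' //.
  by apply: leq_ltn_trans ltin; rewrite -ltnS.
by rewrite (ghL _ _ xx') (ghL _ _ yy').
Qed.

Lemma witt_eq_low n x y :
  (forall i, (i < n)%N -> wcoef x i = wcoef y i) <->
  (forall i, (i < n)%N -> wcoef (x - y) i = 0).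
Proof.
split=> xy i ltin.
  by rewrite (witt_sub_low (x' := y) (y' := y) (n := n)) // subrr.
have := @witt_sub_low n (x - y) (- y) (y - y) (- y) _ _ i ltin.
by rewrite !opprK !subrK; apply=> // j ltjn; rewrite subrr xy.
Qed.

Hypothesis pcharR : p%:R = 0 :> R.

(** In characteristic p, multiplication by p is Verschiebung composed with Frobenius. On a lift, the
    n-th ghost components of p times the vector and of the shifted vector of p-th powers differ by
    p^(n+1) a_n; [ghost_congr_inv] turns this into a congruence modulo p, which is an equality in
    [R]. *)
Lemma witt_mulrp x n :
  wcoef (x *+ p) n = if n is m.+1 then wcoef x m ^+ p else 0.
Proof.
have [A [f [h [tfA hK]]]] := torsion_free_cover R.
pose a := h \o wcoef x; pose X : witt p_pr A := Witt p_pr a.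
have fMn m : f \o wcoef (X *+ m) = wcoef (x *+ m).
  elim: m => [|m IHm]; first by rewrite !mulr0n; apply: wzero_morph.
  rewrite !mulrS.
  transitivity (wadd p (wcoef x) (wcoef (x *+ m))) => //.
  transitivity (f \o wadd p (wcoef X) (wcoef (X *+ m))) => //.
  rewrite wadd_morph IHm; congr (wadd _ _ _).
  by apply: funext => j /=; rewrite hK.
have ghMn m j : ghost p j (wcoef (X *+ m)) = ghost p j a *+ m.
  elim: m => [|m IHm]; first by rewrite !mulr0n; apply: ghost_wzero.
  by rewrite !mulrS ghost_wittD IHm.
pose b j := if j is m.+1 then a m ^+ p else 0.
have [|z zE] := @ghost_congr_inv _ tfA (wcoef (X *+ p)) b _ n.
  move=> j; rewrite ghMn; case: j => [|j].
    by rewrite !ghost0 subr0 expn1; exists (a 0%N).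
  rewrite ghostS {2}/ghost big_ord_recl /= expr0n expn_eq0 eqn0Ngt prime_gt0 //=.
  rewrite mul0rn add0r (_ : \sum_(i < _) _ = ghost p j (fun i => a i ^+ p) *+ p).
    by rewrite mulrnDl addrAC subrr add0r -mulrnA -expnSr; eexists.
  rewrite /ghost -sumrMnl; apply: eq_bigr => i _ /=.
  by rewrite -mulrnA -expnSr.
rewrite -fMn /=; move/eqP: zE; rewrite subr_eq => /eqP ->.
rewrite rmorphD rmorphMn /= -mulr_natr pcharR mulr0 add0r.
by rewrite /b; case: n => [|n]; rewrite ?rmorph0 // rmorphXn /= hK.
Qed.

End Low.
End WittLow.

(** Convergence of every series in powers of p; uniqueness of the limit is [pseparated]. *)
Definition pcomplete (p : nat) (B : zmodType) :=
  forall x : nat -> B, exists l, forall n, pdvd (p ^ n) (l - \sum_(j < n) x j *+ p ^ j).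

Definition pseparated (p : nat) (B : zmodType) :=
  forall x : B, (forall n, pdvd (p ^ n) x) -> x = 0.

(** Finiteness of B/pB, expressed without forming the quotient: [c] separates the classes modulo
    p. *)
Definition pfinite (p : nat) (B : zmodType) :=
  exists (F : finType) (c : B -> F), forall x y, c x = c y -> pdvd p (x - y).

Section WittFinite.
Variables (p s : nat) (k : finFieldType) (p_pr : prime p).
Hypotheses (s_gt0 : (0 < s)%N) (card_k : #|k| = (p ^ s)%N).
Implicit Types x y : witt p_pr k.

Lemma card_natr0 : p%:R = 0 :> k.
Proof. by have /pcharf0 := card_finPcharP card_k p_pr. Qed.

Lemma root_expp (c : k) : (c ^+ (p ^ s.-1)) ^+ p = c.
Proof. by rewrite -exprM -expnSr prednK // -card_k expf_card. Qed.

Lemma witt_pdvdP n x : pdvd (p ^ n) x <-> (forall i, (i < n)%N -> wcoef x i = 0).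
Proof.
split=> [[y ->]|].
  elim: n y => // n IHn y i; rewrite expnSr mulrnA witt_mulrp ?card_natr0 //.
  case: i => // i; rewrite ltnS => /IHn ->.
  by rewrite expr0n eqn0Ngt prime_gt0.
elim: n x => [|n IHn] x x0; first exact: pdvd1.
(* The quotient of x by p: shift the coordinates down and take p-th roots, which in k are the
   p^(s-1)-th powers. *)
have [|z zE] := IHn (Witt p_pr (fun i => wcoef x i.+1 ^+ (p ^ s.-1))).
  move=> i ltin /=; rewrite x0 ?ltnS // expr0n expn_eq0 eqn0Ngt.
  by rewrite prime_gt0.
exists z; rewrite expnSr mulrnA -zE; apply: val_inj; apply: funext => i.
rewrite [RHS]witt_mulrp ?card_natr0 //; case: i => [|i]; first exact: x0.
by rewrite root_expp.
Qed.

Lemma witt_pdvd_res x : witt_res x = 0 -> pdvd p x.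
Proof.
move=> x0; have [_] := witt_pdvdP 1 x.
by rewrite expn1; apply=> -[].
Qed.

Lemma witt_pseparated : pseparated p (witt p_pr k).
Proof.
move=> x dx; apply: val_inj; apply: funext => i.
by have /witt_pdvdP/(_ i (ltnSn i)) := dx i.+1.
Qed.

Lemma witt_pcomplete : pcomplete p (witt p_pr k).
Proof.
move=> x; pose S n := \sum_(j < n) x j *+ p ^ j.
have dS n m : (n <= m)%N -> pdvd (p ^ n) (S m - S n).
  elim: m => [|m IHm]; first by rewrite leqn0 => /eqP ->; exact: pdvd1.
  rewrite leq_eqVlt => /orP[/eqP->|]; first by rewrite subrr; apply: pdvd0.
  rewrite ltnS => lenm; rewrite /S big_ord_recr /= addrAC; apply: pdvdD; first exact: IHm.
  by exists (x m *+ p ^ (m - n)); rewrite -mulrnA -expnD subnK.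
(* A diagonal limit: from the index i+1 on the partial sums agree modulo p^(i+1), so their i-th
   coordinate is constant. *)
exists (Witt p_pr (fun i => wcoef (S i.+1) i)) => n.
apply/witt_pdvdP/witt_eq_low => i ltin /=.
by apply/esym; move/witt_pdvdP/witt_eq_low: (dS i.+1 n ltin); apply.
Qed.

End WittFinite.

(** * p-adically complete rings *)

Section Pdvd.
Variable p : nat.

Lemma zpdvdD (V : zmodType) m (x y : V) : pdvd m x -> pdvd m y -> pdvd m (x + y).
Proof. by move=> [u ->] [v ->]; exists (u + v); rewrite mulrnDl. Qed.

Lemma zpdvdB (V : zmodType) m (x y : V) : pdvd m x -> pdvd m y -> pdvd m (x - y).
Proof. by move=> [u ->] [v ->]; exists (u - v); rewrite mulrnBl. Qed.

Lemma zpdvd_sum (V : zmodType) m (J : Type) (r : seq J) (Q : pred J) (F : J -> V) :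
  (forall j, Q j -> pdvd m (F j)) -> pdvd m (\sum_(j <- r | Q j) F j).
Proof.
by move=> dF; apply: big_ind => //; [exists 0; rewrite mul0rn | apply: zpdvdD].
Qed.

Lemma zpdvd_leq (V : zmodType) m n (x : V) :
  (m <= n)%N -> pdvd (p ^ n) x -> pdvd (p ^ m) x.
Proof.
by move=> lemn [y ->]; exists (y *+ p ^ (n - m)); rewrite -mulrnA -expnD subnK.
Qed.

Lemma zpdvdMl (B : nzRingType) m (x y : B) : pdvd m y -> pdvd m (x * y).
Proof. by move=> [u ->]; exists (x * u); rewrite mulrnAr. Qed.

Lemma zpdvdMr (B : nzRingType) m (x y : B) : pdvd m x -> pdvd m (x * y).
Proof. by move=> [u ->]; exists (u * y); rewrite mulrnAl. Qed.

Lemma pdvd_raddf (U V : zmodType) (f : {additive U -> V}) m x : pdvd m x -> pdvd m (f x).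
Proof. by move=> [y ->]; exists (f y); rewrite raddfMn. Qed.

End Pdvd.

Lemma pcomplete_lim (p : nat) (V : zmodType) (E : nat -> V) : pcomplete p V ->
    (forall n, pdvd (p ^ n.+1) (E n.+1 - E n)) ->
  exists x, forall n, pdvd (p ^ n.+1) (x - E n).
Proof.
move=> cV /choice[y yE].
have [x xP] := cV (fun n => if n is m.+1 then y m else E 0%N); exists x => n.
suff <- : \sum_(j < n.+1) (if j : nat is m.+1 then y m else E 0%N) *+ p ^ j = E n by [].
elim: n => [|n IHn]; first by rewrite big_ord1 expn0.
by rewrite big_ord_recr /= IHn -yE addrC subrK.
Qed.

(** * Inverses and idempotents in p-adically complete rings *)

Section PadicRing.
Variables (p : nat) (B : nzRingType).
Hypotheses (cB : pcomplete p B) (sB : pseparated p B).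

Lemma geometric_inverse (z : B) : exists y, y * (1 - z *+ p) = 1.
Proof.
have [l lP] := cB (fun j => z ^+ j); exists l.
apply/eqP; rewrite -subr_eq0; apply/eqP/sB => n.
have -> : l * (1 - z *+ p) - 1 =
    (l - \sum_(j < n) z ^+ j *+ p ^ j) * (1 - z *+ p) - (z *+ p) ^+ n.
  rewrite mulrBl -addrA; congr (_ + _).
  have -> : \sum_(j < n) z ^+ j *+ p ^ j = \sum_(j < n) (z *+ p) ^+ j.
    by apply: eq_bigr => j _; rewrite exprMn_n.
  have -> : (\sum_(j < n) (z *+ p) ^+ j) * (1 - z *+ p) = 1 - (z *+ p) ^+ n.
    elim: n {lP} => [|n IHn]; first by rewrite big_ord0 mul0r expr0 subrr.
    rewrite big_ord_recr /= mulrDl IHn mulrBr mulr1 -exprSr.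
    by rewrite addrA subrK.
  by rewrite opprB addrAC subrr add0r.
apply: zpdvdB; first by apply: zpdvdMr.
by rewrite exprMn_n; eexists.
Qed.

(** One Newton step for the equation e^2 = e. The derivative 2e - 1 has square 1 + 4d, so it serves
    as its own inverse modulo d, and the defect d becomes a multiple of d^2. *)
Lemma newton_idempotent (e : B) :
  let d := e * e - e in let e' := e - (e *+ 2 - 1) * d in
  e' * e' - e' = d * d * (d *+ 4 - 3%:R).
Proof.
(* Only powers of e occur, so the identity may be checked in the commutative ring of integer
   polynomials, although [B] need not be commutative. *)
have [h hX] : exists h : {rmorphism {poly int} -> B}, h 'X = e.
  have cX : commr_rmorph (intr : int -> B) e by move=> n; apply: commr_int.
  by exists (horner_morph cX); apply: horner_morphX.
have E : let x : {poly int} := 'X in let d := x * x - x in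
    let e' := x - (x *+ 2 - 1) * d in e' * e' - e' = d * d * (d *+ 4 - 3%:R).
  by move=> /=; ring.
have := congr1 h E.
by rewrite !(rmorphB, rmorphM, rmorphMn, rmorph1, rmorph_nat) /= !hX.
Qed.

Lemma lift_idempotent (x : B) : pdvd p (x * x - x) ->
  exists e, e * e = e /\ pdvd p (e - x).
Proof.
move=> dx; pose f (e : B) := e - (e *+ 2 - 1) * (e * e - e).
pose E n := iter n f x.
have dE n : pdvd (p ^ n.+1) (E n * E n - E n).
  elim: n => [|n IHn]; first by rewrite expn1.
  rewrite /= newton_idempotent -mulrA; have [z ->] := IHn; set w := _ - _.
  by exists ((z * (z * w)) *+ p ^ n); rewrite !mulrnAl mulrnAr -!mulrnA -!expnD addSnnS.
have [|e dEe] := pcomplete_lim (E := E) cB.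
  move=> n; have [z zE] := dE n; exists (- ((E n *+ 2 - 1) * z)).
  by rewrite [E n.+1]/= /f zE addrAC subrr add0r mulrnAr mulNrn.
exists e; split; last by have := dEe 0%N; rewrite expn1.
apply/eqP; rewrite -subr_eq0; apply/eqP/sB => n.
apply: (@zpdvd_leq p _ n n.+1) => //; set q := (p ^ _)%N.
have -> : e * e - e = e * (e - E n) + (e - E n) * E n + (E n * E n - E n) - (e - E n).
  by rewrite mulrBr mulrBl !subrKA opprB subrKA.
exact: zpdvdB (zpdvdD (zpdvdD (zpdvdMl _ (dEe n)) (zpdvdMr _ (dEe n))) (dE n)) (dEe n).
Qed.

Hypothesis fB : pfinite p B.

(** Modulo p the powers of x are eventually periodic by the pigeonhole principle, hence some power
    is idempotent there; it is then lifted. *)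
Lemma lift_idempotent_exp (x : B) :
  exists c e, [/\ (0 < c)%N, e * e = e & pdvd p (e - x ^+ c)].
Proof.
have [F [c cP]] := fB.
have [a [b [ltab dab]]] : exists a b, (a < b)%N /\ pdvd p (x ^+ a - x ^+ b).
  have /injectivePn[i [j neij cij]] : ~~ injectiveb (fun i : 'I_#|F|.+1 => c (x ^+ i)).
    by apply/injectiveP => /leq_card; rewrite card_ord ltnn.
  move: neij; rewrite -val_eqE /= neq_ltn => /orP[] ltij.
    by exists i, j; split => //; apply: cP.
  by exists j, i; split => //; apply/cP/esym.
pose d := (b - a)%N; have d_gt0 : (0 < d)%N by rewrite subn_gt0.
have dx m t : (a <= m)%N -> pdvd p (x ^+ (m + t * d) - x ^+ m).
  move=> leam; elim: t => [|t IHt]; first by rewrite mul0n addn0 subrr; exists 0; rewrite mul0rn.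
  rewrite -(subrKA (x ^+ (m + t * d))); apply: zpdvdD => //.
  have -> : (m + t.+1 * d = b + (m + t * d - a))%N.
    by rewrite mulSn; set q := (t * d)%N; rewrite /d; lia.
  have {2}-> : (m + t * d = a + (m + t * d - a))%N.
    by rewrite subnKC // (leq_trans leam) ?leq_addr.
  rewrite !exprD -mulrBl; apply: zpdvdMr.
  by have [z zE] := dab; exists (- z); rewrite mulNrn -zE opprB.
(* A multiple of the period d that lies beyond the preperiod a, so that x^(2m) and x^m agree modulo
   p. *)
pose m := (a.+1 * d)%N.
have [|e [ee de]] := @lift_idempotent (x ^+ m).
  rewrite -exprD {1}/m; apply: dx.
  by rewrite /m mulSn (leq_trans _ (leq_addl _ _)) // leq_pmulr.
by exists m, e; split=> //; rewrite muln_gt0 d_gt0.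
Qed.

End PadicRing.

(** * Local algebras finite over the Witt vectors *)

Section MaxIdealPow.
Variables (k : fieldType) (A : augRing k).
Implicit Types x y : A.

Lemma max_ideal_powM n x y : max_ideal_pow n x -> max_ideal_pow n (y * x).
Proof.
elim: n x => // n IHn x [r [a [b [am bm ->]]]]; exists r, a, (fun i => y * b i).
split=> // [i|]; first exact: IHn (bm i).
by rewrite mulr_sumr; apply: eq_bigr => i _; rewrite mulrCA.
Qed.

Lemma max_ideal_powD n x y :
  max_ideal_pow n x -> max_ideal_pow n y -> max_ideal_pow n (x + y).
Proof.
case: n => // n [r [a [b [am bm ->]]]] [r' [a' [b' [am' bm' ->]]]].
exists (r + r')%N, (fun i => match split i with inl j => a j | inr j => a' j end),
  (fun i => match split i with inl j => b j | inr j => b' j end).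
split=> [i|i|]; try by case: (split i).
rewrite big_split_ord /=; congr (_ + _); apply: eq_bigr => i _.
  by rewrite (unsplitK (inl _ i)).
by rewrite (unsplitK (inr _ i)).
Qed.

Lemma max_ideal_powN n x : max_ideal_pow n x -> max_ideal_pow n (- x).
Proof. by rewrite -mulN1r; apply: max_ideal_powM. Qed.

Lemma max_ideal_powB n x y :
  max_ideal_pow n x -> max_ideal_pow n y -> max_ideal_pow n (x - y).
Proof. by move=> mx my; apply: max_ideal_powD => //; apply: max_ideal_powN. Qed.

Lemma max_ideal_pow0 n : max_ideal_pow n (0 : A).
Proof.
by case: n => // n; exists 0%N, (fun=> 0), (fun=> 0); split=> [[]|[]|] //; rewrite big_ord0.
Qed.

Lemma max_ideal_pow_sum n (J : Type) (r : seq J) (Q : pred J) (F : J -> A) :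
  (forall j, Q j -> max_ideal_pow n (F j)) ->
  max_ideal_pow n (\sum_(j <- r | Q j) F j).
Proof.
by move=> mF; apply: big_ind => //; [apply: max_ideal_pow0 | apply: max_ideal_powD].
Qed.

Lemma max_ideal_pow_mul n x y :
  max_ideal x -> max_ideal_pow n y -> max_ideal_pow n.+1 (x * y).
Proof.
by move=> mx my; exists 1%N, (fun=> x), (fun=> y); split=> //; rewrite big_ord1.
Qed.

Lemma max_ideal_pow_leq m n x : (m <= n)%N -> max_ideal_pow n x -> max_ideal_pow m x.
Proof.
move=> lemn; rewrite -(subnKC lemn); move: (n - m)%N => d.
elim: m x {lemn} => // m IHm x.
rewrite addSn => -[r [a [b [am bm ->]]]]; exists r, a, b; split=> // i; exact: IHm (bm i).
Qed.

Lemma max_ideal_pow1 x : max_ideal x <-> max_ideal_pow 1 x.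
Proof.
split=> [mx|[r [a [b [am _ ->]]]]].
  by rewrite -[x]mulr1; apply: max_ideal_pow_mul.
by rewrite /max_ideal rmorph_sum big1 // => i _; rewrite rmorphM /= am mul0r.
Qed.

Lemma max_ideal_pow_addM m n x y :
  max_ideal_pow m x -> max_ideal_pow n y -> max_ideal_pow (m + n) (x * y).
Proof.
elim: m x => [|m IHm] x; first by move=> _; apply: max_ideal_powM.
case=> r [a [b [am bm ->]]] my; rewrite mulr_suml addSn.
apply: max_ideal_pow_sum => i _; rewrite -mulrA.
by apply: max_ideal_pow_mul => //; apply: IHm => //; apply: bm.
Qed.

Lemma max_ideal_pow_pdvd p n x : p%:R = 0 :> k -> pdvd (p ^ n) x -> max_ideal_pow n x.
Proof.
move=> p0 [y ->]; elim: n => // n IHn.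
rewrite expnSr mulrnA -mulr_natl; apply: max_ideal_pow_mul => //.
by rewrite /max_ideal rmorph_nat.
Qed.

End MaxIdealPow.

Section FiniteOverWitt.
Variables (p s : nat) (k : finFieldType) (p_pr : prime p).
Hypotheses (s_gt0 : (0 < s)%N) (card_k : #|k| = (p ^ s)%N).
Local Notation W := (witt p_pr k).

Let wc : pcomplete p W := witt_pcomplete s_gt0 card_k.
Let ws : pseparated p W := witt_pseparated s_gt0 card_k.

Lemma witt_unit (u : W) : witt_res u != 0 -> exists v, v * u = 1.
Proof.
move=> u0; pose c : W := Witt p_pr (fun i => if i == 0%N then (witt_res u)^-1 else 0).
have [|z zE] := witt_pdvd_res s_gt0 card_k (x := 1 - c * u).
  rewrite rmorphB rmorphM rmorph1.
  have -> : GRing.RMorphism.sort (@witt_res p p_pr k) c = (witt_res u)^-1 by [].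
  by rewrite mulVf ?subrr.
have [y yP] := geometric_inverse wc ws z.
by exists (y * c); rewrite -mulrA; move: yP; rewrite -zE opprB addrC subrK.
Qed.

Lemma witt_valuation (w : W) : w != 0 ->
  exists n u v, w = u *+ p ^ n /\ v * u = 1.
Proof.
move=> w0; have [n dn] : exists n, ~ pdvd (p ^ n) w.
  apply: contrapT => dw; move/eqP: w0; apply.
  apply: ws => n.
  by apply: contrapT => dn; apply: dw; exists n.
elim: n dn => [|n IHn] dn; first by case: dn; exists w.
have [|] := pselect (pdvd (p ^ n) w); last by move/IHn.
move=> [u uE]; have [v vu] : exists v, v * u = 1.
  apply: witt_unit; apply/eqP => u0; apply: dn.
  have [t tE] := witt_pdvd_res s_gt0 card_k u0.
  by exists t; rewrite uE tE -mulrnA -expnS.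
by exists n, u, v.
Qed.

Variables (A : augRing k) (iota : {rmorphism W -> A}).
Hypothesis iota_res : forall w, residue A (iota w) = witt_res w.
Variables (r : nat) (b : nat -> A).
Hypothesis gen_b : forall x, exists w : nat -> W, x = \sum_(i < r) iota (w i) * b i.
Hypothesis sepA : pseparated p A.
Hypothesis idemA : forall e : A, e * e = e -> residue A e = 0 -> e = 0.

Let p0 : p%:R = 0 :> k. Proof. exact: card_natr0 card_k. Qed.

Let res_pdvd (x : A) : pdvd p x -> residue A x = 0.
Proof. by move=> [y ->]; rewrite rmorphMn /= -mulr_natr p0 mulr0. Qed.

Lemma fin_pcomplete : pcomplete p A.
Proof.
move=> x; have /choice[w wE] : forall j, exists w : nat -> W,
  x j = \sum_(i < r) iota (w i) * b i by move=> j; apply: gen_b.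
have /choice[l lP] := fun i => wc (fun j => w j i).
exists (\sum_(i < r) iota (l i) * b i) => n.
have -> : \sum_(j < n) x j *+ p ^ j =
    \sum_(i < r) iota (\sum_(j < n) w j i *+ p ^ j) * b i.
  under eq_bigr do rewrite wE -sumrMnl.
  rewrite exchange_big /=; apply: eq_bigr => i _.
  by rewrite rmorph_sum mulr_suml; apply: eq_bigr => j _; rewrite rmorphMn /= mulrnAl.
rewrite -sumrB; apply: zpdvd_sum => i _; rewrite -mulrBl -rmorphB.
by apply: zpdvdMr; apply: pdvd_raddf.
Qed.

Lemma fin_pfinite : pfinite p A.
Proof.
have /choice[w wE] := gen_b.
exists {ffun 'I_r -> k}, (fun x => [ffun i : 'I_r => witt_res (w x i)]) => x y.
move/ffunP => xy; rewrite (wE x) (wE y) -sumrB; apply: zpdvd_sum => i _.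
rewrite -mulrBl -rmorphB; apply: zpdvdMr; apply: pdvd_raddf.
apply: (witt_pdvd_res s_gt0 card_k); have := xy i; rewrite !ffunE rmorphB /= => ->.
exact: subrr.
Qed.

(** A power of x is congruent modulo p to an idempotent; that idempotent has residue 0, hence
    vanishes by [idemA]. *)
Lemma fin_max_ideal_exp (x : A) : max_ideal x -> exists c, pdvd p (x ^+ c.+1).
Proof.
move=> mx; have [c [e [c_gt0 ee de]]] := lift_idempotent_exp fin_pcomplete sepA fin_pfinite x.
exists c.-1; rewrite prednK //; have [z zE] := de; exists (- z).
rewrite mulNrn -zE (idemA ee) ?sub0r ?opprK //.
have /eqP := res_pdvd de; rewrite rmorphB rmorphXn /= mx expr0n eqn0Ngt c_gt0 subr0.
by move/eqP.
Qed.

(** 1 - x divides 1 - x^(c+1), which has the form 1 - pz and is invertible by the geometric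
    series. *)
Lemma fin_unit1 (x : A) : max_ideal x -> 1 - x \is a GRing.unit.
Proof.
move=> mx; have [c [z zE]] := fin_max_ideal_exp mx.
have [y yP] := geometric_inverse fin_pcomplete sepA z.
apply/unitrPr; exists ((\sum_(i < c.+1) x ^+ i) * y).
rewrite mulrA -[1 - x]opprB mulNr -subrX1 opprB zE mulrC.
by rewrite yP.
Qed.

Lemma fin_local : is_local A.
Proof.
have lift_k c : exists w : W, witt_res w = c.
  by exists (Witt p_pr (fun i => if i == 0%N then c else 0)).
split=> [c|x nx].
  by have [w <-] := lift_k c; exists (iota w).
have [w wE] := lift_k (residue A x)^-1.
have : 1 - (1 - x * iota w) \is a GRing.unit.
  apply: fin_unit1; rewrite /max_ideal rmorphB rmorphM rmorph1 /= iota_res wE.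
  by rewrite mulfV ?subrr //; apply/eqP.
by rewrite opprB addrC subrK unitrM => /andP[].
Qed.

(* Pigeonhole on the partial products modulo p: if two of them agree then, the
   quotient being in the maximal ideal, both are already divisible by p. *)
Lemma fin_prod_pdvd : exists M, (0 < M)%N /\ forall j (ys : seq A),
  {in ys, forall y, max_ideal y} -> (M * j <= size ys)%N -> pdvd (p ^ j) (\prod_(y <- ys) y).
Proof.
have [F [c cP]] := fin_pfinite; exists #|F|.+1; split=> //.
have base (ys : seq A) : {in ys, forall y, max_ideal y} -> (#|F| < (size ys).+1)%N ->
    pdvd p (\prod_(y <- ys) y).
  move=> mys ltF; pose P i := \prod_(y <- take i ys) y.
  have [i [j [ltij lejs dP]]] : exists i j, [/\ (i < j)%N, (j <= size ys)%N & c (P i) = c (P j)].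
    have /injectivePn[i [j neij cij]] : ~~ injectiveb (fun i : 'I_(size ys).+1 => c (P i)).
      by apply/injectiveP => /leq_card; rewrite card_ord leqNgt ltF.
    move: neij; rewrite -val_eqE /= neq_ltn => /orP[] ltij.
      by exists i, j; split; rewrite // -ltnS.
    by exists j, i; split; rewrite // -ltnS.
  have PE : P j = P i * \prod_(y <- drop i (take j ys)) y.
    by rewrite -big_cat -{1}(take_takel ys (ltnW ltij)) cat_take_drop.
  have mQ : max_ideal (\prod_(y <- drop i (take j ys)) y).
    case E: (drop i (take j ys)) => [|y ys'].
      have /(congr1 size) := E; rewrite size_drop size_take_min (minn_idPl lejs) /=.
      by move/eqP; rewrite subn_eq0 leqNgt ltij.
    have /mem_drop/mem_take yys : y \in drop i (take j ys) by rewrite E mem_head.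
    by rewrite big_cons /max_ideal rmorphM /= (mys y yys) mul0r.
  have := cP _ _ dP; rewrite PE -{1}[P i]mulr1 -mulrBr => dPi.
  rewrite -(cat_take_drop i ys) big_cat /=; apply: zpdvdMr.
  by rewrite -[X in pdvd _ X]/(P i) -(mulrK (fin_unit1 mQ) (P i)); apply: zpdvdMr.
elim=> [|j IHj] ys mys; first by exists (\prod_(y <- ys) y).
rewrite mulnS => les; rewrite -(cat_take_drop #|F|.+1 ys) big_cat /= expnS.
apply: pdvdM.
  apply: base => [y /mem_take|]; first exact: mys.
  by rewrite size_take_min ltnS leq_min leqnSn; apply: leq_trans les; apply: leqW; rewrite leq_addr.
apply: IHj => [y /mem_drop|]; first exact: mys.
by rewrite size_drop leq_subRL // (leq_trans _ les) // leq_addr.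
Qed.

Lemma fin_max_ideal_pow : exists M, (0 < M)%N /\
  forall j (x : A), max_ideal_pow (M * j) x -> pdvd (p ^ j) x.
Proof.
have [M [M_gt0 prodM]] := fin_prod_pdvd; exists M; split=> // j.
(* The list [ys] collects the factors from the maximal ideal met while the iterated sums of products
   are unfolded. *)
suff main n (x : A) ys : max_ideal_pow n x -> {in ys, forall y, max_ideal y} ->
    (M * j <= size ys + n)%N -> pdvd (p ^ j) (\prod_(y <- ys) y * x).
  by move=> x mx; have := main _ x [::] mx; rewrite big_nil mul1r; apply.
elim: n x ys => [|n IHn] x ys.
  by move=> _ mys les; apply: zpdvdMr; apply: prodM => //; rewrite -[size _]addn0.
move=> [q [a [c [am cm ->]]]] mys les; rewrite mulr_sumr; apply: zpdvd_sum => i _.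
have -> : \prod_(y <- ys) y * (a i * c i) = \prod_(y <- a i :: ys) y * c i.
  by rewrite big_cons mulrA [a i * _]mulrC.
apply: (IHn _ _ (cm i)); last by rewrite /= addSnnS.
by move=> y; rewrite inE => /orP[/eqP->|/mys].
Qed.

Lemma fin_complete : is_complete A.
Proof.
have [M [M_gt0 powM]] := fin_max_ideal_pow.
split=> [x mx|u du]; first by apply: sepA => j; apply: powM.
have du' m n : (n <= m)%N -> max_ideal_pow n (u m - u n).
  elim: m => [|m IHm]; first by rewrite leqn0 => /eqP ->.
  rewrite leq_eqVlt => /orP[/eqP->|]; first by rewrite subrr; apply: max_ideal_pow0.
  rewrite ltnS => lenm; rewrite -(subrKA (u m)); apply: max_ideal_powD; last exact: IHm.
  exact: max_ideal_pow_leq lenm (du m).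
(* Along the indices M j the increments of u are divisible by p^j, so that subsequence is a p-adic
   series. *)
have /choice[y yE] : forall j, exists y, u (M * j.+1)%N - u (M * j)%N = y *+ p ^ j.
  by move=> j; apply: powM; apply: du'; rewrite leq_mul2l leqnSn orbT.
have [l lP] := fin_pcomplete y; exists (l + u 0%N) => n.
have sumy m : \sum_(j < m) y j *+ p ^ j = u (M * m)%N - u 0%N.
  elim: m => [|m IHm]; first by rewrite big_ord0 muln0 subrr.
  by rewrite big_ord_recr /= IHm -yE addrC subrKA.
rewrite -(subrKA (u (M * n)%N)); apply: max_ideal_powD.
  apply: (max_ideal_pow_pdvd p0); have := lP n; rewrite sumy opprB addrA.
  by rewrite addrAC.
by apply: du'; rewrite leq_pmull.
Qed.

(* An ideal is filtered by its intersections with the W-spans of b_0, ..., b_(j-1);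
   the successive quotients are ideals of W, hence principal. *)
Lemma fin_noetherian : is_noetherian A.
Proof.
move=> I [I0 ID IM].
have IB x y : I x -> I y -> I (x - y).
  by move=> Ix Iy; apply: ID => //; rewrite -mulN1r; apply: IM.
pose span j x := exists w : nat -> W, x = \sum_(i < j) iota (w i) * b i.
have main j : exists g : seq A, {in g, forall y, I y} /\
    forall x, I x -> span j x -> exists c : nat -> A, x = \sum_(i < size g) c i * g`_i.
  elim: j => [|j [g [gI gP]]].
    by exists [::]; split=> // x _ [w ->]; exists (fun=> 0); rewrite !big_ord0.
  pose J w := exists x, I x /\ span j (x - iota w * b j).
  have spanJ x : I x -> span j.+1 x -> exists w, J w /\ span j (x - iota w * b j).
    move=> Ix [w xE]; exists (w j); have S : span j (x - iota (w j) * b j).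
      by exists w; rewrite xE big_ord_recr /= addrK.
    by split=> //; exists x.
  have [J0|/existsNP[w1 /not_implyP[Jw1 /eqP w10]]] := pselect (forall w, J w -> w = 0).
    exists g; split=> // x Ix /(spanJ x Ix)[w [/J0 -> S]].
    by apply: gP => //; rewrite rmorph0 mul0r subr0 in S.
  (* The p-adic valuations occurring in [J]; an element [w0] of minimal valuation generates [J]. *)
  pose Q n := `[< exists w u v : W, [/\ J w, w = u *+ p ^ n & v * u = 1] >].
  have exQ : exists n, Q n.
    have [n [u [v [wE vu]]]] := witt_valuation w10.
    by exists n; apply/asboolP; exists w1, u, v.
  have [n /asboolP[w0 [u [v [[x0 [Ix0 Sx0]] w0E vu]]]] n_min] := ex_minnP exQ.
  have Jw0 w : J w -> exists c, w = c * w0.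
    move=> Jw; have [->|wN0] := eqVneq w 0; first by exists 0; rewrite mul0r.
    have [m [u' [v' [wE vu']]]] := witt_valuation wN0.
    have lenm : (n <= m)%N by apply: n_min; apply/asboolP; exists w, u', v'.
    exists ((u' * v) *+ p ^ (m - n)).
    by rewrite w0E mulrnAl mulrnAr -mulrA vu mulr1 -mulrnA -expnD subnKC.
  exists (x0 :: g); split=> [y|x Ix /(spanJ x Ix)[w [/Jw0[c wE] [d dE]]]].
    by rewrite inE => /orP[/eqP->|/gI].
  have [|d' d'E] := gP (x - iota c * x0) (IB _ _ Ix (IM _ _ Ix0)).
    have [d0 d0E] := Sx0; exists (fun i => d i - c * d0 i).
    have -> : x - iota c * x0 = x - iota w * b j - iota c * (x0 - iota w0 * b j).
      by rewrite wE rmorphM mulrBr mulrA opprB addrA subrK.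
    rewrite dE d0E mulr_sumr -sumrB; apply: eq_bigr => i _.
    by rewrite rmorphB rmorphM mulrBl mulrA.
  exists (fun i => if i is i'.+1 then d' i' else iota c).
  by rewrite big_ord_recl /= -d'E addrC subrK.
have [g [gI gP]] := main r.
exists (size g), (fun i => g`_i) => x; split=> [Ix|[c ->]].
  by have [c ->] := gP x Ix (gen_b x); exists (fun i => c i).
elim/big_ind: _ => // i _; apply: IM; apply: gI; exact: mem_nth.
Qed.

Lemma fin_in_Chat : in_Chat A.
Proof. by split; [apply: fin_local | apply: fin_noetherian | apply: fin_complete]. Qed.

End FiniteOverWitt.

(** * The structure map from the Witt vectors *)

(** The terms of index above n are divisible by p^(n+1), and the others make up the ghost component
    of the p^t-th powers. *)
Lemma ghost_addn (A : comNzRingType) p n t (a : nat -> A) :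
  pdvd (p ^ n.+1) (ghost p (n + t) a - ghost p n (fun i => a i ^+ (p ^ t))).
Proof.
elim: t a => [|t IHt] a.
  by rewrite addn0 expn0 (@ghost_ext _ p n _ a) ?subrr; [exists 0; rewrite mul0rn|].
rewrite addnS ghostS addrAC; apply: zpdvdD.
  rewrite (@ghost_ext _ p n _ (fun i => (a i ^+ p) ^+ (p ^ t))); first exact: IHt.
  by move=> i; rewrite -exprM expnS.
by apply: (@zpdvd_leq p _ _ (n + t).+1); [rewrite ltnS leq_addr | eexists].
Qed.

Section StructureMap.
Variables (p s : nat) (k : finFieldType) (p_pr : prime p).
Hypotheses (s_gt0 : (0 < s)%N) (card_k : #|k| = (p ^ s)%N).
Variables (A : augRing k) (locA : is_local A) (cplA : is_complete A).
Local Notation W := (witt p_pr k).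

Let p0 : p%:R = 0 :> k. Proof. exact: card_natr0 card_k. Qed.

(** The cofactor of a - b in a^q - b^q reduces to q b^(q-1), which is 0 in k; it contributes one
    more factor in the maximal ideal. *)
Lemma max_ideal_powXB q n (a b : A) : q%:R = 0 :> k ->
  max_ideal_pow n.+1 (a - b) -> max_ideal_pow n.+2 (a ^+ q - b ^+ q).
Proof.
move=> q0 mab; rewrite subrXX mulrC; apply: max_ideal_pow_mul => //.
have /max_ideal_pow1 : max_ideal_pow 1 (a - b) by apply: max_ideal_pow_leq mab.
rewrite /max_ideal rmorphB => /eqP; rewrite subr_eq0 => /eqP rab.
rewrite rmorph_sum (eq_bigr (fun=> residue A b ^+ q.-1)) => [|i _].
  by rewrite sumr_const card_ord -mulr_natr q0 mulr0.
rewrite rmorphM !rmorphXn /= rab -exprD subnK //.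
by rewrite -ltnS; case: q i {q0} => [[]|].
Qed.

Lemma ghost_max_ideal n (a b : nat -> A) :
    (forall i, residue A (a i) = residue A (b i)) ->
  max_ideal_pow n.+1 (ghost p n a - ghost p n b).
Proof.
move=> ab; rewrite /ghost -sumrB; apply: max_ideal_pow_sum => i _.
have lein : (i <= n)%N by rewrite -ltnS.
rewrite -mulrnBl -mulr_natl -[X in max_ideal_pow X.+1](subnKC lein) -addnS.
apply: max_ideal_pow_addM.
  by apply: (max_ideal_pow_pdvd p0); exists 1.
elim: (n - i)%N => [|m IHm].
  by rewrite !expr1; apply/max_ideal_pow1; rewrite /max_ideal rmorphB /= ab subrr.
by rewrite expnSr !exprM; apply: max_ideal_powXB.
Qed.

Lemma exp_cardX (c : k) n : c ^+ (p ^ (s * n)) = c.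
Proof.
elim: n => [|n IHn]; first by rewrite muln0 expr1.
by rewrite mulnS expnD exprM -card_k expf_card.
Qed.

Lemma max_ideal_sep (x y : A) (u : nat -> A) :
    (forall n, max_ideal_pow n (x - u n)) -> (forall n, max_ideal_pow n (y - u n)) ->
  x = y.
Proof.
move=> xu yu; apply/eqP; rewrite -subr_eq0; apply/eqP/cplA.1 => n.
by rewrite -(subrKA (u n)) -[u n - y]opprB; apply: max_ideal_powB.
Qed.

(* w is sent to the limit of the ghost components w_(s n) of any coordinatewise
   lift of w: these depend on the lift only modulo m^(s n + 1), and the q-power
   Frobenius of k is the identity. *)
Lemma witt_map_exists :
  exists phi : {rmorphism W -> A}, forall w, residue A (phi w) = witt_res w.
Proof.
have /choice[h hK] := locA.1.
pose G n (w : W) := ghost p (s * n) (h \o wcoef w).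
have leG n : (n <= (s * n).+1)%N by apply: leqW; rewrite leq_pmull.
have GE n (w : W) (a : nat -> A) : (forall i, residue A (a i) = wcoef w i) ->
    max_ideal_pow n (ghost p (s * n) a - G n w).
  by move=> aw; apply: max_ideal_pow_leq (leG n) (ghost_max_ideal _ _) => i /=; rewrite aw hK.
have dG (w : W) n : max_ideal_pow n (G n.+1 w - G n w).
  (* Modulo p^(s n + 1), [ghost_addn] lowers the index s(n+1) to s n at the cost of p^s-th powers,
     which leave the residues in k unchanged. *)
  rewrite /G mulnSr -(subrKA (ghost p (s * n) (fun i => (h (wcoef w i)) ^+ (p ^ s)))).
  apply: max_ideal_powD; last first.
    by apply: GE => i; rewrite rmorphXn /= hK -card_k expf_card.
  apply: max_ideal_pow_leq (leG n) _; apply: (max_ideal_pow_pdvd p0).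
  exact: (ghost_addn _ _ _ (h \o wcoef w)).
have /choice[f fP] := fun w => cplA.2 (fun n => G n w) (dG w).
have f_lim w x : (forall n, max_ideal_pow n (x - G n w)) -> f w = x.
  by move=> xP; apply: (@max_ideal_sep _ _ (fun n => G n w)).
have fB : zmod_morphism f.
  move=> x y; apply: f_lim => n.
  pose a := h \o wcoef x; pose b := h \o wcoef y.
  have gE : ghost p (s * n) (wadd p a (wopp p b)) = G n x - G n y.
    by rewrite ghost_wadd // ghost_wopp.
  rewrite -(subrKA (G n x - G n y)); apply: max_ideal_powD.
    have -> : f x - f y - (G n x - G n y) = (f x - G n x) - (f y - G n y) by ring.
    exact: max_ideal_powB.
  rewrite -gE; apply: GE => i.
  have := congr1 (fun g => g i) (wadd_morph p (residue A) a (wopp p b)).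
  move=> /= ->; rewrite wopp_morph.
  by congr (wadd p _ (wopp p _) i); apply: funext => j /=; rewrite hK.
have fM : monoid_morphism f.
  split=> [|x y]; apply: f_lim => n.
    rewrite -(ghost_wone p_pr A (s * n)); apply: GE => i.
    by rewrite /wone rmorph_nat.
  pose a := h \o wcoef x; pose b := h \o wcoef y.
  have gE : ghost p (s * n) (wmul p a b) = G n x * G n y by rewrite ghost_wmul.
  rewrite -(subrKA (G n x * G n y)); apply: max_ideal_powD.
    rewrite (_ : _ - _ = f y * (f x - G n x) + G n x * (f y - G n y)); last by ring.
    by apply: max_ideal_powD; apply: max_ideal_powM.
  rewrite -gE; apply: GE => i.
  have := congr1 (fun g => g i) (wmul_morph p (residue A) a b).
  move=> /= ->.
  by congr (wmul p _ _ i); apply: funext => j /=; rewrite hK.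
pose fZ := GRing.isZmodMorphism.Build _ _ f fB.
pose fR := GRing.isMonoidMorphism.Build _ _ f fM.
pose F : {rmorphism W -> A} := HB.pack f fZ fR.
exists F => w.
have := fP w 1%N => /max_ideal_pow1; rewrite /max_ideal rmorphB => /eqP.
rewrite subr_eq0 => /eqP -> /=; rewrite /G ghost_rmorph /ghost big_ord_recl subn0 /=.
rewrite hK exp_cardX mulr1n big1 ?addr0 // => i _.
by rewrite /bump leq0n add1n expnSr mulrnA -mulr_natr p0 mulr0.
Qed.

(** w and its p^s-th power differ by a multiple of p, and both multiplication by p and the p^s-th
    power improve agreement modulo a power of the maximal ideal to agreement modulo the next one. *)
Lemma witt_map_unique (phi psi : {rmorphism W -> A}) :
    (forall w, residue A (phi w) = witt_res w) ->
    (forall w, residue A (psi w) = witt_res w) ->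
  phi =1 psi.
Proof.
move=> rphi rpsi w; apply/eqP; rewrite -subr_eq0; apply/eqP/cplA.1 => n.
suff main : max_ideal_pow n.+1 (phi w - psi w) by apply: max_ideal_pow_leq main.
elim: n w => [|n IHn] w.
  by apply/max_ideal_pow1; rewrite /max_ideal rmorphB /= rphi rpsi subrr.
have [|z /eqP] := witt_pdvd_res s_gt0 card_k (x := w - w ^+ (p ^ s)).
  by rewrite rmorphB rmorphXn -card_k expf_card subrr.
rewrite subr_eq => /eqP ->; rewrite !rmorphD !rmorphMn !rmorphXn.
rewrite opprD addrACA.
apply: max_ideal_powD.
  rewrite -mulrnBl -mulr_natl; apply: max_ideal_pow_mul => //.
  by rewrite /max_ideal rmorph_nat.
by apply: max_ideal_powXB => //; rewrite -(prednK s_gt0) expnS natrM p0 mul0r.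
Qed.

End StructureMap.

(** * The ring W(k)[[X]]/(X^2 - pX) *)

Section FpsConstants.
Variable A : comNzRingType.

Definition fps_const (a : A) : fps A := Fps (fun n => if n == 0%N then a else 0).

Lemma fps_const_zmod : zmod_morphism fps_const.
Proof. by move=> a b; apply: fpsP => -[|n] //=; rewrite subrr. Qed.

Lemma fcoef_constM a (f : fps A) n : fcoef (fps_const a * f) n = a * fcoef f n.
Proof.
by rewrite /= big_ord_recl /= subn0 big1 ?addr0 // => i _; rewrite mul0r.
Qed.

Lemma fps_const_monoid : monoid_morphism fps_const.
Proof.
split=> [|a b]; first by apply: fpsP => -[].
by apply: fpsP => n; rewrite fcoef_constM; case: n => //= n; rewrite mulr0.
Qed.

HB.instance Definition _ :=
  GRing.isZmodMorphism.Build A (fps A) fps_const fps_const_zmod.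
HB.instance Definition _ :=
  GRing.isMonoidMorphism.Build A (fps A) fps_const fps_const_monoid.

Lemma fcoefMX (f : fps A) n : fcoef (f * fpsX) n = if n is m.+1 then fcoef f m else 0.
Proof.
rewrite /=; case: n => [|n]; first by rewrite big_ord1 mulr0.
rewrite (bigD1 (inord n)) //= inordK // subSnn mulr1 big1 ?addr0 // => i /eqP ne_in.
case: eqP => [i1|_]; last by rewrite mulr0.
by case: ne_in; apply: val_inj; rewrite /= inordK //; have := ltn_ord i; lia.
Qed.

Lemma fcoefD (f g : fps A) n : fcoef (f + g) n = fcoef f n + fcoef g n.
Proof. by []. Qed.

Lemma fcoefB (f g : fps A) n : fcoef (f - g) n = fcoef f n - fcoef g n.
Proof. by []. Qed.

Lemma fcoef_const a n : fcoef (fps_const a) n = if n == 0%N then a else 0.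
Proof. by []. Qed.

Lemma fcoefMn (f : fps A) m n : fcoef (f *+ m) n = fcoef f n *+ m.
Proof. by elim: m => // m IHm; rewrite !mulrS /= IHm. Qed.

End FpsConstants.

Section XpXRing.
Variables (p s : nat) (k : finFieldType) (p_pr : prime p).
Hypotheses (s_gt0 : (0 < s)%N) (card_k : #|k| = (p ^ s)%N).
Local Notation W := (witt p_pr k).
Local Notation T := (XpX_ring p_pr k).
Local Open Scope quotient_scope.

Let pi : {rmorphism witt_fps p_pr k -> XpX_quo p_pr k} := \pi_(XpX_quo p_pr k).

Definition XpX_const : {rmorphism W -> T} := pi \o (@fps_const W).

Definition XpX_X : T := pi fpsX.

Lemma XpX_const_res w : residue T (XpX_const w) = witt_res w.
Proof. exact: XpX_residue_pi. Qed.

Lemma XpX_X_res : residue T XpX_X = 0.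
Proof. by rewrite [LHS]XpX_residue_pi /witt_fps_res fps_coef0X rmorph0. Qed.

Lemma XpX_pi0 (f : witt_fps p_pr k) : pi f = 0 <-> exists g, f = g * XpX_gen p_pr k.
Proof.
have -> : (pi f = 0) <-> f \in @XpX_ideal p p_pr k.
  split=> [pf|fI].
    by rewrite -[f]subr0 Quotient.idealrBE -[\pi f]/(pi f) pf rmorph0.
  by apply/eqP; rewrite -(rmorph0 pi) -Quotient.idealrBE subr0.
by split=> [/asboolP|?] //; apply/asboolP.
Qed.

Lemma fcoef_mul_gen (g : witt_fps p_pr k) n :
  fcoef (g * XpX_gen p_pr k) n.+1 =
  (if n is m.+1 then fcoef g m else 0) - fcoef g n *+ p.
Proof.
have -> : g * XpX_gen p_pr k = g * fpsX * fpsX - g * fpsX *+ p.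
  by rewrite /XpX_gen mulrBr expr2 mulrA mulr_natl mulrnAr.
by rewrite fcoefB fcoefMn !fcoefMX.
Qed.

Lemma fcoef_mul_gen0 (g : witt_fps p_pr k) : fcoef (g * XpX_gen p_pr k) 0 = 0.
Proof.
have -> : fcoef (g * XpX_gen p_pr k) 0 = fps_coef0 g * fps_coef0 (XpX_gen p_pr k : fps W).
  exact: (rmorphM (@fps_coef0 W)).
have -> : fps_coef0 (XpX_gen p_pr k : fps W) = fps_coef0 fpsX ^+ 2 - p%:R * fps_coef0 fpsX.
  by rewrite /XpX_gen -rmorphXn -(rmorph_nat (@fps_coef0 W)) -rmorphM -rmorphB.
by rewrite fps_coef0X expr0n mulr0 subr0 mulr0.
Qed.

Lemma XpX_combE a b :
  XpX_const a + XpX_const b * XpX_X = pi (fps_const a + fps_const b * fpsX).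
Proof. by rewrite rmorphD rmorphM. Qed.

Lemma XpX_rel : XpX_X * XpX_X = XpX_X *+ p.
Proof.
apply/eqP; rewrite -subr_eq0 -rmorphM -rmorphMn -rmorphB; apply/eqP/XpX_pi0.
by exists 1; rewrite mul1r /XpX_gen expr2 mulr_natl.
Qed.

Let wc : pcomplete p W := witt_pcomplete s_gt0 card_k.
Let ws : pseparated p W := witt_pseparated s_gt0 card_k.

(** Since X^(j+1) = p^j X, the series f reduces to f_0 + l_1 X, where l_n is the sum of the f_(n+j)
    p^j. *)
Lemma XpX_gens (x : T) : exists a b, x = XpX_const a + XpX_const b * XpX_X.
Proof.
have [f ->] : exists f, x = pi f by exists (generic_quotient.repr x); rewrite [pi _]reprK.
have /choice[l lP] := fun n => wc (fun j => fcoef f (n + j)).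
have lE n : l n = fcoef f n + l n.+1 *+ p.
  apply/eqP; rewrite -subr_eq0; apply/eqP/ws => m; apply: (@zpdvd_leq p _ m m.+1) => //.
  have := lP n m.+1; rewrite big_ord_recl expn0 addn0 => dl.
  have [z zE] := lP n.+1 m.
  rewrite -(subrKA (fcoef f n *+ 1 + \sum_(i < m) fcoef f (n + lift ord0 i) *+ p ^ (lift ord0 i))).
  apply: zpdvdD => //; exists (- z); rewrite mulNrn expnSr mulrnA -zE mulrnBl -sumrMnl.
  rewrite mulr1n opprD addrACA subrr add0r opprB; congr (_ - _).
  by apply: eq_bigr => i _; rewrite lift0 -mulrnA -expnSr addSnnS.
exists (fcoef f 0%N), (l 1%N).
apply/eqP; rewrite -subr_eq0 XpX_combE -rmorphB; apply/eqP/XpX_pi0.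
(* The cofactor comes from l_n = f_n + p l_(n+1): the coefficient of index n+2 of its product with
   the generator is l_(n+2) - p l_(n+3). *)
exists (Fps (fun n => l n.+2)); apply: fpsP => n.
rewrite fcoefB fcoefD fcoefMX !fcoef_const; case: n => [|n].
  by rewrite fcoef_mul_gen0 addr0 subrr.
rewrite fcoef_mul_gen add0r; case: n => [|n].
  by rewrite (lE 1%N) opprD addrA subrr.
by rewrite subr0 [fcoef f _](_ : _ = l n.+2 - l n.+3 *+ p) // (lE n.+2) addrK.
Qed.

(** The coefficients of index at least 2 force g_n = p g_(n+1), so g_0 is divisible by every power
    of p and vanishes; a and b are then read off from the coefficients 0 and 1. *)
Lemma XpX_free a b : XpX_const a + XpX_const b * XpX_X = 0 -> a = 0 /\ b = 0.
Proof.
rewrite XpX_combE => /XpX_pi0[g gE].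
have cE n : fcoef (fps_const a + fps_const b * fpsX) n = fcoef (g * XpX_gen p_pr k) n.
  by rewrite gE.
have gp n : fcoef g n = fcoef g n.+1 *+ p.
  have := cE n.+2; rewrite fcoef_mul_gen fcoefD fcoefMX !fcoef_const add0r.
  by move=> /esym/eqP; rewrite subr_eq0 => /eqP.
have g0 : fcoef g 0%N = 0.
  apply: ws => n; exists (fcoef g n); elim: n => [|n IHn]; first by rewrite mulr1n.
  by rewrite IHn gp -mulrnA -expnS.
split.
  by have := cE 0%N; rewrite fcoef_mul_gen0 fcoefD fcoefMX addr0.
have := cE 1%N; rewrite fcoef_mul_gen fcoefD fcoefMX !fcoef_const add0r.
by rewrite g0 mul0rn subr0.
Qed.

Lemma XpX_pseparated : pseparated p T.
Proof.
move=> x dx; have [a [b xE]] := XpX_gens x.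
have dab n : pdvd (p ^ n) a /\ pdvd (p ^ n) b.
  have [y] := dx n; have [c [d ->]] := XpX_gens y; rewrite xE => abE.
  have [|/eqP a0 /eqP b0] := @XpX_free (a - c *+ p ^ n) (b - d *+ p ^ n).
    rewrite !rmorphB !rmorphMn /=; move/eqP: abE; rewrite -subr_eq0 => /eqP <-.
    by rewrite mulrBl mulrnAl mulrnDl; ring.
  by move: a0 b0; rewrite !subr_eq0 => /eqP-> /eqP->; split; eexists.
by rewrite xE (ws (fun n => (dab n).1)) (ws (fun n => (dab n).2)) !rmorph0 mul0r addr0.
Qed.

(** The kernel of the residue map is generated by p and X, and X^2 = pX. *)
Lemma XpX_sqr_pdvd (x : T) : residue T x = 0 -> pdvd p (x * x).
Proof.
have [a [b ->]] := XpX_gens x.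
rewrite rmorphD rmorphM XpX_const_res XpX_X_res mulr0 addr0.
move/(witt_pdvd_res s_gt0 card_k) => [c ->]; set u := XpX_const b; set X := XpX_X.
rewrite rmorphMn; set v := XpX_const c.
exists (v * v *+ p + u * X * v *+ 2 + u * u * X).
have -> : (v *+ p + u * X) * (v *+ p + u * X) =
    (v * v *+ p + u * X * v *+ 2) *+ p + u * u * (X * X) by ring.
by rewrite XpX_rel [RHS]mulrnDl mulrnAr.
Qed.

Lemma XpX_in_Chat : in_Chat T.
Proof.
apply: (fin_in_Chat s_gt0 card_k XpX_const_res (r := 2)
  (b := fun i => if i == 0%N then 1 else XpX_X)) => [x||e ee e0].
- have [a [c ->]] := XpX_gens x; exists (fun i => if i == 0%N then a else c).
  by rewrite big_ord_recl big_ord1 /= mulr1.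
- exact: XpX_pseparated.
(* Here e = e^2 lies in pT, and multiplying e by itself again gains one factor p at each turn. *)
apply: XpX_pseparated => n; have [y yE] := XpX_sqr_pdvd e0.
elim: n => [|n [z zE]]; first by exists e.
exists (z * y); rewrite -[LHS]ee {1}zE -ee yE.
by rewrite mulrnAl mulrnAr -mulrnA -expnS.
Qed.

End XpXRing.

(** * Group algebras *)

(* The group algebra A[gT]; {ffun gT -> A} itself carries the pointwise product. *)
Definition galg (A : comNzRingType) (gT : finGroupType) := {ffun gT -> A}.

Section GroupAlgebra.
Variables (A : comNzRingType) (gT : finGroupType).
Local Notation B := (galg A gT).

HB.instance Definition _ := GRing.Zmodule.copy B {ffun gT -> A}.

Definition galg_of (g : gT) : B := [ffun h => (h == g)%:R].

Definition galg_mul (u v : B) : B := [ffun g => \sum_h u h * v (h^-1 * g)%g].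

Let mulA : associative galg_mul.
Proof.
move=> u v w; apply/ffunP => g; rewrite !ffunE.
under [RHS]eq_bigr do rewrite ffunE mulr_suml.
rewrite exchange_big /=; apply: eq_bigr => h _.
rewrite ffunE mulr_sumr (reindex_inj (mulgI h^-1)%g) /=; apply: eq_bigr => j _.
by rewrite mulrA invMg invgK mulgA mulgK.
Qed.

Let mul1l : left_id (galg_of 1%g) galg_mul.
Proof.
move=> u; apply/ffunP => g; rewrite ffunE (bigD1 1%g) //= ffunE eqxx mul1r invg1 mul1g.
by rewrite big1 ?addr0 // => h /negPf h1; rewrite ffunE h1 mul0r.
Qed.

Let mul1r : right_id (galg_of 1%g) galg_mul.
Proof.
move=> u; apply/ffunP => g; rewrite ffunE (bigD1 g) //= ffunE mulVg eqxx mulr1.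
rewrite big1 ?addr0 // => h hg; rewrite ffunE -(inj_eq (mulgI h)) mulKVg mulg1.
by rewrite eq_sym (negPf hg) mulr0.
Qed.

Let mulDl : left_distributive galg_mul +%R.
Proof.
move=> u v w; apply/ffunP => g; rewrite !ffunE -big_split; apply: eq_bigr => h _.
by rewrite ffunE mulrDl.
Qed.

Let mulDr : right_distributive galg_mul +%R.
Proof.
move=> u v w; apply/ffunP => g; rewrite !ffunE -big_split; apply: eq_bigr => h _.
by rewrite ffunE mulrDr.
Qed.

Let one_neq0 : galg_of 1%g != 0 :> B.
Proof.
by apply/eqP => /ffunP/(_ 1%g)/eqP; rewrite !ffunE eqxx oner_eq0.
Qed.

HB.instance Definition _ :=
  GRing.Zmodule_isNzRing.Build B mulA mul1l mul1r mulDl mulDr one_neq0.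

Lemma galgMnE (u : B) m g : (u *+ m) g = u g *+ m.
Proof. by rewrite ffunMnE. Qed.

Variable p : nat.

Lemma galg_pcomplete : pcomplete p A -> pcomplete p B.
Proof.
move=> cA x; have /choice[l lP] := fun g => cA (fun j => x j g).
exists [ffun g => l g] => n; have /choice[z zE] := fun g => lP g n.
exists [ffun g => z g]; apply/ffunP => g; rewrite galgMnE !ffunE -zE sum_ffunE.
by congr (_ - _); apply: eq_bigr => j _; rewrite galgMnE.
Qed.

Lemma galg_pseparated : pseparated p A -> pseparated p B.
Proof.
move=> sA x dx; apply/ffunP => g; rewrite ffunE; apply: sA => n.
by have [y ->] := dx n; rewrite galgMnE; eexists.
Qed.

Lemma galg_pfinite : pfinite p A -> pfinite p B.
Proof.
move=> [F [c cP]]; exists {ffun gT -> F}, (fun u : B => [ffun g => c (u g)]).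
move=> u v /ffunP uv.
have /choice[z zE] : forall g, exists z, u g - v g = z *+ p.
  by move=> g; apply: cP; have := uv g; rewrite !ffunE.
by exists [ffun g => z g]; apply/ffunP => g; rewrite galgMnE !ffunE zE.
Qed.

End GroupAlgebra.

Section GroupAlgebraAction.
Variables (C : comNzRingType) (A : comUnitRingType) (phi : {rmorphism C -> A}).
Variables (gT : finGroupType) (n : nat) (rho : mx_representation A [set: gT] n).
Implicit Types u v : galg C gT.

(** The extension of [rho] to an algebra map on the group algebra, with coefficients acting through
    [phi]. *)
Definition gop u : 'M[A]_n := \sum_g phi (u g) *: rho g.

Lemma gop_zmod : zmod_morphism gop.
Proof.
move=> u v; rewrite /gop -sumrB; apply: eq_bigr => g _.
by rewrite !ffunE rmorphB scalerBl.
Qed.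

HB.instance Definition _ := GRing.isZmodMorphism.Build (galg C gT) 'M[A]_n gop gop_zmod.

Lemma gopM u v : gop (u * v) = gop u *m gop v.
Proof.
rewrite /gop mulmx_suml.
under eq_bigr do rewrite ffunE rmorph_sum scaler_suml.
rewrite exchange_big /=; apply: eq_bigr => h _.
rewrite (reindex_inj (mulgI h)) mulmx_sumr; apply: eq_bigr => g _ /=.
by rewrite mulKg rmorphM repr_mxM ?inE // -scalemxAl -scalemxAr scalerA.
Qed.

Lemma gop_of g : gop (galg_of C g) = rho g.
Proof.
rewrite /gop (bigD1 g) //= ffunE eqxx rmorph1 scale1r big1 ?addr0 // => h /negPf hg.
by rewrite ffunE hg rmorph0 scale0r.
Qed.

Lemma gop1 : gop 1 = 1%:M.
Proof. by rewrite -(repr_mx1 rho); apply: gop_of. Qed.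

Lemma gopZ c u : gop [ffun g => c * u g] = phi c *: gop u.
Proof.
rewrite /gop scaler_sumr; apply: eq_bigr => g _.
by rewrite ffunE rmorphM scalerA.
Qed.

End GroupAlgebraAction.

(** * Representability *)

(* The largest quotient of a polynomial ring through which a given class of maps to
   objects of the category factors. The class ranges over the whole category: being
   used in a proposition only, it does not affect the universe of the quotient. *)
Section UniversalImage.
Variables (k : fieldType) (I : choiceType) (Q : forall A : Chat k, (I -> A) -> Prop).
Variable r : I -> k.
Hypothesis Q_res : forall (A : Chat k) (h : I -> A) i, Q h -> residue A (h i) = r i.
Variables (A0 : Chat k) (h0 : I -> A0).
Hypothesis Qh0 : Q h0.

Definition image_ideal : {pred zpoly I} :=
  fun f => `[< forall (A : Chat k) (h : I -> A), Q h -> zpoly_ev h f = 0 >].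

Lemma image_idealr_closed : idealr_closed image_ideal.
Proof.
split=> [||a f g].
- by apply/asboolP => A h _; rewrite rmorph0.
- by apply/negP => /asboolP/(_ A0 h0 Qh0)/eqP; rewrite rmorph1 oner_eq0.
move=> /asboolP fI /asboolP gI; apply/asboolP => A h Qh.
by rewrite rmorphD rmorphM /= fI // gI // mulr0 addr0.
Qed.

HB.instance Definition _ := isIdealr.Build (zpoly I) image_ideal image_idealr_closed.

Definition image_ring := {ideal_quot image_ideal}.
HB.instance Definition _ := GRing.ComNzRing.on image_ring.
HB.instance Definition _ := GRing.ComNzRing_hasMulInverse.Build image_ring
  (@cmulVx image_ring) (@cunitPl image_ring) (@cinv_out image_ring).

Local Open Scope quotient_scope.

Let pi : {rmorphism zpoly I -> image_ring} := \pi_image_ring.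

Let pi_surj x : exists f, x = pi f.
Proof. by exists (generic_quotient.repr x); rewrite [pi _]reprK. Qed.

Lemma image_lift (R : comNzRingType) (f : {rmorphism zpoly I -> R}) :
    (forall x, x \in image_ideal -> f x = 0) ->
  exists g : {rmorphism image_ring -> R}, forall x, g (pi x) = f x.
Proof.
move=> f0; pose g (x : image_ring) := f (generic_quotient.repr x).
have gE x : g (pi x) = f x.
  apply/eqP; rewrite -subr_eq0 -rmorphB f0 //.
  by rewrite Quotient.idealrBE reprK.
have gB : zmod_morphism g.
  move=> x y; have [[u ->] [v ->]] := conj (pi_surj x) (pi_surj y).
  by rewrite -(rmorphB pi) !gE rmorphB.
have gM : monoid_morphism g.
  split=> [|x y]; first by rewrite -(rmorph1 pi) gE rmorph1.
  have [[u ->] [v ->]] := conj (pi_surj x) (pi_surj y).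
  by rewrite -(rmorphM pi) !gE rmorphM.
pose gZ := GRing.isZmodMorphism.Build _ _ g gB.
pose gR := GRing.isMonoidMorphism.Build _ _ g gM.
pose G : {rmorphism image_ring -> R} := HB.pack g gZ gR.
by exists G.
Qed.

(** Three properties of the quotient: admissible families factor through it, the resulting maps are
    jointly injective, and the [x i] generate it as a ring, the last in the form of an induction
    principle. *)
Lemma universal_image : exists (U : augRing k) (x : I -> U),
  [/\ forall (A : Chat k) (h : I -> A), Q h ->
        exists f : aug_hom U A, forall i, f (x i) = h i,
      forall u v : U, (forall (A : Chat k) (f : aug_hom U A), Q (f \o x) -> f u = f v) -> u = v
    & forall P : U -> Prop, P 1 -> (forall u v, P u -> P v -> P (u - v)) ->
        (forall u v, P u -> P v -> P (u * v)) -> (forall i, P (x i)) -> forall u, P u].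
Proof.
(* The admissible family [h0] shows that the relations also hold between the prescribed residues,
   which yields the residue map of the quotient. *)
have ideal_res f : f \in image_ideal -> zpoly_ev r f = 0.
  move=> /asboolP fI; have := fI A0 h0 Qh0 => /(congr1 (residue A0)).
  rewrite zpoly_evK rmorph0 => <-; congr (zpoly_ev _ _).
  by apply: funext => i /=; rewrite Q_res.
have [res resE] := image_lift ideal_res.
pose U : augRing k := AugRing res.
have lift_hom (A : Chat k) (h : I -> A) : Q h ->
    exists g : aug_hom U A, forall f, g (pi f) = zpoly_ev h f.
  move=> Qh; have [f /asboolP fI|g gE] := @image_lift A (zpoly_ev h); first exact: fI.
  have gP x : residue A (g x) = residue U x.
    have [f ->] := pi_surj x; rewrite gE resE zpoly_evK; congr (zpoly_ev _ _).
    by apply: funext => i /=; rewrite Q_res.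
  by exists (@AugHom k U A g gP).
exists U, (fun i => pi (zpolyX i)); split=> [A h Qh|u v|P P1 PB PM PX u].
- by have [g gE] := lift_hom A h Qh; exists g => i; rewrite gE zpoly_evX.
- have [[f ->] [g ->]] := conj (pi_surj u) (pi_surj v) => fg.
  apply/eqP; rewrite -Quotient.idealrBE; apply/asboolP => A h Qh.
  have [F FE] := lift_hom A h Qh; rewrite -[LHS](FE (f - g)) !rmorphB (fg A F) ?subrr //.
  rewrite (_ : _ \o _ = h) //; apply: funext => i.
  exact: etrans (FE _) (zpoly_evX h i).
have [f ->] := pi_surj u.
apply: (@zpoly_ind I (fun f => P (pi f))) => {f} //.
- by rewrite rmorph1.
- by move=> f g Pf Pg; rewrite rmorphB; apply: PB.
by move=> f g Pf Pg; rewrite rmorphM; apply: PM.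
Qed.

End UniversalImage.

Section RankOne.
Variables (k : fieldType) (A : augRing k) (locA : is_local A).

Lemma residue_unitmx n (M : 'M[A]_n) : map_mx (residue A) M \in unitmx -> M \in unitmx.
Proof.
rewrite !unitmxE det_map_mx unitfE => /eqP M0.
by apply: locA.2; apply: M0.
Qed.

(* E is conjugate to delta_mx 0 0 by K = E D + (1 - E) (1 - D), D = delta_mx 0 0. *)
Lemma rank_one_idempotent n (E : 'M[A]_n.+1) :
    E *m E = E -> map_mx (residue A) E = delta_mx 0 0 ->
  exists (c : 'cV[A]_n.+1) (r : 'rV[A]_n.+1),
    [/\ E = c *m r, r *m c = 1%:M,
        map_mx (residue A) c = delta_mx 0 0 & map_mx (residue A) r = delta_mx 0 0].
Proof.
move=> EE Ed; pose D : 'M[A]_n.+1 := delta_mx 0 0.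
have DD : D *m D = D by rewrite mul_delta_mx.
pose K := E *m D + (1%:M - E) *m (1%:M - D).
have KD : K *m D = E *m D.
  by rewrite mulmxDl -!mulmxA [(1%:M - D) *m D]mulmxBl mul1mx DD subrr mulmx0 addr0.
have EK : E *m K = E *m D.
  by rewrite mulmxDr !mulmxA [E *m (1%:M - E)]mulmxBr mulmx1 EE subrr mul0mx addr0.
have Kd : map_mx (residue A) K = 1%:M.
  rewrite map_mxD !map_mxM !map_mxB map_mx1 Ed map_delta_mx; set d := delta_mx 0 0.
  have dd : d *m d = d by rewrite mul_delta_mx.
  rewrite dd mulmxBl mul1mx mulmxBr mulmx1 dd.
  by rewrite subrr subr0 addrC subrK.
have uK : K \in unitmx by apply: residue_unitmx; rewrite Kd unitmx1.
have DE : D = delta_mx 0 (0 : 'I_1) *m delta_mx 0 0 by rewrite mul_delta_mx.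
exists (K *m delta_mx 0 0), (delta_mx 0 0 *m invmx K); split.
- by rewrite mulmxA -(mulmxA K) -DE KD -EK mulmxK.
- by rewrite -mulmxA mulKmx // mul_delta_mx; apply/matrixP => i j; rewrite !mxE !ord1.
- by rewrite map_mxM Kd mul1mx map_delta_mx.
rewrite map_mxM; have [_ <-] := Defs.map_mx_unit (residue A) uK.
by rewrite Kd invmx1 mulmx1 map_delta_mx.
Qed.

End RankOne.

Section Representability.
Variables (p s : nat) (k : finFieldType) (p_pr : prime p).
Hypotheses (s_gt0 : (0 < s)%N) (card_k : #|k| = (p ^ s)%N).
Local Notation W := (witt p_pr k).
Variables (gT : finGroupType) (n' : nat).
Local Notation n := n'.+1.
Variable rhobar : mx_representation k [set: gT] n.
Local Notation B := (galg W gT).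

Let wres : {rmorphism W -> k} := @witt_res p p_pr k.

Let wc : pcomplete p W := witt_pcomplete s_gt0 card_k.
Let ws : pseparated p W := witt_pseparated s_gt0 card_k.

Lemma witt_pfinite : pfinite p W.
Proof.
exists k, (@witt_res p p_pr k) => x y xy; apply: (witt_pdvd_res s_gt0 card_k).
by rewrite rmorphB /= xy subrr.
Qed.

Hypothesis span_rhobar : forall M : 'M[k]_n, exists c : gT -> k, M = \sum_g c g *: rhobar g.

Lemma gop_rhobar_surj (M : 'M[k]_n) : exists u : B, gop wres rhobar u = M.
Proof.
have [c ->] := span_rhobar M.
exists [ffun g => Witt p_pr (fun i => if i == 0%N then c g else 0)].
by apply: eq_bigr => g _; rewrite ffunE.
Qed.

(** Some power of a preimage u of the matrix unit is congruent modulo p to an idempotent, and powers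
    of u still act as the matrix unit. *)
Lemma exists_rank_one_idempotent :
  exists e : B, e * e = e /\ gop wres rhobar e = delta_mx 0 0.
Proof.
have [u uE] := gop_rhobar_surj (delta_mx 0 0).
have [c [e [c_gt0 ee [z zE]]]] := lift_idempotent_exp (@galg_pcomplete _ gT _ wc)
  (@galg_pseparated _ gT _ ws) (@galg_pfinite _ gT _ witt_pfinite) u.
exists e; split=> //; move/eqP: zE; rewrite subr_eq addrC => /eqP ->.
have -> : gop wres rhobar (u ^+ c + z *+ p) =
    gop wres rhobar (u ^+ c) + gop wres rhobar z *+ p by rewrite raddfD raddfMn.
have -> : gop wres rhobar z *+ p = 0.
  by apply/matrixP => i j; rewrite mulmxnE mxE -mulr_natr (card_natr0 p_pr card_k) mulr0.
rewrite addr0 -(prednK c_gt0); elim: c.-1 => [|m IHm]; first by rewrite expr1.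
by rewrite exprS gopM uE IHm mul_delta_mx.
Qed.

Lemma residue_gop (A : augRing k) (phi : {rmorphism W -> A}) (rho : Defs.lift rhobar A) (u : B) :
    (forall w, residue A (phi w) = witt_res w) ->
  map_mx (residue A) (gop phi rho u) = gop wres rhobar u.
Proof.
move=> rphi; rewrite /gop raddf_sum; apply: eq_bigr => g _ /=.
by rewrite map_mxZ rphi liftP ?inE.
Qed.

Definition structure_map (A : Chat k) : {rmorphism W -> A} :=
  let: And3 loc _ cpl := ChatP A in
  projT1 (cid (witt_map_exists p_pr s_gt0 card_k loc cpl)).

Lemma structure_mapP (A : Chat k) w : residue A (structure_map A w) = witt_res w.
Proof. by rewrite /structure_map; case: (ChatP A) => loc ? cpl; case: cid. Qed.

Lemma structure_map_unique (A : Chat k) (phi : {rmorphism W -> A}) :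
  (forall w, residue A (phi w) = witt_res w) -> phi =1 structure_map A.
Proof.
move=> rphi; have [_ _ cpl] := ChatP A.
exact: (witt_map_unique s_gt0 card_k cpl rphi (structure_mapP A)).
Qed.

Variable e : B.
Hypotheses (ee : e * e = e) (gop_e : gop wres rhobar e = delta_mx 0 0).

(* The trace of e rho(u) e, where rho(e) has rank one. *)
Definition lam (A : Chat k) (rho : Defs.lift rhobar A) (u : B) : A :=
  \tr (gop (structure_map A) rho e *m gop (structure_map A) rho u).

Section Lam.
Variable A : Chat k.
Implicit Type rho : Defs.lift rhobar A.
Local Notation op rho u := (gop (structure_map A) rho u).

Let locA : is_local A. Proof. by have [] := ChatP A. Qed.

(** With rho(e) = c r, the trace of c r rho(u) is the scalar r rho(u) c. *)
Lemma lam_rank_one rho : exists (c : 'cV[A]_n) (r : 'rV[A]_n),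
  [/\ op rho e = c *m r, r *m c = 1%:M, forall u, (lam rho u)%:M = r *m op rho u *m c,
      map_mx (residue A) c = delta_mx 0 0 & map_mx (residue A) r = delta_mx 0 0].
Proof.
have [||c [r [Ecr rc1 cd rd]]] := @rank_one_idempotent _ _ locA _ (op rho e).
- by rewrite -gopM ee.
- by rewrite (residue_gop _ _ (structure_mapP A)).
exists c, r; split=> // u; rewrite /lam Ecr -mulmxA mxtrace_mulC.
by rewrite trace_mx11 -mx11_scalar.
Qed.

(** The factor c r between r rho(u) c and r rho(v) c is rho(e). Hence the span of the traces is
    closed under products. *)
Lemma lam_mul rho u v : lam rho u * lam rho v = lam rho (u * e * v).
Proof.
have [c [r [Ecr _ lamE _ _]]] := lam_rank_one rho.
have /matrixP/(_ 0 0) : (lam rho u * lam rho v)%:M = (lam rho (u * e * v))%:M :> 'M_1.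
  by rewrite scalar_mxM !lamE !gopM Ecr !mulmxA.
by rewrite !mxE !mulr1n.
Qed.

Lemma lamE rho u : lam rho u = \sum_g structure_map A (u g) * lam rho (galg_of W g).
Proof.
rewrite /lam {2}/gop mulmx_sumr raddf_sum; apply: eq_bigr => g _ /=.
by rewrite -scalemxAr mxtraceZ gop_of.
Qed.

Lemma lam1 rho : lam rho e = 1.
Proof.
have [c [r [Ecr rc1 lamP _ _]]] := lam_rank_one rho.
have /matrixP/(_ 0 0) : (lam rho e)%:M = 1%:M :> 'M_1.
  by rewrite lamP Ecr !mulmxA rc1 mul1mx rc1.
by rewrite !mxE !mulr1n.
Qed.

Lemma lam_res rho u : residue A (lam rho u) = \tr (delta_mx 0 0 *m gop wres rhobar u).
Proof. by rewrite /lam -trace_map_mx map_mxM !(residue_gop _ _ (structure_mapP A)) gop_e. Qed.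

Lemma lam_strict_equiv rho rho' : strict_equiv rho rho' -> lam rho =1 lam rho'.
Proof.
move=> [K [uK _ rE]] u.
have opK v : op rho' v = K *m op rho v *m invmx K.
  rewrite /gop mulmx_sumr mulmx_suml; apply: eq_bigr => g _.
  by rewrite rE ?inE // -scalemxAr -scalemxAl.
by rewrite /lam !opK !mulmxA mulmxKV // [RHS]mxtrace_mulC !mulmxA mulVmx // mul1mx.
Qed.

End Lam.
(* The canonical form D^-1 (lam (v_j g u_i))_(j,i) of a lift, where rhobar(u_i) and
   rhobar(v_j) are the first column and the first row of matrix units. *)
Variables U V : 'I_n -> B.
Hypothesis gop_U : forall i, gop wres rhobar (U i) = delta_mx i 0.
Hypothesis gop_V : forall j, gop wres rhobar (V j) = delta_mx 0 j.

Definition gram (A : comUnitRingType) (l : B -> A) (u : B) : 'M[A]_n :=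
  \matrix_(j, i) l (V j * u * U i).

Lemma canonical_form (A : Chat k) (rho : Defs.lift rhobar A) :
  exists C : 'M[A]_n, [/\ C \in unitmx, map_mx (residue A) C = 1%:M,
    gram (lam rho) 1 \in unitmx
    & forall g, invmx (gram (lam rho) 1) *m gram (lam rho) (galg_of W g) =
                invmx C *m rho g *m C].
Proof.
have locA : is_local A by have [] := ChatP A.
have [c [r [_ _ lamP cd rd]]] := lam_rank_one rho.
pose op u := gop (structure_map A) rho u.
(* The columns rho(u_i) c and the rows r rho(v_j) factor the Gram matrix of u as Q rho(u) C; both Q
   and C reduce to the identity, hence are invertible. *)
pose C : 'M[A]_n := \matrix_(a, i) (op (U i) *m c) a 0.
pose Q : 'M[A]_n := \matrix_(j, a) (r *m op (V j)) 0 a.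
have op_res u : map_mx (residue A) (op u) = gop wres rhobar u.
  exact: residue_gop (structure_mapP A).
have C1 : map_mx (residue A) C = 1%:M.
  apply/matrixP => a i; rewrite mxE [C a i]mxE.
  have -> : residue A ((op (U i) *m c) a 0) = map_mx (residue A) (op (U i) *m c) a 0.
    by rewrite [RHS]mxE.
  by rewrite map_mxM op_res gop_U cd mul_delta_mx !mxE andbT.
have Q1 : map_mx (residue A) Q = 1%:M.
  apply/matrixP => j a; rewrite mxE [Q j a]mxE.
  have -> : residue A ((r *m op (V j)) 0 a) = map_mx (residue A) (r *m op (V j)) 0 a.
    by rewrite [RHS]mxE.
  by rewrite map_mxM op_res gop_V rd mul_delta_mx !mxE eq_sym.
have uC : C \in unitmx by apply: (residue_unitmx locA); rewrite C1 unitmx1.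
have uQ : Q \in unitmx by apply: (residue_unitmx locA); rewrite Q1 unitmx1.
have rowQ j : row j Q = r *m op (V j) by apply/rowP => a; rewrite !mxE.
have colC i : col i C = op (U i) *m c by apply/colP => a; rewrite !mxE.
have gramE u : gram (lam rho) u = Q *m op u *m C.
  apply/matrixP => j i; rewrite mxE.
  have -> : (Q *m op u *m C) j i = (row j Q *m op u *m col i C) 0 0.
    by rewrite colE mulmxA -!row_mul -colE [RHS]mxE [RHS]mxE.
  have -> : lam rho (V j * u * U i) = ((lam rho (V j * u * U i))%:M : 'M_1) 0 0.
    by rewrite mxE mulr1n.
  by rewrite lamP !gopM rowQ colC !mulmxA.
exists C; split=> // [|g]; first by rewrite gramE /op gop1 mulmx1 unitmx_mul uQ uC.
rewrite !gramE /op gop1 mulmx1 gop_of.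
have [_ ->] : Q *m C \in unitmx /\ invmx (Q *m C) = invmx C *m invmx Q.
  by apply: invmx_uniq; rewrite mulmxA mulmxK // mulmxV.
by rewrite !mulmxA mulmxKV.
Qed.

(** The elements generating the universal ring. Including the images of all Witt vectors provides
    that ring with a structure map. *)
Definition datum (A : Chat k) (rho : Defs.lift rhobar A) (i : (W + gT)%type) : A :=
  match i with inl w => structure_map A w | inr g => lam rho (galg_of W g) end.

(** * The universal ring and the universal lift *)

Section UniversalRing.
Variables (T0 : Chat k) (rho0 : Defs.lift rhobar T0).
Variables (R : augRing k) (x : (W + gT)%type -> R).
Variable ev : forall A : Chat k, Defs.lift rhobar A -> aug_hom R A.
Hypothesis evX : forall (A : Chat k) (rho : Defs.lift rhobar A) i, ev rho (x i) = datum rho i.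
Hypothesis ev_inj : forall u v : R,
  (forall (A : Chat k) (rho : Defs.lift rhobar A), ev rho u = ev rho v) -> u = v.
Hypothesis R_ind : forall P : R -> Prop, P 1 -> (forall u v, P u -> P v -> P (u - v)) ->
  (forall u v, P u -> P v -> P (u * v)) -> (forall i, P (x i)) -> forall u, P u.

Lemma universal_structure_map :
  exists iota : {rmorphism W -> R}, forall w, iota w = x (inl w).
Proof.
pose f w := x (inl w).
have fB : zmod_morphism f.
  by move=> u v; apply: ev_inj => A rho; rewrite rmorphB !evX /= rmorphB.
have fM : monoid_morphism f.
  split=> [|u v]; apply: ev_inj => A rho; first by rewrite evX /= !rmorph1.
  by rewrite rmorphM !evX /= rmorphM.
pose fZ := GRing.isZmodMorphism.Build _ _ f fB.
pose fR := GRing.isMonoidMorphism.Build _ _ f fM.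
pose F : {rmorphism W -> R} := HB.pack f fZ fR.
by exists F.
Qed.

Variable iota : {rmorphism W -> R}.
Hypothesis iotaE : forall w, iota w = x (inl w).

Lemma ev_iota (A : Chat k) (rho : Defs.lift rhobar A) w :
  ev rho (iota w) = structure_map A w.
Proof. by rewrite iotaE evX. Qed.

Lemma universal_iota_res w : residue R (iota w) = witt_res w.
Proof. by rewrite -(aug_funP (ev rho0)) ev_iota structure_mapP. Qed.

Definition ulam (u : B) : R := \sum_g iota (u g) * x (inr g).

Lemma ev_ulam (A : Chat k) (rho : Defs.lift rhobar A) u : ev rho (ulam u) = lam rho u.
Proof.
rewrite lamE rmorph_sum; apply: eq_bigr => g _.
by rewrite rmorphM ev_iota evX.
Qed.

(** Products of traces are traces by [lam_mul], 1 is the trace of e and a Witt vector w is the trace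
    of w e. So the ring generated by the data is the span over W of finitely many of them. *)
Lemma ulam_surj y : exists u, y = ulam u.
Proof.
apply: (R_ind (P := fun y => exists u, y = ulam u)) => {y}.
- by exists e; apply: ev_inj => A rho; rewrite rmorph1 ev_ulam lam1.
- move=> _ _ [u ->] [v ->]; exists (u - v); apply: ev_inj => A rho.
  by rewrite rmorphB !ev_ulam /lam raddfB mulmxBr raddfB.
- move=> _ _ [u ->] [v ->]; exists (u * e * v); apply: ev_inj => A rho.
  by rewrite rmorphM !ev_ulam lam_mul.
move=> [w|g]; last by exists (galg_of W g); apply: ev_inj => A rho; rewrite evX ev_ulam.
exists [ffun g => w * e g]; apply: ev_inj => A rho.
rewrite evX ev_ulam lamE -[LHS]mulr1 -(lam1 rho) lamE mulr_sumr.
by apply: eq_bigr => g _; rewrite ffunE rmorphM mulrA.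
Qed.

(** Beyond finiteness over W, the conditions are tested under the maps [ev]: the targets are
    p-adically separated, and there 1 - y is a unit annihilating the idempotent y. *)
Lemma universal_in_Chat : in_Chat R.
Proof.
apply: (fin_in_Chat s_gt0 card_k universal_iota_res (r := #|gT|)
  (b := fun i => x (inr (nth 1%g (enum gT) i)))) => [y|y dy|y yy y0].
- have [u ->] := ulam_surj y; exists (fun i => u (nth 1%g (enum gT) i)).
  rewrite /ulam (reindex_onto enum_val enum_rank) => [|g _]; last exact: enum_rankK.
  apply: eq_big => [i|i _]; first by rewrite enum_valK eqxx.
  by rewrite !(enum_val_nth 1%g).
- apply: ev_inj => A rho; rewrite rmorph0; have [_ _ cpl] := ChatP A.
  apply: cpl.1 => m; apply: (max_ideal_pow_pdvd (card_natr0 p_pr card_k)).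
  exact: pdvd_raddf (dy m).
apply: ev_inj => A rho; rewrite rmorph0; have [loc _ _] := ChatP A.
have : ev rho y * (1 - ev rho y) = 0 by rewrite mulrBr mulr1 -rmorphM yy subrr.
move/(congr1 (fun z => z / (1 - ev rho y))); rewrite mul0r mulrK //.
apply: loc.2; rewrite /max_ideal rmorphB rmorph1 aug_funP y0 subr0.
by apply/eqP; rewrite oner_eq0.
Qed.

Let locR : is_local R. Proof. by have [] := universal_in_Chat. Qed.

Lemma map_gram (A : Chat k) (rho : Defs.lift rhobar A) u :
  map_mx (ev rho) (gram ulam u) = gram (lam rho) u.
Proof. by apply/matrixP => j i; rewrite !mxE ev_ulam. Qed.

Lemma gram1_unit : gram ulam 1 \in unitmx.
Proof.
apply: (residue_unitmx locR); have [C [_ _ uD _]] := canonical_form rho0.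
have -> : map_mx (residue R) (gram ulam 1) = map_mx (residue T0) (gram (lam rho0) 1).
  by rewrite -map_gram; apply/matrixP => j i; rewrite !mxE aug_funP.
by have [] := Defs.map_mx_unit (residue T0) uD.
Qed.

Definition universal_mx (g : gT) : 'M[R]_n := invmx (gram ulam 1) *m gram ulam (galg_of W g).

Lemma map_universal_mx (A : Chat k) (rho : Defs.lift rhobar A) : exists C : 'M[A]_n,
  [/\ C \in unitmx, map_mx (residue A) C = 1%:M
    & forall g, map_mx (ev rho) (universal_mx g) = invmx C *m rho g *m C].
Proof.
have [C [uC C1 _ CE]] := canonical_form rho; exists C; split=> // g.
rewrite map_mxM; have [_ <-] := Defs.map_mx_unit (ev rho) gram1_unit.
by rewrite -CE; congr (invmx _ *m _); apply: map_gram.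
Qed.

Lemma map_ev_inj m1 m2 (M N : 'M[R]_(m1, m2)) :
    (forall (A : Chat k) (rho : Defs.lift rhobar A), map_mx (ev rho) M = map_mx (ev rho) N) ->
  M = N.
Proof.
move=> MN; apply/matrixP => i j; apply: ev_inj => A rho.
by have /matrixP/(_ i j) := MN A rho; rewrite !mxE.
Qed.

(** Under every [ev] the matrices become conjugate to those of a lift, and the maps [ev] are jointly
    injective. *)
Lemma universal_mx_repr : mx_repr [set: gT] universal_mx.
Proof.
split=> [|g h _ _]; apply: map_ev_inj => A rho;
  have [C [uC _ CE]] := map_universal_mx rho.
  by rewrite CE repr_mx1 mulmx1 mulVmx // map_mx1.
rewrite CE.
transitivity ((invmx C *m rho g *m C) *m (invmx C *m rho h *m C)).
  by rewrite repr_mxM ?inE // !mulmxA (mulmxK uC).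
by rewrite -(CE g) -(CE h); apply/esym/map_mxM.
Qed.

Definition universal_repr := MxRepresentation universal_mx_repr.

Lemma universal_liftP :
  {in [set: gT], forall g, map_mx (residue R) (universal_repr g) = rhobar g}.
Proof.
move=> g _; have [C [uC C1 CE]] := map_universal_mx rho0.
have -> : map_mx (residue R) (universal_repr g) =
    map_mx (residue T0) (map_mx (ev rho0) (universal_mx g)).
  by apply/matrixP => i j; rewrite !mxE (aug_funP (ev rho0)).
rewrite CE !map_mxM; have [_ <-] := Defs.map_mx_unit (residue T0) uC.
by rewrite C1 invmx1 mulmx1 mul1mx liftP ?inE.
Qed.

Definition universal_lift : Defs.lift rhobar R := Lift universal_liftP.

Lemma strict_equiv_universal (A : Chat k) (rho : Defs.lift rhobar A) :
  strict_equiv (lift_map (ev rho) universal_lift) rho.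
Proof.
have [C [uC C1 CE]] := map_universal_mx rho; exists C; split=> // g _.
rewrite [lift_map _ _ g](_ : _ = map_mx (ev rho) (universal_mx g)) // CE.
by rewrite !mulmxA mulmxV // mul1mx mulmxK.
Qed.

Lemma lam_lift_map (A : Chat k) (f : aug_hom R A) u : lam (lift_map f universal_lift) u =
  f (\tr (gop iota universal_lift e *m gop iota universal_lift u)).
Proof.
have fS : f \o iota =1 structure_map A.
  by apply: structure_map_unique => w; rewrite /= aug_funP universal_iota_res.
have gopE v : gop (structure_map A) (lift_map f universal_lift) v =
    map_mx f (gop iota universal_lift v).
  rewrite /gop raddf_sum; apply: eq_bigr => g _.
  by rewrite -fS; apply/esym/map_mxZ.
by rewrite /lam !gopE -map_mxM trace_map_mx.
Qed.

(** Both maps need only be compared on traces. In R the trace function of the universal lift is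
    [ulam], because this holds under every [ev]. *)
Lemma ev_universal (A : Chat k) (f : aug_hom R A) :
  ev (lift_map f universal_lift) =1 f.
Proof.
move=> y; have [u ->] := ulam_surj y.
rewrite ev_ulam lam_lift_map; congr (f _); apply: ev_inj => C rho.
rewrite -lam_lift_map ev_ulam.
exact/lam_strict_equiv/strict_equiv_universal.
Qed.

Lemma aug_hom_ext (A C : augRing k) (f g : aug_hom A C) : f =1 g -> f = g.
Proof.
case: f => -[f fc] fP; case: g => -[g gc] gP /= /funext fg; subst g.
case: fc fP => -[a] [b] fP; case: gc gP => -[a'] [b'] gP.
have ea : a = a' by apply: Prop_irrelevance.
have eb : b = b' by apply: Prop_irrelevance.
by subst a' b'; congr AugHom; apply: Prop_irrelevance.
Qed.

Local Open Scope quotient_scope.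

(** A morphism is sent to the image of the universal lift; the inverse sends a class to [ev] of a
    representative, well defined because traces are invariant under strict equivalence. *)
Lemma universal_represents : represents rhobar (MkChat universal_in_Chat).
Proof.
exists (fun A f => \pi_(Def rhobar A) (lift_map f universal_lift)); split=> [A|A C f h].
  exists (fun y => ev (generic_quotient.repr y)) => [f|y].
    apply: aug_hom_ext => u; rewrite -[RHS](ev_universal f).
    have /eqmodP/asboolP req := reprK (\pi_(Def rhobar A) (lift_map f universal_lift)).
    by have [v ->] := ulam_surj u; rewrite !ev_ulam; apply: lam_strict_equiv.
  rewrite -[RHS]reprK; apply/eqmodP/asboolP; exact: strict_equiv_universal.
rewrite Def_map_pi; apply/eqmodP/asboolP; exists 1%:M.
rewrite unitmx1 map_mx1; split=> // g _.
rewrite mul1mx invmx1 mulmx1; apply/matrixP => i j.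
by rewrite [LHS]mxE [RHS]mxE [in LHS]mxE.
Qed.

End UniversalRing.

End Representability.

Section Representability.
Variables (p s : nat) (k : finFieldType) (p_pr : prime p).
Hypotheses (s_gt0 : (0 < s)%N) (card_k : #|k| = (p ^ s)%N).
Local Notation W := (witt p_pr k).
Variables (gT : finGroupType) (n' : nat).
Variable rhobar : mx_representation k [set: gT] n'.+1.
Hypothesis span_rhobar :
  forall M : 'M[k]_n'.+1, exists c : gT -> k, M = \sum_g c g *: rhobar g.
Variables (T0 : Chat k) (rho0 : Defs.lift rhobar T0).
Hypothesis span_rho0 : forall M : 'M[T0]_n'.+1,
  exists u : galg W gT, M = gop (structure_map p_pr s_gt0 card_k T0) rho0 u.

Theorem span_lift_quotient : exists R : Chat k,
  represents rhobar R /\ exists f : aug_hom R T0, forall y, exists x, f x = y.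
Proof.
have [e [ee gop_e]] := exists_rank_one_idempotent p_pr s_gt0 card_k span_rhobar.
have /choice[U gop_U] := fun i => gop_rhobar_surj p_pr span_rhobar (delta_mx i 0).
have /choice[V gop_V] := fun j => gop_rhobar_surj p_pr span_rhobar (delta_mx 0 j).
pose dat (A : Chat k) rho := @datum p s k p_pr s_gt0 card_k gT n' rhobar e A rho.
pose Q (A : Chat k) (h : (W + gT)%type -> A) := exists rho, h = dat A rho.
pose r (i : (W + gT)%type) : k := match i with inl w => witt_res w
  | inr g => \tr (delta_mx 0 0 *m gop (@witt_res p p_pr k) rhobar (galg_of W g)) end.
have Q_res (A : Chat k) h i : Q A h -> residue A (h i) = r i.
  by move=> [rho ->]; case: i => [w|g] /=; [apply: structure_mapP | apply: lam_res].
have [R [x [hom_R inj_R ind_R]]] := universal_image Q_res (ex_intro _ rho0 erefl : Q T0 _).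
have ex_ev A rho := cid (hom_R A _ (ex_intro _ rho erefl : Q A _)).
pose ev A rho := projT1 (ex_ev A rho).
have evX A rho i : ev A rho (x i) = dat A rho i by apply: (projT2 (ex_ev A rho)).
have ev_inj (u v : R) : (forall A rho, ev A rho u = ev A rho v) -> u = v.
  move=> uv; apply: inj_R => A f [rho fE].
  have fev : f =1 ev A rho.
    apply: ind_R => [|a b|a b|i]; first by rewrite !rmorph1.
    - by rewrite !rmorphB => -> ->.
    - by rewrite !rmorphM => -> ->.
    by rewrite evX -fE.
  by rewrite !fev.
have [iota iotaE] := universal_structure_map evX ev_inj.
exists (MkChat (universal_in_Chat ee gop_e rho0 evX ev_inj ind_R iotaE)); split.
  exact: (universal_represents ee gop_e gop_U gop_V).
exists (ev T0 rho0) => y.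
pose op := gop (structure_map p_pr s_gt0 card_k T0) rho0.
have uE : op e 0 0 \is a GRing.unit.
  have [loc _ _] := ChatP T0; apply: loc.2; rewrite /max_ideal.
  have -> : residue T0 (op e 0 0) = map_mx (residue T0) (op e) 0 0 by rewrite [RHS]mxE.
  rewrite (residue_gop _ _ (@structure_mapP p s k p_pr s_gt0 card_k T0)) gop_e mxE.
  by apply/eqP; rewrite oner_eq0.
(* The trace of rho0(e) against a multiple of the matrix unit is that multiple of the corner entry
   of rho0(e), a unit; the chosen u thus has trace y. *)
have [u /esym uP] := span_rho0 ((y / op e 0 0) *: delta_mx 0 0).
exists (ulam x iota u); rewrite (ev_ulam evX iotaE) /lam -/op [op u]uP.
rewrite -scalemxAr mxtraceZ -(mul_delta_mx (0 : 'I_1) 0 0) mulmxA mxtrace_mulC -rowE -colE.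
by rewrite trace_mx11 !mxE divrK.
Qed.

End Representability.

(** * Square roots *)

(** Since s is even, #|k| = 4q + 1. The polynomial X^(2q) - 1 has too few roots to vanish at all
    nonzero c, so c^(2q) = -1 for some c, and c^q is the root. *)
Lemma finField_sqrtN1 (p s : nat) (k : finFieldType) : prime p -> odd p -> ~~ odd s ->
  #|k| = (p ^ s)%N -> (0 < s)%N -> exists c : k, c ^+ 2 = -1.
Proof.
move=> p_pr p_odd s_even card_k s_gt0.
have [q qE] : exists q, (#|k| = 4 * q + 1)%N.
  exists ((p ^ s) %/ 4)%N; rewrite card_k {1}(divn_eq (p ^ s) 4) mulnC; congr (_ + _)%N.
  rewrite -(odd_double_half s) (negPf s_even) add0n -muln2 mulnC expnM -modnXm.
  have -> : (p ^ 2 = 1 %[mod 4])%N; last by rewrite modnXm exp1n.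
  rewrite -(odd_double_half p) p_odd -mul2n.
  by rewrite (_ : ((1 + 2 * p./2) ^ 2 = (p./2 + p./2 ^ 2) * 4 + 1)%N) ?modnMDl //; ring.
have q_gt0 : (0 < q)%N by have := finNzRing_gt1 k; rewrite qE; lia.
have [c c0 cq] : exists2 c : k, c != 0 & c ^+ (2 * q) != 1.
  apply: contrapT => nc; pose P : {poly k} := 'X^(2 * q) - 1.
  have P0 : P != 0 by rewrite -size_poly_gt0 size_XnsubC // muln_gt0.
  have := max_poly_roots (rs := enum (predC1 (0 : k))) P0.
  rewrite enum_uniq -cardE cardC1 qE size_XnsubC ?muln_gt0 // => /(_ _ isT) H.
  suff /H : all (root P) (enum (predC1 (0 : k))) by lia.
  apply/allP => c; rewrite mem_enum inE => c0.
  rewrite /root !hornerE subr_eq0; apply: contrapT => /negP cq.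
  by apply: nc; exists c.
exists (c ^+ q); rewrite -exprM mulnC.
have : (c ^+ (2 * q)) ^+ 2 == 1.
  rewrite -exprM (_ : (2 * q * 2 = 4 * q)%N); last by lia.
  by apply/eqP/(mulIf c0); rewrite -exprSr mul1r -addn1 -qE expf_card.
by rewrite sqrf_eq1 (negPf cq) => /eqP.
Qed.

(** Newton's iteration with the fixed inverse h of 2 y0: the iterates stay congruent to y0 modulo p,
    so every step gains a factor p. *)
Lemma hensel_sqrt (p : nat) (R : comNzRingType) (x y0 h : R) :
    pcomplete p R -> pseparated p R -> h * (y0 *+ 2) = 1 -> pdvd p (y0 * y0 - x) ->
  exists y, y * y = x.
Proof.
move=> cR sR hE dy0; pose f (y : R) := y - (y * y - x) * h.
pose E n := iter n f y0.
have step n : pdvd p (E n - y0) /\ pdvd (p ^ n.+1) (E n * E n - x).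
  elim: n => [|n [[u uE] [d dE]]].
    by rewrite expn1; split; rewrite // subrr; exists 0; rewrite mul0rn.
  have {uE} yE : E n = y0 + u *+ p by rewrite -uE addrC subrK.
  split.
    exists (u - (d * h) *+ p ^ n); rewrite [E n.+1]/(f (E n)) /f dE {1}yE.
    by rewrite mulrnBl -mulrnA -expnSr mulrnAl addrAC [y0 + _]addrC addrK.
  have -> : E n.+1 * E n.+1 - x =
      (E n * E n - x) * (1 - h * (E n *+ 2)) + (E n * E n - x) * (E n * E n - x) * (h * h).
    by rewrite [E n.+1]/(f (E n)) /f; ring.
  rewrite dE yE mulrnDl [h * _]mulrDr hE opprD addrA subrr add0r.
  exists (- (d * (h * u *+ 2)) + (d * d) * (h * h) *+ p ^ n).
  by rewrite !expnS; set q := (p ^ n)%N; ring.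
have [|y dy] := pcomplete_lim (E := E) cR.
  move=> n; have [_ [d dE]] := step n; exists (- (d * h)).
  by rewrite [E n.+1]/(f (E n)) /f dE addrAC subrr add0r mulrnAl mulNrn.
exists y; apply/eqP; rewrite -subr_eq0; apply/eqP/sR => n.
apply: (@zpdvd_leq p _ n n.+1) => //.
have -> : y * y - x = (y - E n) * (y + E n) + (E n * E n - x) by ring.
by apply: zpdvdD; [apply: zpdvdMr | have [] := step n].
Qed.

Lemma witt_sqrt (p s : nat) (k : finFieldType) (p_pr : prime p) (s_gt0 : (0 < s)%N)
    (card_k : #|k| = (p ^ s)%N) (x : witt p_pr k) (c : k) :
  c *+ 2 != 0 -> witt_res x = c * c -> exists y, y * y = x.
Proof.
move=> c0 xc; pose y0 : witt p_pr k := Witt p_pr (fun i => if i == 0%N then c else 0).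
have y0c : witt_res y0 = c by [].
have [h hE] : exists h, h * (y0 *+ 2) = 1.
  by apply: (witt_unit s_gt0 card_k); rewrite rmorphMn [X in X *+ 2]y0c.
apply: hensel_sqrt (witt_pcomplete s_gt0 card_k) (witt_pseparated s_gt0 card_k) hE _.
apply: (witt_pdvd_res s_gt0 card_k).
have -> : witt_res (y0 * y0 - x) = witt_res y0 * witt_res y0 - witt_res x.
  by rewrite rmorphB rmorphM.
by rewrite xc y0c subrr.
Qed.

(** * Clifford algebras *)

(** By doubling: the old generators and omega become diag(M, -M), and two antidiagonal generators
    are added, i making the second one square to h. The last clause says that the gammas generate
    the full matrix algebra. *)
Lemma clifford_system (R : comNzRingType) (h i : R) (l : nat) :
    h + h = 1 -> i * i = -1 ->
  exists (gamma : nat -> 'M[R]_(2 ^ l)) (omega : 'M[R]_(2 ^ l)),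
    [/\ forall a, (a < 2 * l)%N -> gamma a *m gamma a = h%:M,
        forall a b, (a < 2 * l)%N -> (b < 2 * l)%N -> a != b ->
          gamma a *m gamma b = - (gamma b *m gamma a),
        omega *m omega = 1%:M,
        forall a, (a < 2 * l)%N -> omega *m gamma a = - (gamma a *m omega)
      & forall P : 'M[R]_(2 ^ l) -> Prop,
          (forall M N, P M -> P N -> P (M + N)) -> (forall c M, P M -> P (c *: M)) ->
          (forall M N, P M -> P N -> P (M *m N)) -> P 1%:M ->
          (forall a, (a < 2 * l)%N -> P (gamma a)) -> forall M, P M].
Proof.
move=> hh ii; elim: l => [|l [g [w [gg gC ww wg gP]]]].
  exists (fun=> 0), 1%:M; split=> //; first by rewrite mulmx1.
  move=> P _ PZ _ P1 _ M.
  by rewrite [M](mx11_scalar (M : 'M_1)) -scalemx1; apply: PZ.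
rewrite expnS mul2n -addnn; set N := (2 ^ l)%N in g w gg gC ww wg gP *.
pose alpha : 'M[R]_(N + N) := block_mx 0 1%:M h%:M 0.
pose beta : 'M[R]_(N + N) := block_mx 0 i%:M (- (i * h))%:M 0.
pose dup (M : 'M[R]_N) : 'M[R]_(N + N) := block_mx M 0 0 (- M).
pose g' b := if (b < 2 * l)%N then dup (g b) else if b == (2 * l)%N then alpha else beta.
have ltE b : (b < 2 * l.+1)%N ->
    [\/ (b < 2 * l)%N /\ g' b = dup (g b), b = (2 * l)%N /\ g' b = alpha
      | b = (2 * l).+1 /\ g' b = beta].
  rewrite /g' => ltb; case: ifP => [|/negbT geb]; first by constructor 1.
  case: eqP => [->|/eqP neb]; first by constructor 2.
  by constructor 3; split=> //; lia.
have dupM M M' : dup M *m dup M' = block_mx (M *m M') 0 0 (M *m M').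
  by rewrite mulmx_block !mulmx0 !mul0mx !addr0 add0r mulmxN mulNmx opprK.
have dupa M : dup M *m alpha = - (alpha *m dup M).
  rewrite !mulmx_block !mulmx0 !mul0mx !addr0 !add0r opp_block_mx oppr0 mulmx1 mul1mx.
  by rewrite opprK mulNmx scalar_mxC.
have dupb M : dup M *m beta = - (beta *m dup M).
  rewrite !mulmx_block !mulmx0 !mul0mx !addr0 !add0r opp_block_mx oppr0.
  by rewrite !mulmxN opprK mulNmx !scalar_mxC.
have ab : alpha *m beta = - (beta *m alpha).
  rewrite !mulmx_block !mulmx0 !mul0mx !addr0 !add0r opp_block_mx oppr0 mulmx1 mul1mx.
  by rewrite -!scalar_mxM -!raddfN /= opprK [h * i]mulrC.
have scalar_block c : (c%:M : 'M[R]_(N + N)) = block_mx c%:M 0 0 c%:M.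
  exact: scalar_mx_block.
exists g', (dup w); split.
- move=> b /ltE[[ltb ->]|[_ ->]|[_ ->]].
  + by rewrite dupM gg // scalar_block.
  + by rewrite mulmx_block !mulmx0 !mul0mx mulmx1 mul1mx !addr0 !add0r scalar_block.
  + rewrite mulmx_block !mulmx0 !mul0mx !addr0 !add0r scalar_block -!scalar_mxM.
    by rewrite mulrN mulrA ii mulN1r opprK mulNr mulrAC ii mulN1r opprK.
- move=> b c /ltE[[ltb ->]|[bE ->]|[bE ->]] /ltE[[ltc ->]|[cE ->]|[cE ->]] nbc //.
  + by rewrite !dupM gC // opp_block_mx !oppr0.
  + by rewrite dupa opprK.
  + by rewrite bE cE eqxx in nbc.
  + by rewrite dupb opprK.
  + by rewrite ab opprK.
  + by rewrite bE cE eqxx in nbc.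
- by rewrite dupM ww scalar_block.
- move=> b /ltE[[ltb ->]|[_ ->]|[_ ->]] //.
  by rewrite !dupM wg // opp_block_mx !oppr0.
move=> P PD PZ PM P1 Pg.
have Pa : P alpha.
  by have := Pg (2 * l)%N; rewrite /g' ltnn eqxx; apply; lia.
have Pb : P beta.
  have := Pg (2 * l).+1; rewrite /g' (_ : ((2 * l).+1 < 2 * l)%N = false); last by lia.
  by rewrite (_ : ((2 * l).+1 == 2 * l)%N = false); [apply; lia | lia].
(* U = h (alpha - i beta) and L = alpha + i beta are the off-diagonal block units, which move the
   upper left block to all other places. *)
pose U : 'M[R]_(N + N) := block_mx 0 1%:M 0 0.
pose L : 'M[R]_(N + N) := block_mx 0 0 1%:M 0.
have ibE : (- i) *: beta = block_mx 0 1%:M (- h%:M) 0.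
  rewrite scale_block_mx !scaler0 !scale_scalar_mx mulNr ii opprK.
  by rewrite mulNr mulrN opprK mulrA ii mulN1r raddfN.
have PU : P U.
  have -> : U = h *: (alpha + (- i) *: beta).
    rewrite ibE add_block_mx !addr0 subrr scale_block_mx !scaler0.
    by rewrite scalerDr -scalerDl hh scale1r.
  by apply: (PZ); apply: PD => //; apply: PZ.
have PL : P L.
  have -> : L = alpha + (-1) *: ((- i) *: beta).
    rewrite ibE scaleN1r opp_block_mx !oppr0 add_block_mx !addr0 subrr opprK.
    by rewrite -raddfD /= hh.
  by apply: PD => //; apply: (PZ); apply: PZ.
pose ul (M : 'M[R]_N) : 'M[R]_(N + N) := block_mx M 0 0 0.
have ULE : U *m L = ul 1%:M.
  by rewrite mulmx_block !mulmx0 !mul0mx mulmx1 !addr0 !add0r.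
(* Multiplication by U L = diag(1, 0) carries the generation statement for the smaller system to the
   upper left block. *)
have Pul M : P (ul M).
  apply: (gP (fun M => P (ul M))) => {M} [M M' PM1 PM2|c M PM1|M M' PM1 PM2||b ltb].
  - have -> : ul (M + M') = ul M + ul M' by rewrite add_block_mx !addr0.
    exact: PD.
  - have -> : ul (c *: M) = c *: ul M by rewrite scale_block_mx !scaler0.
    exact: PZ.
  - have -> : ul (M *m M') = ul M *m ul M'.
      by rewrite mulmx_block !mulmx0 !mul0mx !addr0.
    exact: PM.
  - by rewrite -ULE; apply: PM.
  have -> : ul (g b) = g' b *m ul 1%:M.
    by rewrite /g' ltb mulmx_block !mulmx0 !mul0mx mulmx1 !addr0.
  by apply: (PM); [apply: Pg; lia | rewrite -ULE; apply: PM].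
move=> M; rewrite -[M]submxK; set A := ulsubmx M; set B := ursubmx M.
set C := dlsubmx M; set D := drsubmx M.
have -> : block_mx A B C D = ul A + ul B *m U + (L *m ul C + L *m (ul D *m U)).
  by rewrite !mulmx_block !(mulmx0, mul0mx, mulmx1, mul1mx, addr0, add0r, add_block_mx).
exact: PD (PD _ _ (Pul A) (PM _ _ (Pul B) PU))
  (PD _ _ (PM _ _ PL (Pul C)) (PM _ _ PL (PM _ _ (Pul D) PU))).
Qed.

Section CliffordRoots.
Variables (R : comNzRingType) (A : comUnitRingType) (phi : {rmorphism R -> A}) (l : nat).
Variables (h i g kap : R) (z : A).
Hypotheses (hh : h + h = 1) (ii : i * i = -1) (gg : g * g *+ (2 * l).+1 = 1).
Hypotheses (kapl : kap *+ (2 * l) = g - 1) (kapg : kap * (g + 1) = - (g * g)).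
Hypothesis zz : z * z = l.+1%:R.
Local Notation N := (2 ^ l)%N.

(* The roots of a system of type A_(2l+1) through a fixed vertex: normalized vectors
   with pairwise scalar products 1/2. Their coordinates along gamma span a
   nondegenerate space of dimension 2l, the remaining one being g z omega. *)
Lemma clifford_roots : exists v : 'I_(2 * l).+1 -> 'M[A]_N,
  (forall a b, v a *m v b + v b *m v a = (1 + (a == b)%:R)%:M) /\
  (forall S : 'M[A]_N -> Prop,
     (forall M M', S M -> S M' -> S (M + M')) -> (forall c M, S M -> S (phi c *: M)) ->
     (forall M M', S M -> S M' -> S (M *m M')) -> S 1%:M -> (forall a, S (v a)) ->
   S z%:M /\ forall M, S (map_mx phi M)).
Proof.
have [gam [om [gg1 gC ww wg gP]]] := clifford_system l hh ii.
pose G a := map_mx phi (gam a); pose O := map_mx phi om.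
have GC (a b : 'I_(2 * l)) : G a *m G b + G b *m G a = (a == b)%:R%:M.
  case: (eqVneq a b) => [->|nab].
    by rewrite -!map_mxM gg1 // map_scalar_mx -raddfD -rmorphD hh rmorph1.
  by rewrite -!map_mxM gC // map_mxN addNr raddf0.
have OO : O *m O = 1%:M by rewrite -map_mxM ww map_mx1.
have OG (a : 'I_(2 * l)) : O *m G a = - (G a *m O) by rewrite -!map_mxM wg // map_mxN.
pose c := phi g * z; pose K := phi kap; pose g' := phi g.
(* The coordinates of the 2l + 1 vertices of a regular simplex centred at the origin, with scalar
   products delta_ab - g^2; the common component c along omega adds 2 c^2 = 1 + g^2. *)
pose cf (a : nat) (b : nat) : A := if (a < 2 * l)%N then (b == a)%:R + K else - g'.
pose vec (x : nat -> A) := \sum_(a < 2 * l) x a *: G a + c *: O.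
have vecC x y : vec x *m vec y + vec y *m vec x =
    (\sum_(a < 2 * l) x a * y a + c * c *+ 2)%:M.
  pose X (x : nat -> A) := \sum_(a < 2 * l) x a *: G a.
  have XX : X x *m X y + X y *m X x = (\sum_(a < 2 * l) x a * y a)%:M.
    rewrite /X !mulmx_suml raddf_sum.
    under eq_bigr do rewrite mulmx_sumr.
    under [X in _ + X]eq_bigr do rewrite mulmx_sumr.
    rewrite [X in _ + X]exchange_big -big_split; apply: eq_bigr => a _ /=.
    rewrite -big_split (bigD1 a) //= big1 => [|b nab].
      rewrite -!scalemxAl -!scalemxAr !scalerA [y a * _]mulrC -scalerDr GC eqxx.
      by rewrite addr0 scalemx1.
    rewrite -!scalemxAl -!scalemxAr !scalerA [y b * _]mulrC -scalerDr GC.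
    by rewrite eq_sym (negPf nab) raddf0 scaler0.
  have XO u : O *m X u = - (X u *m O).
    rewrite mulmx_sumr mulmx_suml -sumrN; apply: eq_bigr => a _.
    by rewrite -scalemxAr OG scalerN -scalemxAl.
  rewrite /vec -/(X x) -/(X y) !mulmxDl !mulmxDr.
  rewrite -!scalemxAl -!scalemxAr !XO OO !scalerN scalerA scalemx1.
  rewrite raddfD /= -XX mulr2n raddfD /=.
  move: (X x *m X y) (X y *m X x) (c *: (X x *m O)) (c *: (X y *m O)) (_%:M).
  move=> P1 P2 P3 P4 P5.
  rewrite [- P4 + P5]addrC [- P3 + P5]addrC ![_ + _ + (P5 - _)]addrACA.
  by rewrite [LHS]addrACA subrKA subrr addr0 addrACA.
pose v (a : 'I_(2 * l).+1) := vec (cf a).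
have Kl : K *+ (2 * l) = g' - 1 by rewrite -rmorphMn kapl rmorphB rmorph1.
have Kg : K * (g' + 1) = - (g' * g').
  by rewrite -[1](rmorph1 phi) -rmorphD -!rmorphM kapg rmorphN.
have gg' : g' * g' *+ (2 * l).+1 = 1 by rewrite -rmorphM -rmorphMn gg rmorph1.
have cc : c * c *+ 2 = g' * g' *+ (2 * l) + g' * g' *+ 2.
  have -> : c * c = g' * g' * (z * z) by rewrite /c -/g'; ring.
  by rewrite zz mulr_natr -mulrnA -mulrnDr; congr (_ *+ _); lia.
have sum_cf (a : nat) (y : nat -> A) : (a < 2 * l)%N ->
    \sum_(b < 2 * l) cf a b * y b = y a + K * \sum_(b < 2 * l) y b.
  move=> lta; rewrite /cf lta mulr_sumr.
  under eq_bigr do rewrite mulrDl.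
  rewrite big_split /= (bigD1 (Ordinal lta)) //= eqxx mul1r big1 ?addr0 // => b.
  by rewrite -val_eqE /= => /negPf ->; rewrite mul0r.
have sum1 (a : nat) : (a < 2 * l)%N -> \sum_(b < 2 * l) cf a b = g'.
  move=> lta; have := sum_cf a (fun=> 1) lta.
  under eq_bigr do rewrite mulr1.
  by move=> ->; rewrite sumr_const card_ord mulr_natr Kl addrC subrK.
have dotC (a b : nat) : (a < 2 * l)%N -> (b <= 2 * l)%N ->
    \sum_(d < 2 * l) cf a d * cf b d = (a == b)%:R - g' * g'.
  move=> lta; rewrite leq_eqVlt => /orP[/eqP->|ltb].
    rewrite (ltn_eqF lta) sum_cf // /cf ltnn sumr_const card_ord.
    have -> : K * (- g' *+ (2 * l)) = - ((K *+ (2 * l)) * g').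
      by rewrite mulrnAr mulrN mulrnAl mulNrn.
    by rewrite Kl mulr0n; ring.
  rewrite sum_cf // sum1 // /cf ltb -addrA (_ : K + K * g' = K * (g' + 1)); last by ring.
  by rewrite Kg.
exists v; split=> [a b|S SD SZ SM S1 Sv].
  rewrite vecC cc; congr (_%:M).
  have gE : g' * g' *+ (2 * l) + g' * g' *+ 2 = 1 + g' * g'.
    by rewrite -mulrnDr addn2 mulrSr gg'.
  have [lta|] := boolP (a < 2 * l)%N.
    have leb : (b <= 2 * l)%N by rewrite -ltnS.
    by rewrite (dotC a b lta leb) gE addrCA subrK.
  rewrite -leqNgt => lea; have aE : a = (2 * l)%N :> nat by have := ltn_ord a; lia.
  have [ltb|] := boolP (b < 2 * l)%N.
    rewrite (eq_bigr (fun d : 'I_(2 * l) => cf b d * cf a d)) => [|d _]; last exact: mulrC.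
    have leb : (a <= 2 * l)%N by rewrite aE.
    by rewrite (dotC b a ltb leb) gE addrCA subrK eq_sym.
  rewrite -leqNgt => leb; have bE : b = (2 * l)%N :> nat by have := ltn_ord b; lia.
  rewrite -val_eqE /= aE bE eqxx /cf ltnn sumr_const card_ord mulrNN.
  by rewrite gE addrCA -mulrSr gg'.
have SB M M' : S M -> S M' -> S (M - M').
  by move=> SM1 SM2; apply: SD => //; rewrite -scaleN1r -(rmorph1 phi) -rmorphN; apply: SZ.
pose sig := \sum_(a < 2 * l) G a.
have vE (a : 'I_(2 * l)) : v (widen_ord (leqnSn _) a) = G a + K *: sig + c *: O.
  rewrite /v /vec /= /cf ltn_ord; congr (_ + _); rewrite scaler_sumr.
  under eq_bigr do rewrite scalerDl.
  rewrite big_split /= (bigD1 a) //= eqxx scale1r big1 ?addr0 // => b.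
  by rewrite -val_eqE => /negPf ->; rewrite scale0r.
have vmE : v ord_max = - g' *: sig + c *: O.
  by rewrite /v /vec /= /cf ltnn scaler_sumr.
have SzO : S (z *: O).
  (* The vertices of the simplex sum to zero, so the sum of the v_a is (2l + 1) g z omega, and g^2
     (2l + 1) = 1. *)
  have -> : z *: O = phi g *: \sum_a v a.
    rewrite big_ord_recr /= vmE; under eq_bigr do rewrite vE.
    rewrite !big_split /= -/sig !sumr_const card_ord scaleNr.
    rewrite [_ *: sig *+ _]scalerMnl Kl scalerBl scale1r.
    have E (P1 P2 P3 P4 : 'M[A]_N) : P1 + (P2 - P1) + P3 + (- P2 + P4) = P3 + P4.
      by rewrite [P1 + _]addrC subrK [P2 + P3]addrC -addrA addNKr.
    rewrite E -mulrSr scalerMnl scalerA.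
    have -> : phi g * (c *+ (2 * l).+1) = (g' * g' *+ (2 * l).+1) * z.
      by rewrite /c -/g' mulrnAr mulrnAl mulrA.
    by rewrite gg' mul1r.
  by apply: SZ; elim/big_ind: _ => //; rewrite -(subrr 1%:M); apply: SB.
have ScO : S (c *: O) by rewrite /c -scalerA; apply: SZ.
have Ssig : S sig.
  have -> : sig = phi (g *+ (2 * l).+1) *: (c *: O - v ord_max).
    rewrite vmE opprD addrCA subrr addr0 -scaleNr opprK scalerA rmorphMn /= -/g'.
    by rewrite mulrnAl gg' scale1r.
  by apply: SZ; apply: SB.
have SG a : (a < 2 * l)%N -> S (G a).
  move=> lta; have -> : G a = v (widen_ord (leqnSn _) (Ordinal lta)) - K *: sig - c *: O.
    by rewrite vE addrAC !addrK.
  by apply: (SB) => //; apply: (SB) => //; apply: SZ.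
have Smap M : S (map_mx phi M).
  apply: (gP (fun M => S (map_mx phi M))) => {M} [M M' SM1 SM2|d M SM1|M M' SM1 SM2||//].
  - by rewrite map_mxD; apply: SD.
  - by rewrite map_mxZ; apply: SZ.
  - by rewrite map_mxM; apply: SM.
  by rewrite map_mx1.
split=> //.
have -> : z%:M = (z *: O) *m O by rewrite -scalemxAl OO scalemx1.
by apply: SM => //; apply: Smap.
Qed.

End CliffordRoots.

(** * The group generated by the roots *)

Section Words.
Variables (A : comNzRingType) (I : Type) (n : nat) (v : I -> 'M[A]_n).

Definition wprod (s : seq I) : 'M[A]_n := foldr (fun i M => v i *m M) 1%:M s.

Lemma wprod_cat s t : wprod (s ++ t) = wprod s *m wprod t.
Proof. by elim: s => [|i s IHs] /=; rewrite ?mul1mx // IHs mulmxA. Qed.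

Lemma wprod1 i : wprod [:: i] = v i.
Proof. exact: mulmx1. Qed.

Lemma wprod_rev s : (forall i, v i *m v i = 1%:M) -> wprod s *m wprod (rev s) = 1%:M.
Proof.
move=> vv; elim: s => [|i s IHs] /=; first by rewrite mulmx1.
by rewrite rev_cons -cats1 wprod_cat wprod1 -mulmxA (mulmxA (wprod s)) IHs mul1mx.
Qed.

End Words.

Lemma map_wprod (A C : comNzRingType) (f : {rmorphism A -> C}) (I : Type) n
    (v : I -> 'M[A]_n) s :
  map_mx f (wprod v s) = wprod (fun i => map_mx f (v i)) s.
Proof. by elim: s => [|i s IHs] /=; rewrite ?map_mx1 // map_mxM IHs. Qed.

Section RootWords.
Variables (k : fieldType) (A : augRing k) (locA : is_local A).
Variables (I : finType) (n' : nat) (v : I -> 'M[A]_n'.+1).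
Hypothesis rootv : forall a b, v a *m v b + v b *m v a = (1 + (a == b)%:R)%:M.
Hypothesis cardI : (3 < #|I|)%N.
Hypothesis centv : forall M, (forall a, M *m v a = v a *m M) -> exists c, M = c%:M.
Hypotheses (two_neq0 : (2%:R : k) != 0) (n_neq0 : (n'.+1%:R : k) != 0).

Lemma natr_unit m : (m%:R : k) != 0 -> (m%:R : A) \is a GRing.unit.
Proof. by move=> m0; apply: locA.2; rewrite /max_ideal rmorph_nat; apply/eqP. Qed.

Lemma root_sqr a : v a *m v a = 1%:M.
Proof.
have : 2%:R *: (v a *m v a) = 2%:R *: 1%:M.
  by rewrite [LHS]scaler_nat mulr2n rootv eqxx scalemx1.
move/(congr1 (fun M => (2%:R)^-1 *: M)).
by rewrite !scalerA (mulVr (natr_unit two_neq0)) !scale1r.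
Qed.

(** [None] stands for the fixed vertex, placed at the origin, so that all roots of the system are
    differences [w i - w j]. *)
Let w (o : option I) : 'M[A]_n'.+1 := if o is Some a then v a else 0.

(** Conjugation by v_c is the negative of the reflection in v_c. On differences of vertices the
    translation by v_c cancels, and the roots are permuted through a transposition. *)
Lemma root_reflect c o : v c *m w o *m v c = v c - w (tperm None (Some c) o).
Proof.
case: o => [a|] /=; last by rewrite mulmx0 mul0mx tpermL subrr.
have [->|nac] := eqVneq a c; first by rewrite tpermR root_sqr mul1mx subr0.
rewrite tpermD //=; last by apply: contraNneq nac => -[->].
have := rootv c a; rewrite eq_sym (negPf nac) addr0 => /esym/eqP.
rewrite -subr_eq => /eqP <-.
by rewrite mulmxBl mul1mx -mulmxA root_sqr mulmx1.
Qed.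

Lemma wprod_conj s a : exists i j : option I,
  i != j /\ wprod v s *m v a *m wprod v (rev s) = w i - w j.
Proof.
elim: s => [|c s [i [j [nij E]]]].
  by exists (Some a), None; rewrite /= mul1mx mulmx1 subr0.
exists (tperm None (Some c) j), (tperm None (Some c) i); split.
  by rewrite (inj_eq perm_inj) eq_sym.
rewrite rev_cons -cats1 wprod_cat wprod1 /=.
have -> : v c *m wprod v s *m v a *m (wprod v (rev s) *m v c) =
    v c *m (wprod v s *m v a *m wprod v (rev s)) *m v c by rewrite !mulmxA.
by rewrite E mulmxBr mulmxBl !root_reflect opprB addrC subrKA.
Qed.

(** Roots are told apart over k by their scalar products with the v_b. More than three indices allow
    a b distinct from all those involved. *)
Lemma root_separated i j a : i != j ->
  map_mx (residue A) (w i - w j) = map_mx (residue A) (v a) -> i = Some a /\ j = None.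
Proof.
pose beta (o : option I) (b : I) : k := if o is Some c then 1 + (c == b)%:R else 0.
have wE o b : map_mx (residue A) (w o) *m map_mx (residue A) (v b) +
    map_mx (residue A) (v b) *m map_mx (residue A) (w o) = (beta o b)%:M.
  rewrite -!map_mxM -map_mxD; case: o => [c|] /=.
    by rewrite rootv map_scalar_mx rmorphD rmorph1 rmorph_nat.
  by rewrite mulmx0 mul0mx addr0 raddf0 -scalemx1 scale0r.
move=> nij E; have {}E b : beta i b - beta j b = 1 + (a == b)%:R.
  have : (beta i b - beta j b)%:M = (beta (Some a) b)%:M :> 'M[k]_n'.+1.
    have -> : (beta i b - beta j b)%:M = (beta i b)%:M - (beta j b)%:M :> 'M[k]_n'.+1.
      by rewrite raddfB.
    rewrite -(wE i) -(wE j) -(wE (Some a)) -E map_mxB mulmxBl mulmxBr.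
    by rewrite opprD addrACA.
  by move/matrixP/(_ 0 0); rewrite !mxE !mulr1n.
have ex_b (x y z : I) : exists b, [/\ b != x, b != y & b != z].
  have ltI : (#|[set x; y; z]| < #|I|)%N.
    apply: leq_ltn_trans cardI; rewrite (leq_trans (leq_card_setU _ _)) //.
    by rewrite cards1 cards2; case: (x != y).
  apply: contrapT => nb; move: ltI; rewrite ltnNge -cardsT subset_leq_card //.
  apply/subsetP => b _; rewrite !inE -!orbA; apply: contrapT => nxyz; apply: nb.
  by exists b; case/negP/norP: nxyz => bx /norP[].
case: i j nij E => [c|] [d|] //= nij E.
- have [b [bc bd ba]] := ex_b c d a; have := E b.
  rewrite ![_ == b]eq_sym (negPf bc) (negPf bd) (negPf ba) subrr addr0 => /eqP.
  by rewrite eq_sym oner_eq0.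
- have := E c; rewrite eqxx subr0 => /addrI; case: (eqVneq a c) => [->|_] // /eqP.
  by rewrite oner_eq0.
have [b [bd _ ba]] := ex_b d d a; have := E b.
rewrite ![_ == b]eq_sym (negPf bd) (negPf ba) addr0 sub0r => /eqP.
by rewrite eq_sym -subr_eq0 opprK -mulr2n (negPf two_neq0).
Qed.

Lemma det_wprod_sqr s : \det (wprod v s) ^+ 2 = 1.
Proof.
elim: s => [|a s IHs] /=; first by rewrite det1 expr1n.
by rewrite det_mulmx exprMn IHs mulr1 expr2 -det_mulmx root_sqr det1.
Qed.

(* A word congruent to 1 modulo the maximal ideal permutes the roots without moving any
   of them, hence is a scalar, whose 2n-th power is 1. *)
Lemma wprod_eq1 s : map_mx (residue A) (wprod v s) = 1%:M -> wprod v s = 1%:M.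
Proof.
move=> s1; have ss' := wprod_rev s root_sqr.
have s's := wprod_rev (rev s) root_sqr; rewrite revK in s's.
have s'1 : map_mx (residue A) (wprod v (rev s)) = 1%:M.
  by rewrite -[LHS]mul1mx -{1}s1 -map_mxM ss' map_mx1.
have [|c cE] := centv (M := wprod v s).
  move=> a; have [i [j [nij E]]] := wprod_conj s a.
  have [|ia j0] := root_separated (a := a) nij.
    by rewrite -E !map_mxM s1 s'1 mul1mx mulmx1.
  move: E; rewrite ia j0 subr0 => E.
  by rewrite -[LHS]mulmx1 -s's mulmxA E.
have c1 : residue A c = 1.
  by move/matrixP/(_ 0 0): s1; rewrite cE map_scalar_mx !mxE !mulr1n.
have := det_wprod_sqr s; rewrite cE det_scalar -exprM => /eqP.
rewrite -subr_eq0 subrX1 => /eqP c0; congr (_%:M); apply/eqP; rewrite -subr_eq0.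
(* The cofactor of c - 1 in c^(2n) - 1 reduces to 2n, which is nonzero in k. *)
have u : \sum_(i < n'.+1 * 2) c ^+ i \is a GRing.unit.
  apply: locA.2; rewrite /max_ideal rmorph_sum.
  rewrite (eq_bigr (fun=> 1)) => [|i _]; last by rewrite rmorphXn /= c1 expr1n.
  by rewrite sumr_const card_ord natrM; apply/eqP; rewrite mulf_neq0.
by rewrite -[c - 1](mulrK u) c0 mul0r.
Qed.

Lemma wprod_inj s t :
  map_mx (residue A) (wprod v s) = map_mx (residue A) (wprod v t) -> wprod v s = wprod v t.
Proof.
move=> st; have t't := wprod_rev (rev t) root_sqr; rewrite revK in t't.
have : wprod v (s ++ rev t) = 1%:M.
  apply: wprod_eq1; rewrite wprod_cat map_mxM st -map_mxM.
  by rewrite wprod_rev ?map_mx1 //; apply: root_sqr.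
rewrite wprod_cat => st'.
by rewrite -[LHS]mulmx1 -t't mulmxA st' mul1mx.
Qed.

End RootWords.

(** A representation spanning over T reduces to one spanning over k, and [span_lift_quotient]
    applies to that reduction with [rho] as its lift. *)
Lemma frakQ_of_span (p s : nat) (k : finFieldType) (p_pr : prime p) (s_gt0 : (0 < s)%N)
    (card_k : #|k| = (p ^ s)%N) (T : Chat k) (phi : {rmorphism witt p_pr k -> T})
    (gT : finGroupType) (n' : nat) (rho : mx_representation T [set: gT] n'.+1) :
    (forall w, residue T (phi w) = witt_res w) ->
    (forall M : 'M[T]_n'.+1, exists u : galg (witt p_pr k) gT, M = gop phi rho u) ->
  frakQ T.
Proof.
move=> rphi span; split; first exact: ChatP.
pose rhobar := map_repr (residue T) rho.
have rhoP : {in [set: gT], forall g, map_mx (residue T) (rho g) = rhobar g} by [].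
pose rho0 : Defs.lift rhobar T := Lift rhoP.
have span0 (M : 'M[T]_n'.+1) :
    exists u : galg (witt p_pr k) gT, M = gop (structure_map p_pr s_gt0 card_k T) rho0 u.
  have [u ->] := span M; exists u; apply: eq_bigr => g _; congr (_ *: _).
  exact: structure_map_unique.
have spanbar (M : 'M[k]_n'.+1) : exists c : gT -> k, M = \sum_g c g *: rhobar g.
  have [loc _ _] := ChatP T; have /choice[h hK] := loc.1.
  have [u uE] := span (map_mx h M); exists (fun g => witt_res (u g)).
  have -> : M = map_mx (residue T) (map_mx h M).
    by apply/matrixP => i j; rewrite !mxE hK.
  rewrite uE /gop raddf_sum; apply: eq_bigr => g _.
  by rewrite -rphi; apply: map_mxZ.
have [R [repR surR]] := span_lift_quotient spanbar span0.
exists R; split=> //.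
by exists gT, [set: gT]%G, n'.+1, rhobar.
Qed.

(* A set of matrices reducing injectively modulo the maximal ideal and closed under
   products is a representation of its reduction, a finite group. *)
Section WordGroup.
Variables (p s : nat) (k : finFieldType) (p_pr : prime p).
Hypotheses (s_gt0 : (0 < s)%N) (card_k : #|k| = (p ^ s)%N).
Variables (T : Chat k) (phi : {rmorphism witt p_pr k -> T}).
Hypothesis rphi : forall w, residue T (phi w) = witt_res w.
Variables (I : finType) (n' : nat) (v : I -> 'M[T]_n'.+1).
Hypothesis vv : forall a, v a *m v a = 1%:M.
Hypothesis v_inj : forall s t : seq I,
  map_mx (residue T) (wprod v s) = map_mx (residue T) (wprod v t) -> wprod v s = wprod v t.
Hypothesis v_gen : forall S : 'M[T]_n'.+1 -> Prop,
  (forall M M', S M -> S M' -> S (M + M')) -> (forall c M, S M -> S (phi c *: M)) ->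
  (forall M M', S M -> S M' -> S (M *m M')) -> S 1%:M -> (forall a, S (v a)) ->
  forall M, S M.

Local Notation vb := (fun a => map_mx (residue T) (v a)).

Definition word_set : {set {unit 'M[k]_n'.+1}} :=
  [set x | `[< exists t, FinRing.uval x = wprod vb t >]].

Lemma word_group_set : group_set word_set.
Proof.
apply/group_setP; split=> [|x y]; first by rewrite inE; apply/asboolP; exists [::].
rewrite !inE => /asboolP[t xE] /asboolP[u yE]; apply/asboolP; exists (t ++ u).
by rewrite wprod_cat -xE -yE.
Qed.

Canonical word_group := group word_group_set.
Local Notation gT := (subg_of word_group).

Lemma word_ex (x : gT) : exists t, FinRing.uval (sgval x) = wprod vb t.
Proof. by have := subgP x; rewrite inE => /asboolP. Qed.

Definition word_of (x : gT) : seq I := projT1 (cid (word_ex x)).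

Lemma word_ofP x : FinRing.uval (sgval x) = wprod vb (word_of x).
Proof. exact: projT2 (cid (word_ex x)). Qed.

(** The choice of a word for each group element is harmless: by [v_inj] words with the same
    reduction have the same product. *)
Lemma word_rep_repr : mx_repr [set: gT] (fun x => wprod v (word_of x)).
Proof.
split=> [|x y _ _].
  by apply: (v_inj (t := [::])); rewrite !map_wprod -word_ofP.
by rewrite -wprod_cat; apply: v_inj; rewrite !map_wprod -word_ofP wprod_cat -!word_ofP.
Qed.

Definition word_rep := MxRepresentation word_rep_repr.

Lemma word_rep_root a : exists x, word_rep x = v a.
Proof.
have u : vb a \is a GRing.unit.
  by apply/unitrP; exists (vb a); rewrite -[_ * _]map_mxM vv map_mx1.
have xG : FinRing.unit 'M[k]_n'.+1 u \in word_set.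
  by rewrite inE; apply/asboolP; exists [:: a]; rewrite wprod1.
have [x xE] : exists x : gT, FinRing.uval (sgval x) = vb a.
  by exists (subg word_group (FinRing.unit 'M[k]_n'.+1 u)); rewrite subgK.
exists x; rewrite -[RHS]wprod1; apply: v_inj.
by rewrite !map_wprod -word_ofP xE wprod1.
Qed.

Lemma frakQ_of_words : frakQ T.
Proof.
apply: (frakQ_of_span s_gt0 card_k (rho := word_rep) rphi).
apply: v_gen => [_ _ [u ->] [w ->]|c _ [u ->]|_ _ [u ->] [w ->]||a].
- by exists (u + w); rewrite raddfD.
- by exists [ffun g => c * u g]; rewrite gopZ.
- by exists (u * w); rewrite gopM.
- by exists 1; rewrite gop1.
have [x <-] := word_rep_root a.
by exists (galg_of (witt p_pr k) x); rewrite gop_of.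
Qed.

End WordGroup.

(** * The theorem *)

Lemma central_mx_scalar (R : comNzRingType) n (M : 'M[R]_n.+1) :
  (forall N, M *m N = N *m M) -> exists c, M = c%:M.
Proof.
move=> MC; exists (M 0 0); apply/matrixP => i j.
have /matrixP/(_ i 0) := MC (delta_mx j 0).
rewrite !mxE (bigD1 j) //= big1 => [|a aj]; last by rewrite mxE (negPf aj) mulr0.
rewrite (bigD1 0) //= big1 => [|a a0]; last by rewrite mxE (negPf a0) andbF mul0r.
by rewrite !mxE !eqxx mulr1 !addr0 andbT => ->; case: (i == j); rewrite ?mul1r ?mul0r.
Qed.

Section Final.
Variables (p s : nat) (k : finFieldType) (p_pr : prime p).
Hypotheses (s_gt0 : (0 < s)%N) (card_k : #|k| = (p ^ s)%N).
Local Notation W := (witt p_pr k).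

Let T : Chat k := MkChat (XpX_in_Chat p_pr s_gt0 card_k).
Let phi : {rmorphism W -> T} := XpX_const k p_pr.
Let X : T := XpX_X k p_pr.
Let XX : X * X = X *+ p. Proof. exact: XpX_rel. Qed.

Lemma XpX_mx_gens n (M : 'M[T]_n) : exists M0 M1 : 'M[W]_n,
  M = map_mx phi M0 + X *: map_mx phi M1.
Proof.
have /choice[a /choice[b abP]] := XpX_gens s_gt0 card_k (p_pr := p_pr).
exists (map_mx a M), (map_mx b M); apply/matrixP => i j.
by rewrite !mxE {1}(abP (M i j)) [X * _]mulrC.
Qed.

Lemma frakQ_two : p = 2%N -> frakQ (XpX_ring p_pr k).
Proof.
move=> p2; pose u : T := 1 - X.
have uu : u * u = 1.
  have -> : u * u = 1 - X *+ 2 + X * X by rewrite /u; ring.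
  by rewrite XX p2 subrK.
pose r (g : {perm bool}) : 'M[T]_1 := (if odd_perm g then u else 1)%:M.
have rP : mx_repr [set: {perm bool}] r.
  split=> [|g h _ _]; first by rewrite /r odd_perm1.
  rewrite /r odd_permM -scalar_mxM; congr (_%:M).
  by case: (odd_perm g); case: (odd_perm h); rewrite ?mulr1 ?mul1r ?uu.
apply: (@frakQ_of_span p s k p_pr s_gt0 card_k T phi _ _ (MxRepresentation rP)).
  exact: XpX_const_res.
move=> M; have [M0 [M1 ->]] := XpX_mx_gens M.
pose t : {perm bool} := tperm true false.
(* This is a + bX = (a + b) - b (1 - X), where the transposition acts as 1 - X. *)
exists ([ffun g => (M0 0 0 + M1 0 0) * galg_of W 1%g g] + [ffun g => - M1 0 0 * galg_of W t g]).
rewrite raddfD /= !gopZ !gop_of /= /r odd_perm1 odd_tperm /=.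
apply/matrixP => i j; rewrite !ord1 !mxE !mulr1n rmorphD rmorphN /u; ring.
Qed.

Hypotheses (p_odd : odd p) (s_even : ~~ odd s).

Lemma two_neq0 : (2%:R : k) != 0.
Proof.
apply/eqP => two0; have /eqP := card_natr0 p_pr card_k.
by rewrite -(odd_double_half p) p_odd -muln2 natrD natrM two0 mulr0 addr0 oner_eq0.
Qed.

(** The 2l + 1 = 2 p^2 - 1 roots through a vertex belong to A_(n-1) with n = 2 p^2, and l + 1 = p^2
    is the square of p - 2X in T. *)
Let l := (p ^ 2).-1.

Let p2E : l.+1 = (p ^ 2)%N. Proof. by rewrite prednK // expn_gt0 prime_gt0. Qed.

Let l1 : (l.+1%:R : k) = 0.
Proof. by rewrite p2E natrX (card_natr0 p_pr card_k) expr0n. Qed.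

(** As l + 1 vanishes in k, 2l + 1 reduces to -1, a square, and 2l to -2, a unit. So g is the
    inverse of a square root of 2l + 1 and kap = (g - 1)/(2l); the last equation follows from g^2 -
    1 = -2l g^2. *)
Lemma clifford_constants : exists h i g kap : W,
  [/\ h + h = 1, i * i = -1, g * g *+ (2 * l).+1 = 1, kap *+ (2 * l) = g - 1
    & kap * (g + 1) = - (g * g)].
Proof.
have [c cc] := finField_sqrtN1 p_pr p_odd s_even card_k s_gt0.
have c2 : c *+ 2 != 0.
  rewrite -mulr_natl mulf_neq0 ?two_neq0 // -sqrf_eq0 cc oppr_eq0; exact: oner_neq0.
have resn m : witt_res (m%:R : W) = m%:R by rewrite rmorph_nat.
have [h hE] : exists h, h * (2%:R : W) = 1.
  by apply: (witt_unit s_gt0 card_k); rewrite resn two_neq0.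
have [i iE] : exists i, i * i = (-1 : W).
  apply: (witt_sqrt s_gt0 card_k c2).
  by rewrite rmorphN rmorph1 -expr2 cc.
have [y yE] : exists y, y * y = ((2 * l).+1%:R : W).
  apply: (witt_sqrt s_gt0 card_k c2); rewrite resn -expr2 cc.
  apply/eqP; rewrite -addr_eq0 -mulrSr (_ : (2 * l).+2 = (2 * l.+1)%N); last by lia.
  by rewrite natrM l1 mulr0.
have [g gE] : exists g, g * y = 1.
  apply: (witt_unit s_gt0 card_k); apply/eqP => y0.
  have := congr1 (@witt_res p p_pr k) yE; rewrite rmorphM [X in X * _]y0 mul0r.
  move/esym; rewrite resn => /eqP; rewrite -[_.+1]addn1 natrD.
  rewrite (_ : (2 * l)%:R = -2%:R :> k) => [|].
    by rewrite mulr2n opprD -addrA addNr addr0 oppr_eq0 oner_eq0.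
  apply/eqP; rewrite -addr_eq0 -natrD (_ : (2 * l + 2 = 2 * l.+1)%N); last by lia.
  by rewrite natrM l1 mulr0.
have [d dE] : exists d, d * ((2 * l)%:R : W) = 1.
  apply: (witt_unit s_gt0 card_k); rewrite resn.
  rewrite (_ : (2 * l)%:R = -2%:R :> k) ?oppr_eq0 ?two_neq0 //.
  apply/eqP; rewrite -addr_eq0 -natrD (_ : (2 * l + 2 = 2 * l.+1)%N); last by lia.
  by rewrite natrM l1 mulr0.
have gg : g * g *+ (2 * l).+1 = 1.
  by rewrite -mulr_natr -yE mulrACA gE mulr1.
exists h, i, g, ((g - 1) * d); split=> //.
- by rewrite -hE; ring.
- by rewrite -mulr_natr -mulrA dE mulr1.
have -> : (g - 1) * d * (g + 1) = (g * g - 1) * d by ring.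
have -> : g * g - 1 = - (g * g * (2 * l)%:R) 
  by rewrite -[X in _ - X]gg mulrSr opprD addrCA subrr addr0 mulr_natr.
transitivity (- (g * g) * (d * (2 * l)%:R)); last by rewrite dE mulr1.
by move: ((2 * l)%:R : W) => q; ring.
Qed.

Lemma frakQ_odd : frakQ (XpX_ring p_pr k).
Proof.
have [h [i [g [kap [hh ii gg kapl kapg]]]]] := clifford_constants.
pose z : T := p%:R - X *+ 2.
have zz : z * z = l.+1%:R.
  have -> : z * z = p%:R * p%:R - p%:R * X *+ 4 + X * X *+ 4 by rewrite /z; ring.
  by rewrite XX -[X *+ p]mulr_natl subrK p2E natrX expr2.
have [n' nE] : exists n', (2 ^ l)%N = n'.+1.
  by exists (2 ^ l).-1; rewrite prednK // expn_gt0.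
have := clifford_roots phi hh ii gg kapl kapg zz; rewrite nE => -[v [rootv genv]].
have v_gen (S : 'M[T]_n'.+1 -> Prop) :
  (forall M M', S M -> S M' -> S (M + M')) -> (forall c M, S M -> S (phi c *: M)) ->
  (forall M M', S M -> S M' -> S (M *m M')) -> S 1%:M -> (forall a, S (v a)) ->
  forall M, S M.
  move=> SD SZ SM S1 Sv M; have [Sz Smap] := genv S SD SZ SM S1 Sv.
  have [M0 [M1 ->]] := XpX_mx_gens M; apply: (SD) => //.
  (* X is recovered from z as h (p - z), where h is one half. *)
  have -> : X *: map_mx phi M1 =
      (phi h *: (phi p%:R *: 1%:M + phi (-1) *: z%:M)) *m map_mx phi M1.
    rewrite -[z%:M]scalemx1 scalerA -scalerDl scalerA -scalemxAl mul1mx; congr (_ *: _).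
    rewrite rmorph_nat rmorphN rmorph1 /z.
    have -> : phi h * (p%:R + -1 * (p%:R - X *+ 2)) = (phi h + phi h) * X by ring.
    by rewrite -rmorphD hh rmorph1 mul1r.
  by apply: (SM) => //; apply: (SZ); apply: (SD); apply: (SZ).
have locT : is_local T by have [] := ChatP T.
have centv M : (forall a, M *m v a = v a *m M) -> exists c, M = c%:M.
  move=> MC; apply: central_mx_scalar; apply: v_gen => [N N' E E'|c N E|N N' E E'||//].
  - by rewrite mulmxDr mulmxDl E E'.
  - by rewrite -scalemxAr -scalemxAl E.
  - by rewrite mulmxA E -mulmxA E' mulmxA.
  by rewrite mulmx1 mul1mx.
have n0 : (n'.+1%:R : k) != 0 by rewrite -nE natrX expf_neq0 ?two_neq0.
have cardI : (3 < #|'I_(2 * l).+1|)%N.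
  rewrite card_ord; have : (2 ^ 2 <= p ^ 2)%N by rewrite leq_exp2r // prime_gt1.
  by rewrite -p2E; lia.
apply: (frakQ_of_words s_gt0 card_k (phi := phi) _ _ _ v_gen).
- exact: XpX_const_res.
- exact: (root_sqr locT rootv two_neq0).
exact: (wprod_inj locT rootv cardI centv two_neq0 n0).
Qed.

End Final.

Local Close Scope ring_scope.

Theorem theorem4p8 (p s : nat) (k : finFieldType) (p_pr : prime p)
    (s_gt0 : 0 < s) (s_even : ~~ odd s) (card_k : #|k| = p ^ s) :
  frakQ (k := k) (XpX_ring p_pr k).
Proof.
have [p2|p_odd] := even_prime p_pr; first exact: frakQ_two s_gt0 card_k p2.
exact: frakQ_odd s_gt0 card_k p_odd s_even.
Qed.
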